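(* Consider the nonparametric $p$-value model of the context with shape functions $h_{n,i}$, shrinking parameters $\kappa_{n,i}$, signal probabilities $\varepsilon_{n,i}$ and perturbations $r_{n,i}$. Suppose that $$\sum_{i=1}^{k_n}\frac{\varepsilon_{n,i}^2}{\kappa_{n,i}}\to K\in[0,\infty]\quad\text{and}\quad\max_{1\le i\le k_n}\int_0^1(h_{n,i}-h)^2\,d\lambda\to0$$ for some $h,h_{n,i}\in L^2((0,1))$, and (without loss of generality) that $\frac{\varepsilon_{n,1}}{\kappa_{n,1}}\le\frac{\varepsilon_{n,2}}{\kappa_{n,2}}\le\dots\le\frac{\varepsilon_{n,k_n}}{\kappa_{n,k_n}}$. (a) If $K=0$, then the undetectable case is present. (b) If $K=\infty$ and for some $r_n\in\{1,\dots,k_n\}$ $$\sum_{i=r_n}^{k_n}\varepsilon_{n,i}\to\infty\quad\text{and}\quad\sum_{i=1}^{r_n}\frac{\varepsilon_{n,i}^2}{\kappa_{n,i}}\to\infty,$$ then the completely detectable case is present. (c) If $\sup_n\sum_{i=1}^{k_n}\varepsilon_{n,i}<\infty$ or $K<\infty$, then every accumulation point $\xi_1$ (in the sense of convergence in distribution on $[-\infty,\infty]$ along subsequences) of $T_n$ under $P_{(n)}$ is real-valued. In particular, if $K\in(0,\infty)$ and $\max_{1\le i\le k_n}\frac{\varepsilon_{n,i}}{\kappa_{n,i}}\to0$, then $T_n\overset{d}{\to}N(-\sigma^2/2,\sigma^2)$ under $P_{(n)}$ and $T_n\overset{d}{\to}N(\sigma^2/2,\sigma^2)$ under $Q_{(n)}$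 with $\sigma^2=K\int_0^1h^2\,d\lambda$. (d) For $j=1,2$ let $\boldsymbol\theta_j=\{(h_{n,i}^{(j)},\kappa_{n,i}^{(j)},\varepsilon_{n,i}^{(j)})_{i\le k_n}:n\in\mathbb N\}$ be a model of this kind such that $\sum_i(\varepsilon_{n,i}^{(j)})^2/\kappa_{n,i}^{(j)}\to K^{(j)}\in(0,\infty)$, $\max_i\int_0^1(h_{n,i}^{(j)}-h^{(j)})^2\,d\lambda\to0$ with $h^{(j)}\in L^2((0,1))$, and $\max_i\varepsilon_{n,i}^{(j)}/\kappa_{n,i}^{(j)}\to0$. Suppose that the limit $$\Gamma=\lim_{n\to\infty}\sum_{i=1}^{k_n}\frac{\varepsilon_{n,i}^{(1)}\varepsilon_{n,i}^{(2)}}{\kappa_{n,i}^{(1)}\kappa_{n,i}^{(2)}}\int_0^{\min\{\kappa_{n,i}^{(1)},\kappa_{n,i}^{(2)}\}}h_{n,i}^{(1)}\bigl(x/\kappa_{n,i}^{(1)}\bigr)h_{n,i}^{(2)}\bigl(x/\kappa_{n,i}^{(2)}\bigr)\,dx$$ exists. Then, for $j=1,2$, the log-likelihood ratio statistic $T_n(\boldsymbol\theta_j)$ converges in distribution to $N(-\sigma_j^2/2,\sigma_j^2)$ under $P_{(n)}$ and to $N(\sigma_j^2/2,\sigma_j^2)$ under $Q_{(n)}(\boldsymbol\theta_j)$ for some $\sigma_j>0$, and the limits $$\gamma(\boldsymbol\theta_j,\boldsymbol\theta_m)=\lim_{n\to\infty}\sum_{i=1}^{k_n}\varepsilon_{n,i}^{(j)}\varepsilon_{n,i}^{(m)}\mathrm{Cov}_{P_{n,i}}\Bigl(\frac{d\mu_{n,i}^{(j)}}{dP_{n,i}},\frac{d\mu_{n,i}^{(m)}}{dP_{n,i}}\Bigr),\quad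 j,m\in\{1,2\},$$ exist in $\mathbb R$ with $\gamma(\boldsymbol\theta_j,\boldsymbol\theta_j)=\sigma_j^2$ and $\gamma(\boldsymbol\theta_1,\boldsymbol\theta_2)=\Gamma$.
   Context: $\lambda$ is Lebesgue measure. $k_n\in\mathbb N$, $k_n\to\infty$. All noise distributions $P_{n,i}$ are the uniform distribution on $(0,1)$. The signal distribution $\mu_{n,i}$, $1\le i\le k_n$, is the probability measure on $(0,1)$ with Lebesgue density $$u\mapsto\frac1{\kappa_{n,i}}h_{n,i}\Bigl(\frac u{\kappa_{n,i}}\Bigr)+r_{n,i}(u)\ \ge0,\qquad\int_0^1r_{n,i}\,d\lambda=0,$$ where $h_{n,i}$ is a Lebesgue probability density on $(0,1)$ (extended by $0$ outside $(0,1)$), $\kappa_{n,i}>0$, and the perturbations satisfy $\sum_{i=1}^{k_n}\varepsilon_{n,i}^2\int_0^1r_{n,i}^2\,d\lambda\to0$. The signal probabilities $\varepsilon_{n,i}\in[0,1]$ and $\kappa_{n,i}$ satisfy $\max_{1\le i\le k_n}(\varepsilon_{n,i}+\kappa_{n,i})\to0$. Put $Q_{n,i}=(1-\varepsilon_{n,i})P_{n,i}+\varepsilon_{n,i}\mu_{n,i}$, $P_{(n)}=\bigotimes_iP_{n,i}$, $Q_{(n)}=\bigotimes_iQ_{n,i}$, $T_n=\sum_{i=1}^{k_n}\log\frac{dQ_{n,i}}{dP_{n,i}}(Y_{n,i})$ with $Y_{n,i}$ the coordinates; for a model $\boldsymbol\theta_j$ the corresponding objects are $\mu_{n,i}^{(j)}$,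 $Q_{(n)}(\boldsymbol\theta_j)$, $T_n(\boldsymbol\theta_j)$ (the noise distributions and $k_n$ are common). Completely detectable case: there are $c_n\in\mathbb R$ such that $\varphi_n=\mathbf 1\{T_n>c_n\}$ satisfies $E_{P_{(n)}}(\varphi_n)+E_{Q_{(n)}}(1-\varphi_n)\to0$. Undetectable case: for every sequence of tests $\psi_n$ (measurable, values in $[0,1]$), $E_{P_{(n)}}(\psi_n)+E_{Q_{(n)}}(1-\psi_n)\to1$. *)

(* Defs.v *)
From HB Require Import structures.
From mathcomp Require Import all_boot all_order all_algebra.
From mathcomp Require Import all_classical all_reals all_analysis.
From mathcomp Require Import measurable_realfun.

Set Implicit Arguments.
Unset Strict Implicit.
Unset Printing Implicit Defensive.

Import Order.TTheory GRing.Theory Num.Theory.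
Import numFieldNormedType.Exports.

Local Open Scope classical_set_scope.
Local Open Scope ring_scope.

Section mixture.
Local Open Scope ereal_scope.
Context d (T : measurableType d) (R : realType).
Variables (e : R) (P M : probability T R).

Definition mixture of (0 <= e <= 1)%R : set T -> \bar R :=
  fun A => (1 - e)%:E * P A + e%:E * M A.

Hypothesis e01 : (0 <= e <= 1)%R.

Let e_ge0 : (0 <= e)%R. Proof. by case/andP: e01. Qed.
Let oneme_ge0 : (0 <= 1 - e)%R. Proof. by rewrite subr_ge0; case/andP: e01. Qed.

Let mix :=
  measure_add (mscale (NngNum oneme_ge0) P) (mscale (NngNum e_ge0) M).

Let mixtureE : mixture e01 = mix.
Proof. by apply/funext => A; rewrite /mix measure_addE. Qed.

Let mixture0 : mixture e01 set0 = 0.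
Proof. rewrite mixtureE; exact: (measure0 mix). Qed.

Let mixture_ge0 A : 0 <= mixture e01 A.
Proof. rewrite mixtureE; exact: (measure_ge0 mix). Qed.

Let mixture_sigma_additive : semi_sigma_additive (mixture e01).
Proof. rewrite mixtureE; exact: (@measure_semi_sigma_additive _ _ _ mix). Qed.

HB.instance Definition _ := isMeasure.Build _ _ _ (mixture e01)
  mixture0 mixture_ge0 mixture_sigma_additive.

Let mixture_setT : mixture e01 [set: T] = 1.
Proof. by rewrite /mixture !probability_setT !mule1 -EFinD subrK. Qed.

HB.instance Definition _ :=
  Measure_isProbability.Build _ _ _ (mixture e01) mixture_setT.

End mixture.

Section product_probability.
Local Open Scope ereal_scope.
Context d (T : measurableType d) (R : realType).

Definition tuple_cons n (x : T * n.-tuple T) : n.+1.-tuple T :=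
  [the n.+1.-tuple T of x.1 :: x.2].

Lemma measurable_tuple_cons n : measurable_fun setT (@tuple_cons n).
Proof. exact: measurable_cons. Qed.

HB.instance Definition _ n :=
  isMeasurableFun.Build _ _ _ _ (@tuple_cons n) (@measurable_tuple_cons n).

Fixpoint prod_prob n : ('I_n -> probability T R) -> probability (n.-tuple T) R :=
  match n with
  | 0 => fun=> \d_ [tuple]
  | m.+1 => fun P =>
      distribution (P ord0 \x prod_prob (fun i => P (lift ord0 i)))
        (@tuple_cons m)
  end.

Lemma measurable_box n (A : 'I_n -> set T) : (forall i, measurable (A i)) ->
  measurable [set x : n.-tuple T | forall i, A i (tnth x i)].
Proof.
move=> mA; rewrite [X in measurable X](_ : _ =
    \bigcap_(i in [set: 'I_n]) (@tnth n T ^~ i @^-1` A i)); last first.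
  by apply/seteqP; split => x /= Ax i; [move=> _|]; exact: Ax.
apply: fin_bigcap_measurable => // i _.
by rewrite -[X in measurable X]setTI; exact: (@measurable_tnth _ T n i measurableT _ (mA i)).
Qed.

Lemma prod_probE n (P : 'I_n -> probability T R) (A : 'I_n -> set T) :
  (forall i, measurable (A i)) ->
  prod_prob P [set x | forall i, A i (tnth x i)] = \prod_(i < n) P i (A i).
Proof.
elim: n P A => [|n IH] P A mA.
  by rewrite big_ord0 /= diracE mem_set// => -[].
rewrite big_ord_recl -(IH (fun i => P (lift ord0 i)))//= /distribution /pushforward.
rewrite [X in (_ \x _) X](_ : _ = A ord0 `*`
   [set x | forall i, A (lift ord0 i) (tnth x i)]); last first.
  apply/seteqP; split => [[x y] /= Axy|[x y] /= [Ax Ay] i].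
    split; first exact: (Axy ord0).
    by move=> i; have := Axy (lift ord0 i); rewrite tnthS.
  by case: (unliftP ord0 i) => [j ->|->]; rewrite ?tnthS//; exact: Ay.
rewrite product_measure1E//; exact: (measurable_box (fun i => mA (lift ord0 i))).
Qed.

End product_probability.

Section likelihood_ratio.
Local Open Scope ereal_scope.
Local Open Scope charge_scope.
Context d (T : measurableType d) (R : realType).

Definition dens (Q P : probability T R) : T -> \bar R :=
  'd (charge_of_finite_measure Q) '/d P.

Lemma measurable_dens (Q P : probability T R) :
  measurable_fun [set: T] (dens Q P).
Proof.
have [QP|nQP] := pselect (charge_of_finite_measure Q `<< P).
  exact: measurable_int (Radon_Nikodym_integrable QP).
rewrite /dens /Radon_Nikodym; case: pselect => // _; exact: measurable_cst.
Qed.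

(* lne 0 = -oo, so the sum lies in [-oo, +oo[ as soon as each [Q i] has a
   density with respect to [P i]. *)
Definition loglr n (Q P : 'I_n -> probability T R) (x : n.-tuple T) : \bar R :=
  \sum_(i < n) lne (dens (Q i) (P i) (tnth x i)).

Lemma measurable_lne : measurable_fun [set: \bar R] (@lne R).
Proof.
rewrite [X in measurable_fun _ X](_ : _ = fun x : \bar R =>
    if x <= 0 then -oo else if x == +oo then +oo else (ln (fine x))%:E).
  apply: measurable_fun_ifT => //=; first exact: measurable_fun_lee.
  apply: measurable_fun_ifT => //=; first exact: measurable_fun_eqe.
  by apply/measurable_EFinP; exact: measurableT_comp.
by apply/funext => -[r| |]; rewrite ?lee_fin ?leNye.
Qed.

Lemma measurable_loglr n (Q P : 'I_n -> probability T R) :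
  measurable_fun [set: n.-tuple T] (loglr Q P).
Proof.
apply: emeasurable_sum => i; apply: measurableT_comp; first exact: measurable_lne.
apply: measurableT_comp; first exact: measurable_dens.
exact: measurable_tnth.
Qed.

HB.instance Definition _ n (Q P : 'I_n -> probability T R) :=
  isMeasurableFun.Build _ _ _ _ (loglr Q P) (measurable_loglr Q P).

End likelihood_ratio.

Section convergence_in_distribution.
Context (R : realType).

Definition weak_cvg (nu : nat -> probability (\bar R) R)
    (xi : probability (\bar R) R) :=
  forall f : \bar R -> R, continuous f -> bounded_fun f ->
    (\int[nu n]_x (f x)%:E @[n --> \oo] --> \int[xi]_x (f x)%:E)%E.

Definition EFinR : measurableTypeR R -> \bar R := @EFin R.

Lemma measurable_EFinR : measurable_fun setT EFinR.
Proof. exact: EFin_measurable. Qed.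

HB.instance Definition _ :=
  isMeasurableFun.Build _ _ _ _ EFinR measurable_EFinR.

(* The law N(m, v), parametrized by its variance [v > 0] and seen on [-oo, +oo];
   the second argument of [normal_prob] is the standard deviation. *)
Definition normal_law (m v : R) : probability (\bar R) R :=
  distribution (normal_prob m (Num.sqrt v)) EFinR.

End convergence_in_distribution.

Section detection.
Local Open Scope ereal_scope.
Context (R : realType) (d : nat -> measure_display).
Context (T : forall n, measurableType (d n)).
Variables P Q : forall n, probability (T n) R.

Definition completely_detectable (S : forall n, T n -> \bar R) :=
  exists c : nat -> R,
    let phi n : T n -> R := \1_[set w | (c n)%:E < S n w] in
    'E_(P n)[phi n] + 'E_(Q n)[cst 1%R \- phi n] @[n --> \oo] --> 0.

Definition undetectable :=
  forall psi : forall n, T n -> R,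
    (forall n, measurable_fun [set: T n] (psi n)) ->
    (forall n w, 0 <= psi n w <= 1)%R ->
    'E_(P n)[psi n] + 'E_(Q n)[cst 1%R \- psi n] @[n --> \oo] --> 1.

End detection.

Section pvalue_model.
Context (R : realType).
Local Notation mu := (@lebesgue_measure R).
Local Notation I01 := (`]0%R, 1%R[%classic).

Definition L2_01 (f : R -> R) :=
  measurable_fun (I01 : set R) f /\ (\int[mu]_(x in I01) (f x ^+ 2)%:E < +oo)%E.

(* Laws on ]0, 1[ are represented as Borel laws on the line giving mass one to
   ]0, 1[. *)
Definition noise : probability (measurableTypeR R) R := uniform_prob (@ltr01 R).

(* The row index 1 <= i <= k_n becomes i : 'I_(k n), i.e. 0 <= i < k n.
   [hshape] is h_{n,i}, extended by 0 outside ]0, 1[, and [pert] is r_{n,i}, of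
   which only the values on ]0, 1[ matter. In [pert_cvg0], 0 * +oo = 0. *)
Record pvalue_model (k : nat -> nat) := PvalueModel {
  hshape : forall n, 'I_(k n) -> R -> R ;
  kappa : forall n, 'I_(k n) -> R ;
  eps : forall n, 'I_(k n) -> R ;
  pert : forall n, 'I_(k n) -> R -> R ;
  signal : forall n, 'I_(k n) -> probability (measurableTypeR R) R ;
  hshape_measurable : forall n i, measurable_fun [set: R] (@hshape n i) ;
  hshape_ge0 : forall n i u, 0 <= @hshape n i u ;
  hshape_out : forall n i u, u \notin `]0, 1[%R -> @hshape n i u = 0 ;
  hshape_int : forall n i, (\int[mu]_(u in I01) (@hshape n i u)%:E = 1)%E ;
  kappa_gt0 : forall n i, 0 < @kappa n i ;
  eps01 : forall n i, 0 <= @eps n i <= 1 ;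
  pert_integrable : forall n i,
    mu.-integrable I01 (EFin \o @pert n i) ;
  pert_int : forall n i, (\int[mu]_(u in I01) (@pert n i u)%:E = 0)%E ;
  density_ge0 : forall n i u, u \in `]0, 1[%R ->
    0 <= (@kappa n i)^-1 * @hshape n i (u / @kappa n i) + @pert n i u ;
  signalE : forall n i (A : set (measurableTypeR R)), measurable A ->
    (@signal n i A = \int[mu]_(u in A `&` I01)
      ((@kappa n i)^-1 * @hshape n i (u / @kappa n i) + @pert n i u)%:E)%E ;
  pert_cvg0 :
    (\sum_(i < k n) (@eps n i ^+ 2)%:E *
       \int[mu]_(u in I01) (@pert n i u ^+ 2)%:E)%E
      @[n --> \oo] --> 0%E ;
  eps_kappa_cvg0 :
    \big[Num.max/0]_(i < k n) (@eps n i + @kappa n i) @[n --> \oo] --> 0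
}.

Context (k : nat -> nat) (M : pvalue_model k).

Definition obs n (i : 'I_(k n)) : probability (measurableTypeR R) R :=
  mixture noise (signal M i) (eps01 M i).

Definition P_ n := prod_prob (fun _ : 'I_(k n) => noise).

Definition Q_ n := prod_prob (@obs n).

Definition T_ n : {mfun (k n).-tuple (measurableTypeR R) >-> \bar R} :=
  loglr (@obs n) (fun=> noise).

(* [hshape M] converges to [h] in L2(0, 1), uniformly in the row index. *)
Definition shape_cvg (h : R -> R) :=
  (\big[maxe/0]_(i < k n) \int[mu]_(x in I01) ((hshape M i x - h x) ^+ 2)%:E)%E
    @[n --> \oo] --> 0%E.

Definition asymptotic_normal (v : R) :=
  weak_cvg (fun n => distribution (P_ n) (T_ n)) (normal_law (- v / 2) v) /\
  weak_cvg (fun n => distribution (Q_ n) (T_ n)) (normal_law (v / 2) v).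

End pvalue_model.

(* Main.v *)
Require Import Defs.
From HB Require Import structures.
From mathcomp Require Import all_boot all_order all_algebra.
From mathcomp Require Import all_classical all_reals all_analysis.
From mathcomp Require Import measurable_realfun.
From mathcomp Require Import ring lra.

Set Implicit Arguments.
Unset Strict Implicit.
Unset Printing Implicit Defensive.

Import Order.TTheory GRing.Theory Num.Theory.
Import numFieldNormedType.Exports.

Local Open Scope classical_set_scope.
Local Open Scope ring_scope.

(* The i-th observation of a row has density [1 + y i] with respect to the noise,
   where [y i] is [eps * (f i - 1)] on ]0, 1[ and [f i] is the density of the
   signal; almost surely the log-likelihood ratio is the sum [S] of the
   [ln (1 + y i)].  Up to an error whose squared L2 norms sum to o(1), [y i] is the
   rescaled shape [u |-> eps / kappa * h (u / kappa)], so that the variances sum to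
   [V], which tends to [K * \int h^2].
   - If [K = 0], the chi-square distance [expR V - 1] of the two laws vanishes.
   - The squared Hellinger distances of the coordinates are at least of order
     [min (eps^2 / kappa, eps)]; if their sum diverges, so does minus the logarithm
     of the affinity, which bounds the sum of the errors of the test [S > 0].
   - Bounds on the expectation of [expR S + expR (- S)] keep the mass of the limits
     away from both infinities.
   - If [max eps / kappa] vanishes, Lindeberg's condition holds, and a second-order
     expansion of the characteristic function of [S], under the noise and under
     the alternative, gives the Gaussian one.  For tight laws this implies weak
     convergence, because [f (M * asin y)] is uniformly approximated by Bernstein
     polynomials, which makes trigonometric polynomials of [x] dense on compacts.
   - The covariances come from the bilinear version of the computation of [V]. *)

(** * Elementary inequalities *)

(** Only second moments are available, since the shapes converge in L2 and no better. Remainders of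
    order three are therefore measured by [trunc_sqr], which is dominated by the square, and
    products are compared by Young's inequality with a free weight, disposed of by
    [cvg0_of_trade_off]. Logarithms are tamed by [y i >= - 1/2], true in all large rows because a
    mixture density is at least [1 - eps]; this is one of the conditions that make a row good, and
    finitely many rows are dropped. Characteristic functions are kept real: they are the means of
    [cos (t * x + b)] for every phase [b]. The phase absorbs the coordinates already conditioned
    upon, so an induction on the tuple replaces the coordinates one by one by Gaussian factors, and
    the errors add up. The variance [K * \int h^2] is positive because a probability density on ]0,
    1[ has L2 norm at least 1 and no row is empty. *)

Section elementary_bounds.
Context {R : realType}.
Implicit Types x y z t b C : R.

(** The mean value theorem on the segment from 0 to [x], which the two conditions on [z] describe;
    they keep [ln (1 + z)] inside its domain when [x] is negative. No factor [1 / k.+1] is gained as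
    by integration, so the constants derived from it are not sharp. *)
Lemma normr_le_of_derive (f df : R -> R) (k : nat) C x : 0 <= C ->
  (forall z, `|z| <= `|x| -> 0 <= z * x -> is_derive z 1 f (df z)) ->
  (forall z, `|z| <= `|x| -> 0 <= z * x -> `|df z| <= C * `|z| ^+ k) ->
  f 0 = 0 -> `|f x| <= C * `|x| ^+ k.+1.
Proof.
move=> C0 fdf dfC f0.
have key z : `|z| <= `|x| -> 0 <= z * x -> `|df z * x| <= C * `|x| ^+ k.+1.
  move=> zx zx0; rewrite normrM exprSr mulrA ler_wpM2r//.
  by rewrite (le_trans (dfC z zx zx0))// ler_wpM2l// lerXn2r// nnegrE.
have [x0|x0] := leP 0 x.
  have zP z : z \in `[0, x] -> `|z| <= `|x| /\ 0 <= z * x.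
    rewrite in_itv/= => /andP[z0 zx].
    by rewrite !ger0_norm// mulr_ge0.
  have [||c c0x] := @MVT_segment R f df 0 x x0.
  - move=> z /subset_itv_oo_cc /zP[z1 z2]; exact: fdf.
  - apply: derivable_within_continuous => z /zP[z1 z2].
    by apply: ex_derive; exact: fdf.
  - rewrite f0 !subr0 => ->; have [c1 c2] := zP _ c0x; exact: key.
have zP z : z \in `[x, 0] -> `|z| <= `|x| /\ 0 <= z * x.
  rewrite in_itv/= => /andP[z0 zx].
  by rewrite ler0_norm// ltr0_norm// lerN2 mulr_le0// ltW.
have [||c c0x] := @MVT_segment R f df x 0 (ltW x0).
- move=> z /subset_itv_oo_cc /zP[z1 z2]; exact: fdf.
- apply: derivable_within_continuous => z /zP[z1 z2].
  by apply: ex_derive; exact: fdf.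
- rewrite f0 !sub0r => /eqP; rewrite mulrN eqr_opp => /eqP ->.
  have [c1 c2] := zP _ c0x; exact: key.
Qed.

Lemma normr_sin_le x : `|sin x| <= `|x|.
Proof.
have := @normr_le_of_derive sin cos 0 1 x ler01.
rewrite expr1 mul1r; apply => [z _ _|]; last exact: sin0.
by rewrite expr0 mulr1; exact: cos_max.
Qed.

Lemma normr_cosB1_le x : `|cos x - 1| <= `|x|.
Proof.
have := @normr_le_of_derive (fun z => cos z - 1) (fun z => - sin z) 0 1 x ler01.
rewrite expr1 mul1r; apply => [z _ _|z _ _|]; last by rewrite cos0 subrr.
  by apply: is_derive_eq; rewrite /GRing.scale/=; ring.
by rewrite normrN mul1r expr0 sin_max.
Qed.

Lemma normr_cosB1_le2 x : `|cos x - 1| <= `|x| ^+ 2.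
Proof.
have := @normr_le_of_derive (fun z => cos z - 1) (fun z => - sin z) 1 1 x ler01.
rewrite mul1r; apply => [z _ _|z _ _|]; last by rewrite cos0 subrr.
  by apply: is_derive_eq; rewrite /GRing.scale/=; ring.
by rewrite normrN mul1r expr1 normr_sin_le.
Qed.

Lemma normr_sinB_le x : `|sin x - x| <= `|x| ^+ 2.
Proof.
have := @normr_le_of_derive (fun z => sin z - z) (fun z => cos z - 1) 1 1 x ler01.
rewrite mul1r; apply => [z _ _|]; last by rewrite sin0 subrr.
by rewrite mul1r expr1 normr_cosB1_le.
Qed.

Lemma normr_cosB1D_le x : `|cos x - 1 + x ^+ 2 / 2| <= `|x| ^+ 3.
Proof.
have := @normr_le_of_derive (fun z => cos z - 1 + z ^+ 2 / 2)
  (fun z => z - sin z) 2 1 x ler01.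
rewrite mul1r; apply => [z _ _|z _ _|].
- by apply: is_derive_eq; rewrite /GRing.scale/=; field.
- by rewrite mul1r distrC normr_sinB_le.
- by rewrite cos0; ring.
Qed.

Lemma normrM_le1 x y C : `|x| <= 1 -> `|y| <= C -> `|x * y| <= C.
Proof.
move=> x1 yC; rewrite normrM -[leRHS]mul1r.
by apply: ler_pM.
Qed.

Lemma cosD_taylor1 b x : `|cos (b + x) - cos b + sin b * x| <= 2 * x ^+ 2.
Proof.
rewrite (_ : _ + _ = cos b * (cos x - 1) - sin b * (sin x - x)); last first.
  by rewrite cosD; ring.
rewrite (le_trans (ler_normB _ _))// mulr_natl mulr2n lerD//.
  by apply: normrM_le1 (cos_max _) _; rewrite -real_normK ?num_real// normr_cosB1_le2.
by apply: normrM_le1 (sin_max _) _; rewrite -real_normK ?num_real// normr_sinB_le.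
Qed.

Lemma normr_sinB_le3 x : `|sin x - x| <= `|x| ^+ 3.
Proof.
have := @normr_le_of_derive (fun z => sin z - z) (fun z => cos z - 1) 2 1 x ler01.
rewrite mul1r; apply => [z _ _|]; last by rewrite sin0 subrr.
by rewrite mul1r normr_cosB1_le2.
Qed.

Lemma cosD_taylor2 b x :
  `|cos (b + x) - cos b + sin b * x + cos b * (x ^+ 2 / 2)| <= 2 * `|x| ^+ 3.
Proof.
rewrite (_ : _ + _ = cos b * (cos x - 1 + x ^+ 2 / 2) - sin b * (sin x - x)).
  rewrite (le_trans (ler_normB _ _))// mulr_natl mulr2n lerD//.
    exact: normrM_le1 (cos_max _) (normr_cosB1D_le _).
  exact: normrM_le1 (sin_max _) (normr_sinB_le3 _).
by rewrite cosD; ring.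
Qed.

Lemma is_derive_ln1D z : -1 < z -> is_derive z 1 (fun y => ln (1 + y)) (1 + z)^-1.
Proof.
move=> z1; have z0 : 0 < 1 + z by lra.
apply: is_derive_eq; first by apply: is_derive1_comp; exact: is_derive1_ln.
by rewrite /GRing.scale/=; ring.
Qed.

Section ln1D.
Variables (y : R) (y2 : - 2^-1 <= y).

(** The segment from 0 to [y] stays above -1/2, where [(1 + z)^-1 <= 2]: this is the constant 2 of
    the three bounds on the logarithm. *)
Let ge_half z : `|z| <= `|y| -> 0 <= z * y -> - 2^-1 <= z.
Proof.
move=> zy zy0; have [z0|z0] := leP 0 z; first lra.
have y0 : y <= 0 by rewrite -(nmulr_rge0 _ z0).
by move: zy; rewrite ltr0_norm// ler0_norm// lerN2; exact: le_trans.
Qed.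

Lemma normr_ln1D_le : `|ln (1 + y)| <= 2 * `|y|.
Proof.
have := @normr_le_of_derive (fun z => ln (1 + z)) (fun z => (1 + z)^-1) 0 2 y.
rewrite expr1; apply => // [z zy zy0|z zy zy0|]; last by rewrite addr0 ln1.
  by apply: is_derive_ln1D; have ? := ge_half zy zy0; lra.
have z2 := ge_half zy zy0; rewrite expr0 mulr1 ger0_norm ?invr_ge0; last lra.
by rewrite -[leRHS]invrK lef_pV2 ?posrE; lra.
Qed.

Lemma normr_ln1DB_le : `|ln (1 + y) - y| <= 2 * `|y| ^+ 2.
Proof.
have := @normr_le_of_derive (fun z => ln (1 + z) - z) (fun z => (1 + z)^-1 - 1) 1 2 y.
apply => // [z zy zy0|z zy zy0|]; last by rewrite addr0 ln1 subrr.
  apply: is_deriveB; apply: is_derive_ln1D; have ? := ge_half zy zy0; lra.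
have z2 := ge_half zy zy0; rewrite expr1.
have z0 : 0 < 1 + z by lra.
rewrite (_ : _ - 1 = - (1 + z)^-1 * z); last by field; lra.
rewrite normrM ler_wpM2r// normrN gtr0_norm ?invr_gt0//.
by rewrite -[leRHS]invrK lef_pV2 ?posrE; lra.
Qed.

Lemma normr_ln1DBD_le : `|ln (1 + y) - y + y ^+ 2 / 2| <= 2 * `|y| ^+ 3.
Proof.
have := @normr_le_of_derive (fun z => ln (1 + z) - z + z ^+ 2 / 2)
  (fun z => (1 + z)^-1 - 1 + z) 2 2 y.
apply => // [z zy zy0|z zy zy0|]; last by rewrite addr0 ln1; ring.
  have z2 : -1 < z by have ? := ge_half zy zy0; lra.
  have dz := is_derive_ln1D z2.
  by apply: is_derive_eq; rewrite /GRing.scale/=; field; lra.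
have z2 := ge_half zy zy0.
have z0 : 0 < 1 + z by lra.
rewrite (_ : _ + z = (1 + z)^-1 * z ^+ 2); last by field; lra.
rewrite normrM normrX ler_wpM2r ?exprn_ge0// gtr0_norm ?invr_gt0//.
by rewrite -[leRHS]invrK lef_pV2 ?posrE; lra.
Qed.

End ln1D.

Lemma normr_expRNB1D_le (w : R) : 0 <= w -> `|expR (- w) - 1 + w| <= w ^+ 2.
Proof.
move=> w0; rewrite -[X in _ <= X ^+ 2]ger0_norm//.
have := @normr_le_of_derive (fun z => expR (- z) - 1 + z)
  (fun z => - expR (- z) + 1) 1 1 w ler01.
rewrite mul1r; apply => [z zw zw0|z zw zw0|].
- by apply: is_derive_eq; rewrite /GRing.scale/=; ring.
- have zge0 : 0 <= z.
    move: w0 zw zw0; rewrite le_eqVlt => /orP[/eqP<-|w0].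
      by rewrite normr0 normr_le0 => /eqP ->.
    by rewrite pmulr_lge0.
  have e1 : 0 <= - expR (- z) + 1 by rewrite addrC subr_ge0 expR_le1 oppr_le0.
  have e2 : - expR (- z) + 1 <= z by have ? := expR_ge1Dx (- z); lra.
  by rewrite mul1r expr1 !ger0_norm.
- by rewrite oppr0 expR0; ring.
Qed.

Lemma normr_expRB1_le (x : R) : `|expR x - 1| <= expR `|x| * `|x|.
Proof.
have := @normr_le_of_derive (fun z => expR z - 1) expR 0 (expR `|x|) x (expR_ge0 _).
rewrite expr1; apply => [z _ _|z zx _|]; last by rewrite expR0 subrr.
  by apply: is_derive_eq; rewrite /GRing.scale/=; ring.
by rewrite ger0_norm ?expR_ge0// expr0 mulr1 ler_expR (le_trans (ler_norm z)).
Qed.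

Lemma normr_expRB1B_le (x : R) : `|expR x - 1 - x| <= expR `|x| * `|x| ^+ 2.
Proof.
have := @normr_le_of_derive (fun z => expR z - 1 - z) (fun z => expR z - 1) 1
  (expR `|x|) x (expR_ge0 _).
apply => [z _ _|z zx _|]; last by rewrite expR0 subrr subr0.
  by apply: is_derive_eq; rewrite /GRing.scale/=; ring.
rewrite expr1 (le_trans (normr_expRB1_le z))//; apply: ler_wpM2r => //.
by rewrite ler_expR.
Qed.

(** A way to differentiate under an integral sign: the increment of [f] at [t] is compared, up to
    order two in [h], with that of a function [D] whose derivative at 0 is known. *)
Lemma is_derive_of_increment (f D : R -> R) (t d K : R) :
  is_derive (0 : R) 1 D d ->
  (forall h, `|h| <= 1 -> `|(f (t + h) - f t) - (D h - D 0)| <= K * `|h| ^+ 2) ->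
  is_derive t 1 f d.
Proof.
move=> [dD DE] fD.
have cvgD0 : h^-1 *: (D (h *: 1 + 0) - D 0) @[h --> 0^'] --> d.
  by rewrite -DE; exact: dD.
have cvgf : h^-1 *: (f (h *: 1 + t) - f t) @[h --> 0^'] --> d.
  have -> : (fun h : R => h^-1 *: (f (h *: 1 + t) - f t)) = (fun h =>
      h^-1 *: (D (h *: 1 + 0) - D 0) + h^-1 *: (f (h *: 1 + t) - f t - (D (h *: 1 + 0) - D 0))).
    by apply/funext => h; rewrite -scalerDr; congr (_ *: _); ring.
  rewrite -[X in _ --> X]addr0; apply: cvgD => //.
  apply/cvgrPdist_le => e e0.
  near=> h.
  have h0 : h != 0 by near: h; exact: nbhs_dnbhs_neq.
  have h1 : `|h| <= 1.
    by near: h; exact: dnbhs0_le.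
  have h2 : `|h| <= e / (`|K| + 1).
    by near: h; apply: dnbhs0_le; rewrite divr_gt0// ltr_wpDl.
  rewrite sub0r normrN /GRing.scale/= mulr1 addr0 normrM normfV.
  rewrite mulrC ler_pdivrMr ?normr_gt0// (addrC h) (le_trans (fD h h1))//.
  rewrite expr2 mulrA; apply: ler_wpM2r => //.
  rewrite ler_pdivlMr ?ltr_wpDl// in h2.
  apply: le_trans h2; rewrite mulrC; apply: ler_wpM2l => //.
  by rewrite (le_trans (ler_norm K))// lerDl.
split; first by apply/cvg_ex; exists d.
exact/cvg_lim.
Unshelve. all: by end_near. Qed.

End elementary_bounds.

(** * Second-order expansion of the characteristic function of one coordinate *)

Section loglik_taylor.
Context {R : realType}.
Implicit Types b y v : R.
Variables (c t : R) (c01 : 0 <= c <= 1).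

(* [(1 + c y) cos (t ln (1 + y) + b)] is the integrand of the characteristic
   function of the log-likelihood ratio under the null ([c = 0]) and under the
   alternative ([c = 1]). *)
Definition loglik_cos b y := (1 + c * y) * cos (t * ln (1 + y) + b).

(** [t] times the mean per unit of variance of the Gaussian limit: [- t / 2] under the null, [t / 2]
    under the alternative. *)
Definition loglik_drift : R := - (1 - 2 * c) * t / 2.

(** Cubic near 0 and quadratic at infinity, hence integrable as soon as [y ^+ 2] is. That its means
    sum to o(1) is the form taken by Lindeberg's condition. *)
Definition trunc_sqr y := y ^+ 2 * Num.min `|y| 1.

(* The two expansions have the same coefficients once [y] is replaced by its
   mean [0] and [y ^+ 2] by its mean [v]. *)
Definition loglik_expansion C :=
  (forall b y, - 2^-1 <= y -> `|loglik_cos b y - cos b - y * (c * cos b - t * sin b)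
    - y ^+ 2 / 2 * ((1 - 2 * c) * t * sin b - t ^+ 2 * cos b)| <= C * trunc_sqr y) /\
  (forall b v, 0 <= v ->
    `|expR (- (t ^+ 2 * v / 2)) * cos (b + loglik_drift * v) - cos b
    - v / 2 * ((1 - 2 * c) * t * sin b - t ^+ 2 * cos b)| <= C * v ^+ 2).

Lemma trunc_sqr_ge0 y : 0 <= trunc_sqr y.
Proof. by rewrite mulr_ge0 ?sqr_ge0// le_min normr_ge0 ler01. Qed.

(** [C0] and [C1] bound the first- and second-order remainders of [cos (t * ln (1 + y) + b)]; [C2]
    dominates what is needed both for [|y| <= 1] and for [|y| > 1]. *)
Let C0 := 8 * t ^+ 2 + 2 * `|t|.
Let C1 := 16 * `|t| ^+ 3 + 3 * t ^+ 2 + 2 * `|t|.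
Let C2 := C0 + C1 + 4 * `|t| + t ^+ 2 + 2.

Let t0 : 0 <= `|t|. Proof. exact: normr_ge0. Qed.
Let t3 : 0 <= `|t| ^+ 3. Proof. exact: exprn_ge0. Qed.
Let tt : 0 <= t ^+ 2. Proof. exact: sqr_ge0. Qed.

Let C0_ge0 : 0 <= C0. Proof. by have := t0; have := tt; rewrite /C0 => ? ?; lra. Qed.
Let C1_ge0 : 0 <= C1. Proof. by have := t0; have := tt; have := t3; rewrite /C1 => ? ? ?; lra. Qed.
Let normr_sqr y : `|y ^+ 2| = y ^+ 2.
Proof. by rewrite ger0_norm// sqr_ge0. Qed.

Let sqr_ln1D_le y : - 2^-1 <= y -> ln (1 + y) ^+ 2 <= 4 * y ^+ 2.
Proof.
move=> y2; rewrite -(normr_sqr (ln _)) -(normr_sqr y) !normrX.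
rewrite (_ : 4 = 2 ^+ 2); last by ring.
by rewrite -exprMn lerXn2r ?nnegrE ?mulr_ge0// normr_ln1D_le.
Qed.

Lemma cos_ln1D_taylor1 b y : - 2^-1 <= y ->
  `|cos (t * ln (1 + y) + b) - cos b + t * sin b * y| <= C0 * y ^+ 2.
Proof.
move=> y2; set l := ln (1 + y).
rewrite (_ : _ + _ = (cos (b + t * l) - cos b + sin b * (t * l))
   - sin b * (t * (l - y))); last by rewrite addrC (addrC b); ring.
rewrite (le_trans (ler_normB _ _))// mulrDl lerD//.
  rewrite (le_trans (cosD_taylor1 _ _))// exprMn.
  by have := sqr_ln1D_le y2; have := sqr_ge0 t; rewrite -/l => ? ?; nra.
apply: normrM_le1 (sin_max _) _; rewrite normrM (mulrC 2) -mulrA ler_wpM2l//.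
by rewrite (le_trans (normr_ln1DB_le y2))// -normrX normr_sqr.
Qed.

Lemma cos_ln1D_taylor2 b y : - 2^-1 <= y ->
  `|cos (t * ln (1 + y) + b) - cos b + t * sin b * y
    - y ^+ 2 / 2 * (t * sin b - t ^+ 2 * cos b)| <= C1 * `|y| ^+ 3.
Proof.
move=> y2; set l := ln (1 + y).
have ly : `|l| <= 2 * `|y| by exact: normr_ln1D_le.
(* The cosine is expanded at order two in [t * l]; then [l] is replaced by [y - y^2 / 2] in the
   linear term and [l^2] by [y^2] in the quadratic one, the last difference being
   [(l - y) * (l + y)]. *)
rewrite (_ : _ - _ = (cos (b + t * l) - cos b + sin b * (t * l)
    + cos b * ((t * l) ^+ 2 / 2)) - sin b * (t * (l - y + y ^+ 2 / 2))
    - cos b * (t ^+ 2 / 2 * ((l - y) * (l + y)))); last first.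
  by rewrite [t * l + b]addrC; field.
have e1 : 2 * `|t * l| ^+ 3 <= 16 * `|t| ^+ 3 * `|y| ^+ 3.
  rewrite normrM exprMn (_ : 16 * _ * _ = 2 * (`|t| ^+ 3 * (2 * `|y|) ^+ 3)); last by ring.
  apply: ler_wpM2l => //; apply: ler_wpM2l; first exact: exprn_ge0.
  by rewrite lerXn2r ?nnegrE// mulr_ge0.
have e2 : `|t * (l - y + y ^+ 2 / 2)| <= 2 * `|t| * `|y| ^+ 3.
  rewrite normrM (mulrC 2) -[leRHS]mulrA; apply: ler_wpM2l => //; exact: normr_ln1DBD_le.
have e3 : `|t ^+ 2 / 2 * ((l - y) * (l + y))| <= 3 * t ^+ 2 * `|y| ^+ 3.
  rewrite (_ : 3 * _ * _ = t ^+ 2 / 2 * ((2 * `|y| ^+ 2) * (3 * `|y|))); last by field.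
  rewrite normrM; apply: ler_pM => //; first by rewrite ger0_norm// divr_ge0// sqr_ge0.
  rewrite normrM; apply: ler_pM => //; first exact: normr_ln1DB_le.
  have -> : 3 * `|y| = 2 * `|y| + `|y| by ring.
  by apply: (le_trans (ler_normD _ _)); exact: lerD.
have -> : C1 * `|y| ^+ 3 = 16 * `|t| ^+ 3 * `|y| ^+ 3 + 2 * `|t| * `|y| ^+ 3
    + 3 * t ^+ 2 * `|y| ^+ 3 by rewrite /C1; ring.
apply: (le_trans (ler_normB _ _)); apply: lerD; last exact: normrM_le1 (cos_max _) e3.
apply: (le_trans (ler_normB _ _)); apply: lerD; last exact: normrM_le1 (sin_max _) e2.
exact: le_trans (cosD_taylor2 _ _) e1.
Qed.

(** For [|y| <= 1] the factor [c * y] multiplies the first-order remainder, and the product is again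
    cubic. For [|y| > 1] a first-order expansion is enough, every quadratic term being itself of the
    order of [trunc_sqr y]. *)
Lemma loglik_cos_taylor b y : - 2^-1 <= y ->
  `|loglik_cos b y - cos b - y * (c * cos b - t * sin b)
    - y ^+ 2 / 2 * ((1 - 2 * c) * t * sin b - t ^+ 2 * cos b)|
  <= C2 * trunc_sqr y.
Proof.
move=> y2; have R1 := cos_ln1D_taylor1 b y2; have R2 := cos_ln1D_taylor2 b y2.
have c1 : `|c| <= 1 by case/andP: c01 => ? ?; rewrite ger0_norm.
have tge0 := t0; have ttge0 := tt; have C0ge0 := C0_ge0; have C1ge0 := C1_ge0.
move: R1 R2; rewrite /loglik_cos /C2; move: C0 C1 C0ge0 C1ge0 => D0 D1 D0_ge0 D1_ge0.
set G := cos (t * _ + b) => R1 R2.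
have [y1|y1] := leP `|y| 1.
  have -> : trunc_sqr y = `|y| ^+ 3.
    by rewrite /trunc_sqr min_l// -normr_sqr normrX -exprSr.
  rewrite (_ : _ - _ = (G - cos b + t * sin b * y
      - y ^+ 2 / 2 * (t * sin b - t ^+ 2 * cos b))
      + c * (y * (G - cos b + t * sin b * y))); last by field.
  apply: (le_trans (ler_normD _ _)).
  apply: (@le_trans _ _ (D1 * `|y| ^+ 3 + D0 * `|y| ^+ 3)).
    apply: lerD => //; apply: normrM_le1 => //; rewrite normrM exprS mulrCA.
    by apply: ler_wpM2l => //; rewrite -normrX normr_sqr.
  by rewrite -mulrDl; apply: ler_wpM2r; [exact: exprn_ge0|lra].
have -> : trunc_sqr y = y ^+ 2 by rewrite /trunc_sqr min_r ?mulr1// ltW.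
have yy : `|y| <= y ^+ 2 by rewrite -normr_sqr normrX expr2 ler_peMl// ltW.
rewrite (_ : _ - _ = (G - cos b + t * sin b * y) + c * (y * (G - cos b))
    - (1 - 2 * c) * (sin b * (t * (y ^+ 2 / 2)))
    + cos b * (t ^+ 2 * (y ^+ 2 / 2))); last by field.
have y20 : 0 <= y ^+ 2 / 2 by rewrite divr_ge0// sqr_ge0.
have e1 : `|c * (y * (G - cos b))| <= 2 * y ^+ 2.
  apply: normrM_le1 => //; rewrite normrM mulrC; apply: ler_pM => //.
  have -> : 2 = 1 + 1 :> R by ring.
  by apply: (le_trans (ler_normB _ _)); apply: lerD; exact: cos_max.
have e2 : `|(1 - 2 * c) * (sin b * (t * (y ^+ 2 / 2)))| <= `|t| * (y ^+ 2 / 2).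
  apply: normrM_le1; first by case/andP: c01 => ? ?; rewrite ler_norml; apply/andP; split; lra.
  by apply: normrM_le1; [exact: sin_max|rewrite normrM (ger0_norm y20)].
have e3 : `|cos b * (t ^+ 2 * (y ^+ 2 / 2))| <= t ^+ 2 * (y ^+ 2 / 2).
  by apply: normrM_le1; [exact: cos_max|rewrite ger0_norm// mulr_ge0].
apply: (le_trans (ler_normD _ _)).
apply: (@le_trans _ _ (D0 * y ^+ 2 + 2 * y ^+ 2 + `|t| * (y ^+ 2 / 2)
    + t ^+ 2 * (y ^+ 2 / 2))).
  rewrite lerD// (le_trans (ler_normB _ _))// lerD//.
  by rewrite (le_trans (ler_normD _ _))// lerD.
rewrite (_ : _ + _ = (D0 + 2 + `|t| / 2 + t ^+ 2 / 2) * y ^+ 2); last by field.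
by apply: ler_wpM2r; [exact: sqr_ge0|lra].
Qed.

Lemma expR_cos_taylor b v : 0 <= v ->
  `|expR (- (t ^+ 2 * v / 2)) * cos (b + loglik_drift * v) - cos b
    - v / 2 * ((1 - 2 * c) * t * sin b - t ^+ 2 * cos b)|
  <= (t ^+ 4 / 4 + t ^+ 2 / 2 * `|loglik_drift| + 2 * loglik_drift ^+ 2) * v ^+ 2.
Proof.
move=> v0; set w := t ^+ 2 * v / 2; set k := loglik_drift.
have w0 : 0 <= w by rewrite divr_ge0// mulr_ge0// sqr_ge0.
rewrite (_ : _ - _ = expR (- w) * (cos (b + k * v) - cos b + sin b * (k * v))
  + (expR (- w) - 1 + w) * cos b - sin b * ((expR (- w) - 1) * (k * v))); last first.
  by rewrite /w /k /loglik_drift; field.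
have e0 : expR (- w) <= 1 by rewrite expR_le1 oppr_le0.
have e1 : `|expR (- w) - 1| <= w.
  have h1 := expR_ge1Dx (- w).
  by rewrite ler_norml; apply/andP; split; lra.
rewrite [leRHS](_ : _ = 2 * (k * v) ^+ 2 + w ^+ 2 + w * (`|k| * v)); last first.
  by rewrite /w; field.
apply: (le_trans (ler_normB _ _)); apply: lerD.
  apply: (le_trans (ler_normD _ _)); apply: lerD.
    apply: normrM_le1; last exact: cosD_taylor1.
    by rewrite ger0_norm// expR_ge0.
  by rewrite mulrC; apply: normrM_le1; [exact: cos_max|exact: normr_expRNB1D_le].
apply: normrM_le1; first exact: sin_max.
by rewrite normrM; apply: ler_pM => //; rewrite normrM (ger0_norm v0).
Qed.

Lemma loglik_expansion_exists : exists2 C, 0 <= C & loglik_expansion C.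
Proof.
pose K := t ^+ 4 / 4 + t ^+ 2 / 2 * `|loglik_drift| + 2 * loglik_drift ^+ 2.
exists (`|C2| + `|K|); first exact: addr_ge0.
split=> [b y y2|b v v0].
  apply: (le_trans (loglik_cos_taylor b y2)); apply: ler_wpM2r; first exact: trunc_sqr_ge0.
  by rewrite (le_trans (ler_norm C2))// lerDl.
apply: (le_trans (expR_cos_taylor b v0)); apply: ler_wpM2r; first exact: sqr_ge0.
by rewrite -/K (le_trans (ler_norm K))// lerDr.
Qed.

End loglik_taylor.

(** * Product probabilities *)

Section product_probability_integrals.
Context d (T : measurableType d) (R : realType).
Local Open Scope ereal_scope.

Lemma measurable_tuple_cons2 n (x : T) :
  measurable_fun [set: n.-tuple T] (fun y => tuple_cons (x, y)).
Proof.
apply: (measurableT_comp (measurable_tuple_cons (n:=n)) (g := fun y => (x, y))).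
exact: pair1_measurable.
Qed.

Lemma integral_prod_probS n (P : 'I_n.+1 -> probability T R)
    (F : n.+1.-tuple T -> \bar R) :
  measurable_fun [set: n.+1.-tuple T] F -> (forall x, 0 <= F x) ->
  \int[prod_prob P]_x F x =
  \int[P ord0]_x \int[prod_prob (fun i => P (lift ord0 i))]_y F (tuple_cons (x, y)).
Proof.
move=> mF F0 /=; rewrite ge0_integral_pushforward//=.
rewrite preimage_setT fubini_tonelli1//=.
by apply: measurableT_comp => //; exact: measurable_tuple_cons.
Qed.

Lemma measurable_prodr_tnth n (f : 'I_n -> T -> R) :
  (forall i, measurable_fun [set: T] (f i)) ->
  measurable_fun [set: n.-tuple T] (fun x => \prod_(i < n) f i (tnth x i))%R.
Proof.
move=> mf; apply: measurable_prod => i _.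
by apply: measurableT_comp; [exact: mf|exact: measurable_tnth].
Qed.

Lemma integral_prod_prob_prodr n (P : 'I_n -> probability T R)
    (f : 'I_n -> T -> R) :
  (forall i, measurable_fun [set: T] (f i)) -> (forall i x, 0 <= f i x)%R ->
  \int[prod_prob P]_x (\prod_(i < n) f i (tnth x i))%:E =
  \prod_(i < n) \int[P i]_x (f i x)%:E.
Proof.
elim: n P f => [|n IH] P f mf f0.
  rewrite big_ord0 (eq_integral (cst 1))/= => [|x _]; last by rewrite big_ord0.
  by rewrite integral_cst// mul1e; exact: (@probability_setT _ _ _ (prod_prob P)).
rewrite integral_prod_probS; last 2 first.
- by apply/measurable_EFinP; exact: measurable_prodr_tnth.
- by move=> x; rewrite lee_fin prodr_ge0.
rewrite big_ord_recl -(IH _ (fun i => f (lift ord0 i)))// -ge0_integralZr//=.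
- apply: eq_integral => x _; rewrite -ge0_integralZl//=.
  + apply: eq_integral => y _; rewrite big_ord_recl EFinM tnth0//.
    by congr (_ * _%:E); apply: eq_bigr => i _; rewrite tnthS.
  + by apply/measurable_EFinP; exact: (measurable_prodr_tnth (fun i => mf (lift ord0 i))).
  + by move=> y _; rewrite lee_fin prodr_ge0.
  + by rewrite lee_fin.
- exact/measurable_EFinP.
- by move=> x _; rewrite lee_fin.
- by apply: integral_ge0 => y _; rewrite lee_fin prodr_ge0.
Qed.

(** The density is assumed as an identity between integrals of nonnegative functions, the form in
    which it applies to the inner integral left by Tonelli's theorem, seen as a function of the
    first coordinate. *)
Lemma integral_prod_prob_density n (P Q : 'I_n -> probability T R)
    (g : 'I_n -> T -> R) (F : n.-tuple T -> \bar R) :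
  (forall i, measurable_fun [set: T] (g i)) -> (forall i x, 0 <= g i x)%R ->
  (forall i (f : T -> \bar R), measurable_fun [set: T] f -> (forall x, 0 <= f x) ->
    \int[Q i]_x f x = \int[P i]_x (f x * (g i x)%:E)) ->
  measurable_fun [set: n.-tuple T] F -> (forall x, 0 <= F x) ->
  \int[prod_prob Q]_x F x =
  \int[prod_prob P]_x (F x * (\prod_(i < n) g i (tnth x i))%:E).
Proof.
elim: n P Q g F => [|n IH] P Q g F mg g0 QP mF F0.
  by apply: eq_integral => x _; rewrite big_ord0 mule1.
have mFg : measurable_fun [set: n.+1.-tuple T]
    (fun x => F x * (\prod_(i < n.+1) g i (tnth x i))%:E).
  by apply: emeasurable_funM => //; apply/measurable_EFinP; exact: measurable_prodr_tnth.
rewrite !integral_prod_probS//; last first.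
  by move=> x; rewrite mule_ge0// lee_fin prodr_ge0.
have mFx x : measurable_fun [set: n.-tuple T] (fun y => F (tuple_cons (x, y))).
  by apply: measurableT_comp => //; exact: measurable_tuple_cons2.
have mFF : measurable_fun [set: T * n.-tuple T] (F \o @tuple_cons _ T n).
  by apply: measurableT_comp => //; exact: measurable_tuple_cons.
rewrite QP; last 2 first.
- by apply: (measurable_fun_fubini_tonelli_F (F \o @tuple_cons _ T n)) => // x; exact: F0.
- by move=> x; exact: integral_ge0.
apply: eq_integral => x _.
rewrite (IH (fun i => P (lift ord0 i)) _ (fun i => g (lift ord0 i)))//.
  rewrite -ge0_integralZr//=.
  + apply: eq_integral => y _; rewrite big_ord_recl EFinM tnth0//= muleA muleAC.
    by congr (_ * _%:E * _); apply: eq_bigr => i _; rewrite tnthS.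
  + apply: emeasurable_funM => //; apply/measurable_EFinP.
    exact: (measurable_prodr_tnth (fun i => mg (lift ord0 i))).
  + by move=> y _; rewrite mule_ge0// lee_fin prodr_ge0.
  + by rewrite lee_fin.
by move=> i f mf f0; exact: QP.
Qed.

Lemma prod_prob_box1 n (P : 'I_n -> probability T R) (A : 'I_n -> set T) :
  (forall i, measurable (A i)) -> (forall i, P i (A i) = 1) ->
  prod_prob P [set x | forall i, A i (tnth x i)] = 1.
Proof. by move=> mA PA; rewrite prod_probE// big1. Qed.

End product_probability_integrals.

Section probability_Rintegral.
Context d (T : measurableType d) (R : realType) (P : probability T R).
Implicit Types (f g : T -> R) (C e : R).

Lemma probability_integrable_bounded f C :
  measurable_fun [set: T] f -> (forall x, `|f x| <= C) ->
  P.-integrable [set: T] (EFin \o f).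
Proof.
move=> mf fC; apply: measurable_bounded_integrable => //.
  by apply: (@le_lt_trans _ _ 1%E); [exact: probability_le1|exact: ltry].
by exists C; split; [exact: num_real|move=> D CD x _; exact: le_trans (fC x) (ltW CD)].
Qed.

Lemma ge0_integrable_lty f : measurable_fun [set: T] f -> (forall x, 0 <= f x) ->
  (\int[P]_x (f x)%:E < +oo)%E -> P.-integrable [set: T] (EFin \o f).
Proof.
move=> mf f0 foo; apply/integrableP; split; first exact/measurable_EFinP.
apply: le_lt_trans foo; apply: ge0_le_integral => //=.
- by do 2 apply: measurableT_comp => //.
- exact/measurable_EFinP.
- by move=> x _; rewrite ger0_norm.
Qed.

Lemma integrable_scale c f : P.-integrable [set: T] (EFin \o f) ->
  P.-integrable [set: T] (EFin \o (fun x => c * f x)).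
Proof.
move=> intf; rewrite (_ : _ \o _ = (fun x => c%:E * (EFin \o f) x))%E//.
exact: integrableZl.
Qed.

Lemma integrable_add f g : P.-integrable [set: T] (EFin \o f) ->
  P.-integrable [set: T] (EFin \o g) ->
  P.-integrable [set: T] (EFin \o (fun x => f x + g x)).
Proof. by move=> intf intg; exact: (integrableD measurableT intf intg). Qed.

Lemma normr_RintegralB_le f g e :
  P.-integrable [set: T] (EFin \o f) -> P.-integrable [set: T] (EFin \o g) ->
  (forall x, `|f x - g x| <= e) ->
  `|\int[P]_x f x - \int[P]_x g x| <= e.
Proof.
move=> intf intg fge; rewrite -RintegralB//.
have intfg : P.-integrable [set: T] (EFin \o (f \- g)).
  by rewrite (_ : _ \o _ = (EFin \o f) \- (EFin \o g))%E//; exact: integrableB.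
apply: (le_trans (le_normr_Rintegral _ _)) => //.
apply: (@le_trans _ _ (\int[P]_x e)).
  apply: le_Rintegral => // [|]; first exact: integrable_norm.
  exact: finite_measure_integrable_cst.
by rewrite Rintegral_cst//= probability_setT/= mulr1.
Qed.

End probability_Rintegral.

Lemma measurable_cosD d (T : measurableType d) (R : realType) (X : T -> R) (t b : R) :
  measurable_fun [set: T] X ->
  measurable_fun [set: T] (fun x => cos (t * X x + b)).
Proof.
move=> mX; apply: measurableT_comp; first by apply: continuous_measurable_fun; exact: continuous_cos.
by apply: measurable_funD => //; exact: measurable_funM.
Qed.

(** * Characteristic functions of sums of independent coordinates *)

Section product_characteristic_function.
Context d (T : measurableType d) (R : realType).
Implicit Types (b t e : R).

Lemma integrable_prod_prob_cons n (P : 'I_n.+1 -> probability T R)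
    (F : n.+1.-tuple T -> R) C :
  measurable_fun [set: n.+1.-tuple T] F -> (forall x, `|F x| <= C) ->
  (P ord0 \x prod_prob (fun i => P (lift ord0 i)))%E.-integrable
    [set: T * n.-tuple T] (EFin \o F \o @tuple_cons _ T n).
Proof.
move=> mF FC; apply: (@probability_integrable_bounded _ _ _
  (P ord0 \x prod_prob (fun i => P (lift ord0 i)))%E (F \o @tuple_cons _ T n) C).
  by apply: measurableT_comp => //; exact: measurable_tuple_cons.
by move=> x; exact: FC.
Qed.

Lemma Rintegral_prod_probS n (P : 'I_n.+1 -> probability T R)
    (F : n.+1.-tuple T -> R) C :
  measurable_fun [set: n.+1.-tuple T] F -> (forall x, `|F x| <= C) ->
  \int[prod_prob P]_x F x =
  \int[P ord0]_x \int[prod_prob (fun i => P (lift ord0 i))]_y F (tuple_cons (x, y)).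
Proof.
move=> mF FC; rewrite /Rintegral/= integral_pushforward//=; last 2 first.
- exact/measurable_EFinP.
- rewrite preimage_setT; exact: integrable_prod_prob_cons FC.
rewrite preimage_setT -integral12_prod_meas1; last exact: integrable_prod_prob_cons FC.
congr fine; apply: eq_integral => x _; rewrite fineK//.
apply: integrable_fin_num => //.
apply: (@probability_integrable_bounded _ _ _ _ (fun y => F (tuple_cons (x, y))) C) => //.
by apply: measurableT_comp => //; exact: measurable_tuple_cons2.
Qed.

(** Integrates an approximation that holds conditionally on the first coordinate: [G] stands for the
    integral over the others. *)
Lemma normr_Rintegral_prod_probB_le n (P : 'I_n.+1 -> probability T R)
    (F : n.+1.-tuple T -> R) (G : T -> R) C e :
  measurable_fun [set: n.+1.-tuple T] F -> (forall x, `|F x| <= C) ->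
  measurable_fun [set: T] G -> (forall x, `|G x| <= C) ->
  (forall x, `|\int[prod_prob (fun i => P (lift ord0 i))]_y F (tuple_cons (x, y))
    - G x| <= e) ->
  `|\int[prod_prob P]_x F x - \int[P ord0]_x G x| <= e.
Proof.
move=> mF FC mG GC FGe; rewrite (Rintegral_prod_probS _ mF FC).
apply: normr_RintegralB_le => //; last exact: probability_integrable_bounded GC.
have := integrable_fubini_F (integrable_prod_prob_cons P mF FC).
apply: eq_integrable => // x _; rewrite /fubini_F /= /Rintegral fineK//.
apply: integrable_fin_num => //.
apply: (@probability_integrable_bounded _ _ _ _ (fun y => F (tuple_cons (x, y))) C) => //.
by apply: measurableT_comp => //; exact: measurable_tuple_cons2.
Qed.

Lemma measurable_sum_tnth n (X : 'I_n -> T -> R) :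
  (forall i, measurable_fun [set: T] (X i)) ->
  measurable_fun [set: n.-tuple T] (fun x => \sum_(i < n) X i (tnth x i)).
Proof.
move=> mX; apply: measurable_sum => i.
by apply: measurableT_comp; [exact: mX|exact: measurable_tnth].
Qed.

(** Given the first coordinate, the others contribute a cosine with phase [t * X ord0 x + b], so the
    hypothesis must be uniform in the phase. The Gaussian factor [rho] of the others is at most 1,
    so that the errors add up without being amplified. *)
Lemma prod_prob_cos_approx n (P : 'I_n -> probability T R) (X : 'I_n -> T -> R)
    (v e : 'I_n -> R) t k :
  (forall i, measurable_fun [set: T] (X i)) -> (forall i, 0 <= v i) ->
  (forall i b, `|\int[P i]_x cos (t * X i x + b)
    - expR (- (t ^+ 2 * v i / 2)) * cos (b + k * v i)| <= e i) ->
  forall b, `|\int[prod_prob P]_x cos (t * (\sum_(i < n) X i (tnth x i)) + b)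
    - expR (- (t ^+ 2 * (\sum_(i < n) v i) / 2)) * cos (b + k * \sum_(i < n) v i)|
  <= \sum_(i < n) e i.
Proof.
elim: n P X v e => [|n IH] P X v e mX v0 Xe b.
  rewrite !big_ord0 !(mulr0, mul0r) oppr0 expR0 mul1r addr0.
  rewrite (@eq_Rintegral _ _ _ _ _ (cst (cos b))) => [|x _]; last first.
    by rewrite big_ord0 mulr0 add0r.
  by rewrite Rintegral_cst//= indicT mulr1 subrr normr0.
set V := \sum_(i < n) v (lift ord0 i).
have V0 : 0 <= V by exact: sumr_ge0.
pose rho := expR (- (t ^+ 2 * V / 2)).
have rho1 : `|rho| <= 1.
  rewrite ger0_norm ?expR_ge0// expR_le1 oppr_le0.
  by apply: divr_ge0 => //; apply: mulr_ge0 => //; exact: sqr_ge0.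
rewrite [\sum_(i < n.+1) v i]big_ord_recl [\sum_(i < n.+1) e i]big_ord_recl -/V.
set E := \sum_(i < n) e _.
(* The tail of the tuple is replaced first, conditionally on the first coordinate; [G] is what is
   left, and its phase already carries the drift [k * V] of the tail. *)
pose G x := rho * cos (t * X ord0 x + (b + k * V)).
apply: (@le_trans _ _ (`|\int[prod_prob P]_x
      cos (t * (\sum_(i < n.+1) X i (tnth x i)) + b) - \int[P ord0]_x G x| +
    `|\int[P ord0]_x G x - expR (- (t ^+ 2 * (v ord0 + V) / 2))
      * cos (b + k * (v ord0 + V))|)).
  by rewrite (le_trans _ (ler_normD _ _))// addrA subrK.
rewrite addrC; apply: lerD.
  have intc : (P ord0).-integrable [set: T]
      (EFin \o (fun x => cos (t * X ord0 x + (b + k * V)))).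
    apply: (@probability_integrable_bounded _ _ _ _ _ 1) => //.
      exact: measurable_cosD.
    by move=> x; exact: cos_max.
  rewrite /G RintegralZl// [X in expR X](_ : _ =
    - (t ^+ 2 * V / 2) - t ^+ 2 * v ord0 / 2); last by field.
  rewrite expRD -/rho -mulrA -mulrBr; apply: normrM_le1 => //.
  have -> : b + k * (v ord0 + V) = b + k * V + k * v ord0 by ring.
  exact: Xe.
apply: (@normr_Rintegral_prod_probB_le _ P _ _ 1).
- by apply: measurable_cosD; exact: measurable_sum_tnth.
- by move=> x; exact: cos_max.
- by apply: measurable_funM => //; exact: measurable_cosD.
- by move=> x; apply: normrM_le1 => //; exact: cos_max.
- move=> x; have := IH (fun i => P (lift ord0 i)) (fun i => X (lift ord0 i)) _ _
    (fun i => mX _) (fun i => v0 _) (fun i => Xe _) (t * X ord0 x + b).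
  rewrite -/V -/rho /G; congr (`| _ - _ * cos _| <= _); last by ring.
  apply: eq_Rintegral => y _; congr cos; rewrite big_ord_recl tnth0/=.
  have -> : \sum_(i < n) X (lift ord0 i) (tnth (tuple_cons (x, y)) (lift ord0 i)) =
      \sum_(i < n) X (lift ord0 i) (tnth y i).
    by apply: eq_bigr => i _; rewrite tnthS.
  by rewrite /=; ring.
Qed.

End product_characteristic_function.

(** * Trigonometric approximation and weak convergence *)

Section trigonometric_approximation.
Context {R : realType}.
Implicit Types (f g p : R -> R) (phi psi : nat -> R) (x y z t b c A e : R).

(** The free phase gives the sines too, and frequency 0 the constants; the span is closed under
    products by the product-to-sum formula. *)
Inductive trig_poly : (R -> R) -> Prop :=
| trig_poly_cos t b : trig_poly (fun x => cos (t * x + b))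
| trig_polyD f g : trig_poly f -> trig_poly g -> trig_poly (fun x => f x + g x)
| trig_polyZ c f : trig_poly f -> trig_poly (fun x => c * f x).

Lemma trig_poly_cst c : trig_poly (fun=> c).
Proof.
rewrite (_ : (fun=> c) = (fun x => c * cos (0 * x + 0))).
  exact/trig_polyZ/trig_poly_cos.
by apply/funext => x; rewrite mul0r addr0 cos0 mulr1.
Qed.

Lemma trig_poly_cosM t b f : trig_poly f -> trig_poly (fun x => cos (t * x + b) * f x).
Proof.
elim=> [t' b'|g h _ IHg _ IHh|c g _ IHg].
- rewrite (_ : (fun x => _) = (fun x => 2^-1 * cos ((t + t') * x + (b + b'))
    + 2^-1 * cos ((t - t') * x + (b - b')))).
    by apply: trig_polyD; apply: trig_polyZ; exact: trig_poly_cos.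
  apply/funext => x.
  have -> : (t + t') * x + (b + b') = (t * x + b) + (t' * x + b') by ring.
  have -> : (t - t') * x + (b - b') = (t * x + b) - (t' * x + b') by ring.
  by rewrite (cosD (t * x + b)) (cosB (t * x + b)); field.
- rewrite (_ : (fun x => _) = (fun x => cos (t * x + b) * g x + cos (t * x + b) * h x)).
    exact: trig_polyD.
  by apply/funext => x; rewrite mulrDr.
- rewrite (_ : (fun x => _) = (fun x => c * (cos (t * x + b) * g x))).
    exact: trig_polyZ.
  by apply/funext => x; rewrite mulrCA.
Qed.

(* The expectation of [phi] under the binomial law of parameters [n] and [x]:
   the Bernstein operator, defined by conditioning on the first trial. *)
Fixpoint bernstein (n : nat) phi x :=
  if n is n'.+1 then
    x * bernstein n' (phi \o S) x + (1 - x) * bernstein n' phi x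
  else phi 0%N.

Lemma bernstein_cst n c x : bernstein n (fun=> c) x = c.
Proof. by elim: n => [//|n IH] /=; rewrite /comp IH; ring. Qed.

Lemma bernsteinD n phi psi x :
  bernstein n (fun k => phi k + psi k) x = bernstein n phi x + bernstein n psi x.
Proof. by elim: n phi psi => [//|n IH] phi psi /=; rewrite /comp !IH; ring. Qed.

Lemma bernsteinZ n c phi x :
  bernstein n (fun k => c * phi k) x = c * bernstein n phi x.
Proof. by elim: n phi => [//|n IH] phi /=; rewrite /comp !IH; ring. Qed.

Lemma le_bernstein n phi psi x : 0 <= x <= 1 ->
  (forall k, (k <= n)%N -> phi k <= psi k) -> bernstein n phi x <= bernstein n psi x.
Proof.
move=> /andP[x0 x1]; elim: n phi psi => [|n IH] phi psi le /=; first exact: le.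
apply: lerD; first by apply: ler_wpM2l => //; apply: IH => k kn; exact: le.
by apply: ler_wpM2l; [rewrite subr_ge0|apply: IH => k /leqW; exact: le].
Qed.

(** Squared mean plus variance of a binomial variable shifted by [a]. The shift is general because a
    first success changes it into [1 + a]; at [a = - n * x] only the variance remains. *)
Lemma bernstein_sqr n a x : bernstein n (fun k => (k%:R + a) ^+ 2) x =
  (n%:R * x + a) ^+ 2 + n%:R * (x * (1 - x)).
Proof.
elim: n a => [|n IH] a /=; first by rewrite !mul0r !add0r addr0.
rewrite (_ : _ \o S = fun k => (k%:R + (1 + a)) ^+ 2); last first.
  by apply/funext => k /=; rewrite -natr1 addrA.
by rewrite !IH -natr1; ring.
Qed.

(** Each step of the recursion multiplies by [(1 + sin) / 2] or [(1 - sin) / 2], and a sine is a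
    cosine with phase [- pi / 2]. *)
Lemma trig_poly_bernstein n phi t :
  trig_poly (fun x => bernstein n phi ((1 + sin (t * x)) / 2)).
Proof.
elim: n phi => [|n IH] phi /=; first exact: trig_poly_cst.
have trig_sinM f : trig_poly f -> trig_poly (fun x => sin (t * x) * f x).
  move=> /(trig_poly_cosM t (- (pi / 2))); congr trig_poly.
  by apply/funext => x; rewrite cosBpihalf.
rewrite (_ : (fun x => _) = (fun x =>
    2^-1 * (bernstein n (phi \o S) ((1 + sin (t * x)) / 2)
      + bernstein n phi ((1 + sin (t * x)) / 2)) +
    (2^-1 * (sin (t * x) * bernstein n (phi \o S) ((1 + sin (t * x)) / 2))
      + - 2^-1 * (sin (t * x) * bernstein n phi ((1 + sin (t * x)) / 2))))).
  apply: trig_polyD; first by apply: trig_polyZ; exact: trig_polyD.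
  by apply: trig_polyD; apply: trig_polyZ; exact: trig_sinM.
by apply/funext => x; field.
Qed.

(** Heine's theorem in a form where [y] may leave the segment: the points [k / n] are not restricted
    to [k <= n] when they are compared with [x]. *)
Lemma continuous_segment_unif f a b e : continuous f -> 0 < e ->
  exists2 d, 0 < d & forall x y, x \in `[a, b] -> `|x - y| < d -> `|f x - f y| < e.
Proof.
move=> cf e0.
have /compact_near_coveringP cov := @segment_compact R a b.
pose P d x := forall y, `|x - y| < d -> `|f x - f y| < e.
have : \forall d \near 0^'+, `[a, b] `<=` P d.
  apply: (cov R 0^'+ P) => x xab.
  have e20 : 0 < e / 2 by rewrite divr_gt0.
  have /cvgrPdist_lt/(_ _ e20)/nbhs_ballP[/= eta eta0 etaP] := cf x.
  have eta20 : 0 < eta / 2 by rewrite divr_gt0.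
  exists (ball x (eta / 2), [set d | d < eta / 2]) => /=.
    split; first exact: nbhsx_ballx.
    exact: nbhs_right_lt.
  move=> [x' d]/= [xx' d2] y x'y.
  have fx' : `|f x - f x'| < e / 2.
    apply: etaP; apply: lt_trans xx' _; rewrite ltr_pdivrMr// ltr_pMr//.
    by rewrite ltr1n.
  have fy : `|f x - f y| < e / 2.
    apply: etaP; rewrite /ball/= (_ : x - y = (x - x') + (x' - y)); last by ring.
    rewrite (le_lt_trans (ler_normD _ _))// [ltRHS]splitr ltrD//.
    exact: lt_trans x'y d2.
  rewrite (_ : f x' - f y = (f x - f y) - (f x - f x')); last by ring.
  by rewrite (le_lt_trans (ler_normB _ _))// [ltRHS]splitr ltrD.
move=> [/= d d0 dP]; exists (d / 2); first by rewrite divr_gt0.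
move=> x y xab; apply: (dP (d / 2)) => //=.
  rewrite sub0r normrN gtr0_norm ?divr_gt0// ltr_pdivrMr// ltr_pMr//.
  by rewrite ltr1n.
by rewrite divr_gt0.
Qed.

(** Chebyshev's inequality: the distance from [f (k / n)] to [f x] is at most [e / 2] when [k / n]
    is within [d] of [x], and otherwise at most [2 * A], which the factor [((k / n - x) / d)^2 >= 1]
    can only increase. Positivity of the operator and the binomial variance conclude. *)
Lemma bernstein_cvg_unif f A e : continuous f -> (forall x, `|f x| <= A) -> 0 < e ->
  exists n, forall x, 0 <= x <= 1 ->
    `|bernstein n (fun k => f (k%:R / n%:R)) x - f x| <= e.
Proof.
move=> cf fA e0.
have e20 : 0 < e / 2 by rewrite divr_gt0.
have [d d0 dP] := @continuous_segment_unif f 0 1 _ cf e20.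
have A0 : 0 <= A by apply: le_trans (fA 0).
(* The variance of [k] is at most [N], so the quadratic term contributes at most
   [2 * A / (d ^+ 2 * N)]; this [n] makes it at most [e / 2]. *)
have [n nP] : exists n : nat, 4 * A / (e * d ^+ 2) <= n.+1%:R.
  exists (Num.truncn (4 * A / (e * d ^+ 2))); exact: (ltW (truncnS_gt _)).
exists n.+1 => x x01; set N := n.+1%:R.
have N0 : 0 < N by rewrite ltr0n.
have pw k : `|f (k%:R / N) - f x| <= e / 2 + 2 * A / (d ^+ 2 * N ^+ 2) * (k%:R + - (N * x)) ^+ 2.
  have sq : (k%:R + - (N * x)) ^+ 2 = N ^+ 2 * (x - k%:R / N) ^+ 2.
    by field; rewrite gt_eqF.
  have c0 : 0 <= 2 * A / (d ^+ 2 * N ^+ 2) * (k%:R + - (N * x)) ^+ 2.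
    apply: mulr_ge0; last exact: sqr_ge0.
    by apply: divr_ge0; apply: mulr_ge0 => //; exact: sqr_ge0.
  have [xk|xk] := ltP `|x - k%:R / N| d.
    by rewrite distrC (le_trans (ltW (dP _ _ _ xk)))// ?lerDl// in_itv.
  apply: (le_trans (ler_normB _ _)).
  apply: (@le_trans _ _ (A + A)); first exact: lerD.
  rewrite -[leLHS]add0r; apply: lerD; first exact: ltW.
  rewrite sq (_ : _ * _ = 2 * A * ((x - k%:R / N) ^+ 2 / d ^+ 2)); last first.
    by field; rewrite !gt_eqF.
  have -> : A + A = 2 * A by ring.
  apply: ler_peMr; first exact: mulr_ge0.
  rewrite ler_pdivlMr ?exprn_gt0// mul1r.
  by rewrite -[leRHS]real_normK ?num_real// lerXn2r ?nnegrE// ltW.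
have x1x : x * (1 - x) <= 1.
  by case/andP: x01 => x0 x1; rewrite mulr_ile1 ?subr_ge0// lerBlDr lerDl.
have var : bernstein n.+1 (fun k => e / 2 + 2 * A / (d ^+ 2 * N ^+ 2)
     * (k%:R + - (N * x)) ^+ 2) x <= e.
  rewrite bernsteinD bernstein_cst bernsteinZ bernstein_sqr -/N subrr expr0n/= add0r.
  rewrite [leRHS]splitr lerD2l.
  rewrite (_ : _ * _ = 2 * A / (d ^+ 2) / N * (x * (1 - x))); last first.
    by field; rewrite !gt_eqF.
  apply: (@le_trans _ _ (2 * A / d ^+ 2 / N)).
    rewrite ler_piMr//; apply: divr_ge0; last exact: ltW.
    by apply: divr_ge0; [exact: mulr_ge0|exact: sqr_ge0].
  rewrite ler_pdivrMr// -ler_pdivrMl//; apply: le_trans nP.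
  by rewrite le_eqVlt; apply/orP; left; apply/eqP; field; rewrite !gt_eqF.
apply: le_trans var; rewrite ler_norml; apply/andP; split.
  rewrite lerBrDl -(bernstein_cst n.+1 (f x) x) -(mulN1r (bernstein _ _ _)).
  rewrite -bernsteinZ -bernsteinD; apply: le_bernstein => // k _.
  by have := pw k; rewrite ler_norml lerBrDl mulN1r => /andP[].
rewrite lerBlDr -[X in _ + X](bernstein_cst n.+1 (f x) x) -bernsteinD.
apply: le_bernstein => // k _.
by have := pw k; rewrite ler_norml lerBlDr => /andP[].
Qed.

Lemma continuous_ereal_EFin (f : \bar R -> R) : continuous f ->
  continuous (fun x : R => f x%:E).
Proof.
move=> cf x; apply: (@continuous_comp _ _ _ (@EFin R) f); last exact: cf.
by apply: cvg_EFin; [exact: nearW|exact: cvg_id].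
Qed.

(** The bound by [A] holds on the whole line, not only on [[-L, L]], because the Bernstein operator
    is positive and preserves constants. *)
Lemma trig_poly_approx (f : \bar R -> R) A e (L : R) : continuous f ->
  (forall x : \bar R, `|f x| <= A) -> 0 < e ->
  exists p, [/\ trig_poly p, forall x, `|p x| <= A &
    forall x, `|x| <= L -> `|p x - f x%:E| <= e].
Proof.
(* [M] is such that [|x / M| <= 1/2] on [[-L, L]]; there [asin] inverts the sine. *)
move=> cf fA e0; pose M := 2 * (`|L| + 1).
have M0 : 0 < M by rewrite mulr_gt0// ltr_wpDl.
(* Keeps the argument of [asin] in [[-1/2, 1/2]], so that [F] is continuous on the whole line. At
   [(1 + sin (x / M)) / 2] with [|x| <= L] the clamp is inactive, since [|sin (x / M)| <= 1/2]. *)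
pose clamp z := Num.max (- 2^-1) (Num.min (2 * z - 1) 2^-1).
pose F z := f (M * asin (clamp z))%:E.
have clampP z : - 2^-1 <= clamp z <= 2^-1.
  by rewrite /clamp le_max lexx/= ge_max ge_min lexx orbT andbT; lra.
have ccl : continuous clamp.
  move=> z; apply: (@continuous_max R R (fun=> - 2^-1) _ z); first exact: cvg_cst.
  apply: (@continuous_min R R _ (fun=> 2^-1) z); last exact: cvg_cst.
  by apply: cvgB; [apply: cvgM; [exact: cvg_cst|exact: cvg_id]|exact: cvg_cst].
have cF : continuous F.
  move=> z.
  apply: (@continuous_comp _ _ _ (fun z => M * asin (clamp z)) (fun y => f y%:E)).
    apply: (@continuousM R R (fun=> M) (asin \o clamp) z); first exact: cvg_cst.
    apply: continuous_comp; first exact: ccl.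
    apply: continuous_asin; have /andP[? ?] := clampP z; apply/andP; split; lra.
  exact: continuous_ereal_EFin.
have FA z : `|F z| <= A by exact: fA.
have [n nP] := bernstein_cvg_unif cF FA e0.
have s01 x : 0 <= (1 + sin (M^-1 * x)) / 2 <= 1.
  have := sin_geN1 (M^-1 * x); have := sin_le1 (M^-1 * x) => ? ?.
  by apply/andP; split; lra.
exists (fun x => bernstein n (fun k => F (k%:R / n%:R)) ((1 + sin (M^-1 * x)) / 2)).
split=> [|x|x xL].
- exact: trig_poly_bernstein.
- rewrite ler_norml; apply/andP; split.
    rewrite -[leLHS](bernstein_cst n _ ((1 + sin (M^-1 * x)) / 2)).
    by apply: le_bernstein => // k _; have := FA (k%:R / n%:R); rewrite ler_norml => /andP[].
  rewrite -[leRHS](bernstein_cst n _ ((1 + sin (M^-1 * x)) / 2)).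
  by apply: le_bernstein => // k _; have := FA (k%:R / n%:R); rewrite ler_norml => /andP[].
- have xM : `|M^-1 * x| <= 2^-1.
    rewrite normrM gtr0_norm ?invr_gt0// mulrC ler_pdivrMr// /M.
    rewrite mulrA mulVf// mul1r (le_trans xL)// (le_trans (ler_norm L))//.
    by rewrite lerDl.
  have sx : `|sin (M^-1 * x)| <= 2^-1 := le_trans (normr_sin_le _) xM.
  suff <- : F ((1 + sin (M^-1 * x)) / 2) = f x%:E by exact: nP.
  rewrite /F /clamp (_ : 2 * _ - 1 = sin (M^-1 * x)); last by field.
  move: sx; rewrite ler_norml => /andP[s1 s2].
  rewrite (min_l s2) (max_r s1) sinK ?mulrA ?divff ?mul1r ?gt_eqF//.
  move: xM; rewrite ler_norml in_itv/= => /andP[x1 x2].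
  by have := @pihalf_ge1 R => ?; apply/andP; split; lra.
Qed.

End trigonometric_approximation.

(** * From trigonometric test functions to weak convergence *)

Section weak_convergence.
Context {R : realType}.
Implicit Types (nu : nat -> probability (measurableTypeR R) R)
  (xi : probability (measurableTypeR R) R) (t b A B e : R).

Lemma normr_RintegralB_le_integral d (T : measurableType d)
    (P : probability T R) (f g h : T -> R) :
  P.-integrable [set: T] (EFin \o f) -> P.-integrable [set: T] (EFin \o g) ->
  P.-integrable [set: T] (EFin \o h) ->
  (forall x, `|f x - g x| <= h x) ->
  `|\int[P]_x f x - \int[P]_x g x| <= \int[P]_x h x.
Proof.
move=> intf intg inth fgh; rewrite -RintegralB//.
have intfg : P.-integrable [set: T] (EFin \o (f \- g)).
  by rewrite (_ : _ \o _ = (EFin \o f) \- (EFin \o g))%E//; exact: integrableB.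
apply: (le_trans (le_normr_Rintegral _ _)) => //.
by apply: le_Rintegral => //; exact: integrable_norm.
Qed.

(** Twice the hyperbolic cosine. At a log-likelihood ratio it is the likelihood ratio plus its
    inverse, whose expectations under the noise factor over the coordinates. *)
Definition cosh2 (x : R) : R := expR x + expR (- x).

Lemma measurable_cosh2 : measurable_fun [set: R] cosh2.
Proof.
apply: measurable_funD; apply: continuous_measurable_fun.
  exact: continuous_expR.
by move=> x; apply: continuous_comp; [exact: opp_continuous|exact: continuous_expR].
Qed.

Lemma cosh2_ge0 x : 0 <= cosh2 x.
Proof. by rewrite addr_ge0 ?expR_ge0. Qed.

Lemma normr_le_cosh2 x : `|x| <= cosh2 x.
Proof.
have h1 := expR_ge1Dx x; have h2 := expR_ge1Dx (- x).
have h3 := expR_ge0 x; have h4 := expR_ge0 (- x).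
by rewrite /cosh2 ler_norml; apply/andP; split; lra.
Qed.

Lemma integrable_cosh2 xi B : (\int[xi]_x (cosh2 x)%:E <= B%:E)%E ->
  xi.-integrable [set: R] (EFin \o cosh2).
Proof.
move=> le; apply: ge0_integrable_lty; first exact: measurable_cosh2.
  exact: cosh2_ge0.
exact: le_lt_trans le (ltry B).
Qed.

Lemma measurable_ereal_EFin (f : \bar R -> R) : continuous f ->
  measurable_fun [set: R] (fun x : R => f x%:E).
Proof. by move=> cf; apply: continuous_measurable_fun; exact: continuous_ereal_EFin. Qed.

Lemma measurable_trig_poly (p : R -> R) : trig_poly p -> measurable_fun [set: R] p.
Proof.
elim=> [t b|f g _ mf _ mg|c f _ mf].
- by apply: (@measurable_cosD _ _ _ id); exact: measurable_id.
- exact: measurable_funD.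
- exact: measurable_funM.
Qed.

Lemma integrable_trig_poly xi (p : R -> R) : trig_poly p ->
  xi.-integrable [set: R] (EFin \o p).
Proof.
elim=> [t b|f g _ intf _ intg|c f _ intf].
- apply: (@probability_integrable_bounded _ _ _ _ _ 1) => //.
    by apply: (@measurable_cosD _ _ _ id); exact: measurable_id.
  by move=> x; exact: cos_max.
- exact: integrable_add.
- exact: integrable_scale.
Qed.

Lemma trig_poly_cvg nu xi :
  (forall t b, \int[nu n]_x cos (t * x + b) @[n --> \oo]
    --> \int[xi]_x cos (t * x + b)) ->
  forall p, trig_poly p -> \int[nu n]_x p x @[n --> \oo] --> \int[xi]_x p x.
Proof.
move=> cvgc p; elim=> [t b|f g tf IHf tg IHg|c f tf IHf]; first exact: cvgc.
- rewrite RintegralD//; [|exact: integrable_trig_poly..].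
  under eq_cvg do rewrite RintegralD ?integrable_trig_poly//.
  exact: cvgD.
- rewrite RintegralZl//; last exact: integrable_trig_poly.
  under eq_cvg do rewrite RintegralZl ?integrable_trig_poly//.
  by apply: cvgM; [exact: cvg_cst|exact: IHf].
Qed.

(** One polynomial serves every law with the same bound [B]. Beyond [L] the difference is at most
    [2 * A], hence at most [2 * A / L * cosh2 x] because [|x| <= cosh2 x]. *)
Lemma trig_poly_integral_approx (f : \bar R -> R) A e B : 0 < e ->
  continuous f -> (forall x : \bar R, `|f x| <= A) -> 0 <= B ->
  exists2 p, trig_poly p & forall xi, (\int[xi]_x (cosh2 x)%:E <= B%:E)%E ->
    `|\int[xi]_x p x - \int[xi]_x f x%:E| <= e.
Proof.
move=> e0 cf fA B0.
have A0 : 0 <= A by apply: le_trans (fA 0%E).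
have e20 : 0 < e / 2 by rewrite divr_gt0.
(* Makes [2 * A * B / L] at most [e / 2]; the added ones keep [L] positive. *)
pose L := (4 * (A + 1) * (B + 1)) / e.
have L0 : 0 < L by rewrite divr_gt0 ?mulr_gt0 ?ltr_wpDl.
have [p [tp pA pf]] := @trig_poly_approx _ f A _ L cf fA e20.
exists p => // xi xiB.
have intc := integrable_cosh2 xiB.
have mp := measurable_trig_poly tp.
pose h x := e / 2 + 2 * A / L * cosh2 x.
have AL0 : 0 <= 2 * A / L by apply: divr_ge0; [exact: mulr_ge0|exact: ltW].
have fph x : `|p x - f x%:E| <= h x.
  have h0 : 0 <= 2 * A / L * cosh2 x.
    by apply: mulr_ge0 => //; exact: cosh2_ge0.
  have [xL|xL] := leP `|x| L; first by rewrite (le_trans (pf _ xL))// lerDl.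
  apply: (le_trans (ler_normB _ _)); apply: (@le_trans _ _ (A + A)).
    exact: lerD.
  rewrite -[leLHS]add0r lerD ?(ltW e20)//.
  have -> : A + A = 2 * A by ring.
  rewrite -mulrA; apply: ler_peMr; first exact: mulr_ge0.
  rewrite mulrC ler_pdivlMr// mul1r (le_trans (ltW xL))//.
  exact: normr_le_cosh2.
have inth2 : xi.-integrable [set: R] (EFin \o (fun x => 2 * A / L * cosh2 x)).
  exact: integrable_scale.
have inte : xi.-integrable [set: R] (EFin \o cst (e / 2)).
  exact: finite_measure_integrable_cst.
have inth : xi.-integrable [set: R] (EFin \o h).
  exact: (integrableD _ inte inth2).
apply: (le_trans (normr_RintegralB_le_integral _ _ inth fph)).
- exact: integrable_trig_poly.
- apply: (@probability_integrable_bounded _ (measurableTypeR R) R _ (fun x => f x%:E) A) => //.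
  exact: measurable_ereal_EFin.
rewrite /h RintegralD// Rintegral_cst// RintegralZl//.
have -> : fine (xi [set: R]) = 1 by rewrite probability_setT.
have cB : \int[xi]_x cosh2 x <= B.
  rewrite -lee_fin /Rintegral fineK//.
  exact: (integrable_fin_num _ intc).
rewrite mulr1 [leRHS]splitr lerD2l.
apply: (@le_trans _ _ (2 * A / L * B)).
  exact: ler_wpM2l.
rewrite /L (_ : _ * B = (e / 2) * ((A / (A + 1)) * (B / (B + 1)))); last first.
  by field; rewrite !gt_eqF// ltr_wpDl.
rewrite ler_piMr// ?(ltW e20)//.
have le1 (z : R) : 0 <= z -> 0 <= z / (z + 1) <= 1.
  move=> z0; apply/andP; split; first by rewrite divr_ge0// addr_ge0.
  by rewrite ler_pdivrMr ?mul1r ?lerDl// ltr_wpDl.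
by have /andP[a0 a1] := le1 _ A0; have /andP[b0 b1] := le1 _ B0; rewrite mulr_ile1.
Qed.

Lemma cvg_integral_of_cos nu xi B :
  (\forall n \near \oo, (\int[nu n]_x (cosh2 x)%:E <= B%:E)%E) ->
  (\int[xi]_x (cosh2 x)%:E <= B%:E)%E ->
  (forall t b, \int[nu n]_x cos (t * x + b) @[n --> \oo]
    --> \int[xi]_x cos (t * x + b)) ->
  forall f : \bar R -> R, continuous f -> bounded_fun f ->
  (\int[nu n]_x (f x%:E)%:E @[n --> \oo] --> \int[xi]_x (f x%:E)%:E)%E.
Proof.
move=> nuB xiB cvgc f cf [A0 [_ fA0]].
pose A := A0 + 1.
have fA (x : \bar R) : `|f x| <= A by apply: fA0 => //; rewrite /A ltrDl.
have B0 : 0 <= B.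
  rewrite -lee_fin; apply: le_trans xiB; apply: integral_ge0 => x _.
  by rewrite lee_fin cosh2_ge0.
have fE (P : probability (measurableTypeR R) R) :
    (\int[P]_x (f x%:E)%:E = (\int[P]_x f x%:E)%:E)%E.
  rewrite /Rintegral fineK//; apply: integrable_fin_num => //.
  apply: (@probability_integrable_bounded _ (measurableTypeR R) R _ (fun x => f x%:E) A) => //.
  exact: measurable_ereal_EFin.
rewrite fE; under eq_cvg do rewrite fE.
apply: cvg_EFin; first exact: nearW.
apply/cvgrPdist_le => e e0.
have e30 : 0 < e / 3 by rewrite divr_gt0.
have [p tp pP] := @trig_poly_integral_approx f A _ B e30 cf fA B0.
have /cvgrPdist_le/(_ _ e30) cvgp := trig_poly_cvg cvgc tp.
near=> n => /=.
have h1 : `|\int[nu n]_x p x - \int[nu n]_x f x%:E| <= e / 3.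
  by apply: pP; near: n.
have h2 : `|\int[xi]_x p x - \int[xi]_x f x%:E| <= e / 3 by exact: pP.
have h3 : `|\int[xi]_x p x - \int[nu n]_x p x| <= e / 3 by near: n.
move: h1 h2 h3; set a1 := Rintegral _ _ _; set a2 := Rintegral _ _ _.
set a3 := Rintegral _ _ _; set a4 := Rintegral _ _ _ => h1 h2 h3.
rewrite (_ : a4 - a2 = (a1 - a2) + ((a3 - a1) - (a3 - a4))); last by ring.
rewrite (_ : e = e / 3 + (e / 3 + e / 3)); last by field.
apply: (le_trans (ler_normD _ _)); apply: lerD => //.
by apply: (le_trans (ler_normB _ _)); apply: lerD.
Unshelve. all: by end_near. Qed.

End weak_convergence.

(** * Densities and the Gaussian characteristic function *)

Section density_and_substitution.
Local Open Scope ereal_scope.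
Local Open Scope charge_scope.

Section density.
Context d (T : measurableType d) (R : realType).
Variables (nu : {finite_measure set T -> \bar R})
  (mu : {sigma_finite_measure set T -> \bar R}) (g : T -> R).
Hypothesis intg : mu.-integrable [set: T] (EFin \o g).
Hypothesis nuE : forall A, measurable A -> nu A = \int[mu]_(x in A) (g x)%:E.

Lemma dominates_density : nu `<< mu.
Proof.
apply/null_content_dominatesP => A mA muA0; rewrite nuE//.
by apply: null_set_integral => //; apply: measurable_funTS; exact: measurable_int intg.
Qed.

Lemma ae_eq_Radon_Nikodym_density :
  ae_eq mu [set: T] ('d (charge_of_finite_measure nu) '/d mu) (EFin \o g).
Proof.
have numu := dominates_density.
apply: integral_ae_eq => //.
- exact: Radon_Nikodym_integrable.
- exact: measurable_int intg.
by move=> A _ mA; rewrite -Radon_Nikodym_integral// -nuE.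
Qed.

Hypothesis g0 : forall x, (0 <= g x)%R.

Lemma ge0_integral_density (f : T -> \bar R) :
  measurable_fun [set: T] f -> (forall x, 0 <= f x) ->
  \int[nu]_x f x = \int[mu]_x (f x * (g x)%:E).
Proof.
move=> mf f0; have numu := dominates_density.
have mg : measurable_fun [set: T] (EFin \o g) by exact: measurable_int intg.
rewrite -(Radon_Nikodym_SigmaFinite.change_of_variables numu)//.
apply: ge0_ae_eq_integral => //.
- apply: emeasurable_funM => //.
  exact: (measurable_int mu (Radon_Nikodym_SigmaFinite.f_integrable _)).
- exact: emeasurable_funM.
- by move=> x _; rewrite mule_ge0// Radon_Nikodym_SigmaFinite.f_ge0.
- by move=> x _; rewrite mule_ge0// lee_fin.
- apply: ae_eqe_mul2l.
  apply: ae_eq_trans ae_eq_Radon_Nikodym_density.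
  exact: ae_eq_Radon_Nikodym_SigmaFinite.
Qed.

End density.

Section affine.
Context {R : realType} (k a : R).
Hypothesis k0 : (0 < k)%R.
Local Notation mu := (@lebesgue_measure R).

Let phi (x : measurableTypeR R) : measurableTypeR R := (k * x + a)%R.

Let mphi : measurable_fun [set: measurableTypeR R] phi.
Proof. by apply: measurable_funD => //; exact: measurable_funM. Qed.

Let pf : {measure set (measurableTypeR R) -> \bar R}.
Proof. by refine (pushforward mu phi); exact: mphi. Defined.

Let nu : {measure set (measurableTypeR R) -> \bar R} :=
  mscale (NngNum (ltW k0)) pf.

(** [k] times the image of Lebesgue measure under [phi] gives half-open intervals their length, and
    this characterizes Lebesgue measure. *)
Let nuE A : measurable A -> mu A = nu A.
Proof.
apply: lebesgue_measure_unique => _ [[x y] _ <-]/=.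
rewrite /nu /mscale/= /pf /pushforward/=.
rewrite (_ : phi @^-1` _ = `](x - a) / k, (y - a) / k]%classic)%R; last first.
  apply/seteqP; split => z /=; rewrite !in_itv/= /phi.
    by rewrite ltr_pdivrMr// ler_pdivlMr// ltrBlDr lerBrDr (mulrC z).
  by rewrite ltr_pdivrMr// ler_pdivlMr// ltrBlDr lerBrDr (mulrC z).
rewrite !lebesgue_measure_itv/= !lte_fin ltr_pM2r ?invr_gt0// ltrBlDr subrK.
case: ifPn => [xy|]; last by rewrite mule0.
by rewrite -!EFinB -EFinM; congr EFin; field; rewrite gt_eqF.
Qed.

Lemma ge0_integral_affine (f : R -> \bar R) :
  measurable_fun [set: R] f -> (forall x, 0 <= f x) ->
  \int[mu]_x f x = k%:E * \int[mu]_x f (k * x + a)%R.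
Proof.
move=> mf f0.
rewrite (@eq_measure_integral _ _ _ _ nu) => [|A mA _]; last exact: nuE.
rewrite ge0_integral_mscale// ge0_integral_pushforward//=.
Qed.

End affine.

End density_and_substitution.

(** * The Gaussian law: exponential tilting and characteristic function *)

Section standard_normal.
Context {R : realType}.
Implicit Types (m s t b h x : R).
Local Notation mu := (@lebesgue_measure R).

Definition gauss : probability (measurableTypeR R) R := normal_prob 0 1.

Lemma normal_pdf_affine m s x : 0 < s ->
  s * normal_pdf m s (s * x + m) = normal_pdf 0 1 x.
Proof.
move=> s0; rewrite !normal_pdfE ?oner_neq0 ?gt_eqF// /normal_peak /normal_fun.
rewrite subr0 addrK mulrA; congr (_ * expR _).
  have -> : s ^+ 2 * pi *+ 2 = s ^+ 2 * (1 ^+ 2 * pi *+ 2) by ring.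
  rewrite sqrtrM ?sqr_ge0// sqrtr_sqr gtr0_norm// invfM mulrA divff ?mul1r//.
  by rewrite gt_eqF.
by field; rewrite gt_eqF.
Qed.

(** Completing the square: tilting the standard Gaussian density by an exponential translates it. *)
Lemma normal_pdf_tilt h x :
  expR (h * x) * normal_pdf 0 1 x = expR (h ^+ 2 / 2) * normal_pdf h 1 x.
Proof.
rewrite !normal_pdfE ?oner_neq0// mulrCA [RHS]mulrCA; congr (_ * _).
by rewrite /normal_fun -!expRD; congr expR; field.
Qed.

Lemma ge0_integral_normal_prob m s (f : R -> \bar R) :
  measurable_fun [set: R] f -> (forall x, 0 <= f x)%E ->
  (\int[normal_prob m s]_x f x = \int[mu]_x (f x * (normal_pdf m s x)%:E))%E.
Proof.
move=> mf f0; apply: ge0_integral_density => //.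
- exact: integrable_normal_pdf.
- exact: normal_pdf_ge0.
Qed.

Lemma ge0_integral_normal_prob_gauss m s (f : R -> \bar R) : 0 < s ->
  measurable_fun [set: R] f -> (forall x, 0 <= f x)%E ->
  (\int[normal_prob m s]_x f x = \int[gauss]_x f (s * x + m)%R)%E.
Proof.
move=> s0 mf f0.
have mfa : measurable_fun [set: R] (fun x => f (s * x + m)).
  by apply: measurableT_comp => //; apply: measurable_funD => //; exact: measurable_funM.
have mpdf m' s' : measurable_fun [set: R] (EFin \o normal_pdf m' s').
  by apply/measurable_EFinP; exact: measurable_normal_pdf.
rewrite (ge0_integral_normal_prob m s mf f0).
rewrite /gauss (@ge0_integral_normal_prob 0 1 _ mfa (fun x => f0 _)).
rewrite (ge0_integral_affine m s0); last 2 first.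
- by apply: emeasurable_funM => //; exact: (mpdf m s).
- by move=> x; rewrite mule_ge0// lee_fin normal_pdf_ge0.
rewrite -ge0_integralZl//; last 3 first.
- apply: emeasurable_funM => //.
  apply: (measurableT_comp (mpdf m s)).
  by apply: measurable_funD => //; exact: measurable_funM.
- by move=> x _; rewrite mule_ge0// lee_fin normal_pdf_ge0.
- by rewrite lee_fin ltW.
by apply: eq_integral => x _; rewrite muleCA -EFinM normal_pdf_affine.
Qed.

Lemma ge0_integral_gauss_tilt h (f : R -> R) :
  measurable_fun [set: R] f -> (forall x, 0 <= f x) ->
  (\int[gauss]_x (f x * expR (h * x))%:E =
   (expR (h ^+ 2 / 2))%:E * \int[gauss]_x (f (x + h))%:E)%E.
Proof.
move=> mf f0.
have mexp : measurable_fun [set: R] (fun x => expR (h * x)).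
  by apply: measurableT_comp => //; exact: measurable_funM.
have -> : (\int[gauss]_x (f (x + h))%:E = \int[normal_prob h 1]_x (f x)%:E)%E.
  rewrite ge0_integral_normal_prob_gauss//.
  - by apply: eq_integral => x _; rewrite mul1r.
  - exact/measurable_EFinP.
rewrite (@ge0_integral_normal_prob h 1 (fun x => (f x)%:E))//; last exact/measurable_EFinP.
rewrite (@ge0_integral_normal_prob 0 1 (fun x => (f x * expR (h * x))%:E)); last 2 first.
- by apply/measurable_EFinP; exact: measurable_funM.
- by move=> x; rewrite lee_fin mulr_ge0// expR_ge0.
rewrite -ge0_integralZl//.
- apply: eq_integral => x _; rewrite -!EFinM; congr EFin.
  by rewrite -mulrA normal_pdf_tilt mulrCA.
- by apply: emeasurable_funM; apply/measurable_EFinP => //; exact: measurable_normal_pdf.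
- by move=> x _; rewrite mule_ge0// lee_fin ?normal_pdf_ge0.
Qed.

Lemma integral_gauss_expR h : (\int[gauss]_x (expR (h * x))%:E = (expR (h ^+ 2 / 2))%:E)%E.
Proof.
have := @ge0_integral_gauss_tilt h (cst 1) (measurable_cst _) (fun=> ler01).
under eq_integral do rewrite mul1r.
move=> ->; have -> : (\int[gauss]_x (cst (1 : R) (x + h))%:E = 1)%E.
  by apply: (etrans (integral_cst gauss measurableT 1%E)); rewrite mul1e; exact: probability_setT.
by rewrite mule1.
Qed.

(** Adding 1 to a function bounded by 1 makes it nonnegative; identities proved for nonnegative
    integrands are carried over in this way to cosines. *)
Lemma integral_1DE (P : probability (measurableTypeR R) R) (g : R -> R) :
  measurable_fun [set: R] g -> (forall x, `|g x| <= 1) ->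
  (\int[P]_x (1 + g x)%:E = (1 + \int[P]_x g x)%:E)%E.
Proof.
move=> mg g1.
have intg : P.-integrable [set: R] (EFin \o g).
  exact: (@probability_integrable_bounded _ (measurableTypeR R) R _ g 1).
have int1 : P.-integrable [set: R] (EFin \o cst (1 : R)).
  exact: finite_measure_integrable_cst.
under eq_integral do rewrite EFinD.
rewrite (integralD _ int1 intg)// EFinD; congr (_ + _)%E.
  by apply: (etrans (integral_cst P measurableT 1%E)); rewrite mul1e; exact: probability_setT.
by rewrite /Rintegral fineK//; exact: integrable_fin_num.
Qed.

Let onem_ge0 (y : R) : `|y| <= 1 -> 0 <= 1 + y.
Proof. by rewrite ler_norml => /andP[y1 _]; rewrite -lerBlDl sub0r. Qed.

Lemma Rintegral_gauss_affine m s (g : R -> R) : 0 < s ->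
  measurable_fun [set: R] g -> (forall x, `|g x| <= 1) ->
  \int[normal_prob m s]_x g x = \int[gauss]_x g (s * x + m).
Proof.
move=> s0 mg g1.
have mga : measurable_fun [set: R] (fun x => g (s * x + m)).
  by apply: measurableT_comp => //; apply: measurable_funD => //; exact: measurable_funM.
pose N : probability (measurableTypeR R) R := normal_prob m s.
suff : (1 + \int[N]_x g x = 1 + \int[gauss]_x g (s * x + m))%R by exact: addrI.
have e1 := integral_1DE N mg g1.
have e2 := integral_1DE gauss mga (fun x => g1 _).
apply: EFin_inj; apply: (etrans (esym e1)); apply: (etrans _ e2).
apply: (@ge0_integral_normal_prob_gauss m s (fun x => (1 + g x)%:E)) => //.
- by apply/measurable_EFinP; exact: measurable_funD.
- by move=> x; rewrite lee_fin onem_ge0.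
Qed.

Lemma integrable_gauss_expR h : gauss.-integrable [set: R] (EFin \o (fun x => expR (h * x))).
Proof.
have mexp : measurable_fun [set: R] (fun x => expR (h * x)).
  by apply: measurableT_comp => //; exact: measurable_funM.
by apply: ge0_integrable_lty => //; rewrite integral_gauss_expR ltry.
Qed.

Lemma Rintegral_gauss_tilt h (g : R -> R) :
  measurable_fun [set: R] g -> (forall x, `|g x| <= 1) ->
  \int[gauss]_x (g x * expR (h * x)) =
  expR (h ^+ 2 / 2) * \int[gauss]_x g (x + h).
Proof.
move=> mg g1.
have mgh : measurable_fun [set: R] (fun x => g (x + h)).
  by apply: measurableT_comp => //; exact: measurable_funD.
have inte := integrable_gauss_expR h.
have intge : gauss.-integrable [set: R] (EFin \o (fun x => g x * expR (h * x))).
  apply: (le_integrable measurableT _ _ inte) => /=.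
    apply: measurableT_comp => //; apply: measurable_funM => //.
    by apply: measurableT_comp => //; exact: measurable_funM.
  by move=> x _; rewrite lee_fin normrM ler_piMl.
have := @ge0_integral_gauss_tilt h (fun x => 1 + g x).
rewrite (integral_1DE _ mgh)// -EFinM => tilt.
suff : (expR (h ^+ 2 / 2) + \int[gauss]_x (g x * expR (h * x)) =
    expR (h ^+ 2 / 2) * (1 + \int[gauss]_x g (x + h)))%R.
  by rewrite mulrDr mulr1 => /addrI.
apply: EFin_inj; rewrite -tilt => [||x]; last 2 first.
- exact: measurable_funD.
- exact: onem_ge0.
under eq_integral do rewrite mulrDl mul1r EFinD.
rewrite (integralD _ inte intge)// EFinD integral_gauss_expR; congr (_ + _)%E.
by rewrite /Rintegral fineK//; exact: integrable_fin_num.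
Qed.

Definition gauss_cos b t : R := \int[gauss]_x cos (t * x + b).

Lemma integrable_gauss_cos t b :
  gauss.-integrable [set: R] (EFin \o (fun x => cos (t * x + b))).
Proof.
apply: (@probability_integrable_bounded _ (measurableTypeR R) R _ _ 1) => //.
  by apply: (@measurable_cosD _ _ _ id); exact: measurable_id.
by move=> x; exact: cos_max.
Qed.

Lemma gauss_cos_tilt b t h :
  \int[gauss]_x (cos (t * x + (b - pi / 2)) * expR (h * x)) =
  expR (h ^+ 2 / 2) *
    (cos (t * h) * gauss_cos (b - pi / 2) t + sin (t * h) * gauss_cos b t).
Proof.
rewrite Rintegral_gauss_tilt; last 2 first.
- by apply: (@measurable_cosD _ _ _ id); exact: measurable_id.
- by move=> x; exact: cos_max.
congr (_ * _); rewrite /gauss_cos -!RintegralZl//; [|exact: integrable_gauss_cos..].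
have intZ c b' : gauss.-integrable [set: R] (EFin \o (fun x => c * cos (t * x + b'))).
  by apply: integrable_scale; exact: integrable_gauss_cos.
rewrite -RintegralD//; apply: eq_Rintegral => x _.
rewrite mulrDr -addrA addrCA cosD; congr (_ + _).
by rewrite addrA sinBpihalf mulrN opprK.
Qed.

(** Pointwise, [cos ((t + h) * x + b) - cos (t * x + b)] and
    [- sin (t * x + b) * (expR (h * x) - 1)] agree to first order in [h * x]. The error is at most
    [3 * expR |x| * (h * x)^2], and [x^2 <= 2 * expR |x|] leaves [6 * h^2] times two exponentials,
    each of mean [expR 2]. *)
Lemma gauss_cos_increment b t h : `|h| <= 1 ->
  `|(gauss_cos b (t + h) - gauss_cos b t)
    - (- (expR (h ^+ 2 / 2) *
       (cos (t * h) * gauss_cos (b - pi / 2) t + sin (t * h) * gauss_cos b t))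
      - - (expR (0 ^+ 2 / 2) *
       (cos (t * 0) * gauss_cos (b - pi / 2) t + sin (t * 0) * gauss_cos b t)))|
  <= (12 * expR 2) * `|h| ^+ 2.
Proof.
move=> h1; rewrite -!gauss_cos_tilt.
have inttilt k : gauss.-integrable [set: R]
    (EFin \o (fun x => cos (t * x + (b - pi / 2)) * expR (k * x))).
  apply: (le_integrable measurableT _ _ (integrable_gauss_expR k)) => /=.
    apply: measurableT_comp => //; apply: measurable_funM.
      by apply: (@measurable_cosD _ _ _ id); exact: measurable_id.
    by apply: measurableT_comp => //; exact: measurable_funM.
  by move=> x _; rewrite lee_fin normrM ler_piMl// cos_max.
pose f x := cos ((t + h) * x + b) + cos (t * x + (b - pi / 2)) * expR (h * x).
pose g x := cos (t * x + b) + cos (t * x + (b - pi / 2)) * expR (0 * x).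
pose k x := 6 * `|h| ^+ 2 * expR (2 * x) + 6 * `|h| ^+ 2 * expR (- 2 * x).
have intf : gauss.-integrable [set: R] (EFin \o f).
  by apply: integrable_add => //; exact: integrable_gauss_cos.
have intg : gauss.-integrable [set: R] (EFin \o g).
  by apply: integrable_add => //; exact: integrable_gauss_cos.
have intkZ c : gauss.-integrable [set: R] (EFin \o (fun x => 6 * `|h| ^+ 2 * expR (c * x))).
  by apply: integrable_scale; exact: integrable_gauss_expR.
have intk : gauss.-integrable [set: R] (EFin \o k) by exact: integrable_add.
have Rexp c : \int[gauss]_x expR (c * x) = expR (c ^+ 2 / 2).
  by rewrite /Rintegral integral_gauss_expR.
have -> : 12 * expR 2 * `|h| ^+ 2 = \int[gauss]_x k x.
  rewrite RintegralD// !RintegralZl ?Rexp//; [|exact: integrable_gauss_expR..].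
  have -> : (- 2) ^+ 2 / 2 = 2 :> R by field.
  have -> : 2 ^+ 2 / 2 = 2 :> R by field.
  by ring.
rewrite [X in `|X|](_ : _ = \int[gauss]_x f x - \int[gauss]_x g x); last first.
  by rewrite !RintegralD//; [rewrite /gauss_cos; ring|exact: integrable_gauss_cos..].
apply: normr_RintegralB_le_integral => // x.
set th := t * x + b; set y := h * x.
have yx : `|y| <= `|x| by rewrite normrM; apply: ler_piMl.
rewrite /f /g mul0r expR0 mulr1 (_ : (t + h) * x + b = th + y); last first.
  by rewrite /th /y; ring.
have -> : t * x + (b - pi / 2) = th - pi / 2 by rewrite /th; ring.
rewrite cosBpihalf (_ : _ - _ = (cos (th + y) - cos th + sin th * y)
  + sin th * (expR y - 1 - y)); last by ring.
apply: (le_trans (ler_normD _ _)).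
apply: (@le_trans _ _ (2 * y ^+ 2 + expR `|x| * y ^+ 2)).
  apply: lerD; first exact: cosD_taylor1.
  apply: normrM_le1; first exact: sin_max.
  apply: (le_trans (normr_expRB1B_le y)); rewrite real_normK ?num_real//.
  by apply: ler_wpM2r; [exact: sqr_ge0|rewrite ler_expR].
have ex1 : 1 <= expR `|x| by rewrite -[leLHS]expR0 ler_expR.
have x2 : x ^+ 2 <= 2 * expR `|x|.
  have := @expR_ge1Dxn _ `|x| 1 (normr_ge0 x).
  rewrite real_normK ?num_real// => h2; have : (2`!)%:R = 2 :> R by [].
  by move=> e2; move: h2; rewrite e2 => ?; lra.
have e2x : expR `|x| * expR `|x| <= expR (2 * x) + expR (- 2 * x).
  have -> : expR `|x| * expR `|x| = expR (2 * `|x|) by rewrite -expRD; congr expR; ring.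
  have e1 := expR_ge0 (2 * x); have e2 := expR_ge0 (- 2 * x).
  have [x0|x0] := leP 0 x.
    have -> : `|x| = x by rewrite ger0_norm.
    lra.
  have -> : 2 * `|x| = - 2 * x by rewrite ltr0_norm// mulrN mulNr.
  lra.
rewrite /k -mulrDr.
apply: (@le_trans _ _ (3 * expR `|x| * y ^+ 2)).
  by rewrite -mulrDl; apply: ler_wpM2r; [exact: sqr_ge0|lra].
rewrite /y exprMn real_normK ?num_real//.
rewrite (_ : 3 * _ * _ = h ^+ 2 * (3 * expR `|x| * x ^+ 2)); last by ring.
rewrite (_ : 6 * _ * _ = h ^+ 2 * (6 * (expR (2 * x) + expR (- 2 * x)))); last by ring.
apply: ler_wpM2l; first exact: sqr_ge0.
apply: (@le_trans _ _ (6 * (expR `|x| * expR `|x|))).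
  rewrite (_ : 6 * _ = 3 * expR `|x| * (2 * expR `|x|)); last by ring.
  by apply: ler_wpM2l => //; rewrite mulr_ge0// expR_ge0.
by apply: ler_wpM2l.
Qed.

Lemma is_derive_gauss_cos b t : is_derive t 1 (gauss_cos b) (- t * gauss_cos b t).
Proof.
apply: (is_derive_of_increment _ (fun h => @gauss_cos_increment b t h)).
apply: is_derive_eq; rewrite /GRing.scale/= !(mulr0, mul0r, expr0n)/=.
by rewrite cos0 sin0 expR0; ring.
Qed.

(** The derivative just found is the differential equation [g' = - t * g], so the product with
    [expR (t ^+ 2 / 2)] is constant. *)
Lemma gauss_cosE b t : gauss_cos b t = expR (- (t ^+ 2 / 2)) * cos b.
Proof.
pose E s := expR (s ^+ 2 / 2) * gauss_cos b s.
have dE s : is_derive s 1 E 0.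
  have ds := is_derive_gauss_cos b s.
  by apply: is_derive_eq; rewrite /GRing.scale/=; field.
have E0 : E 0 = cos b.
  rewrite /E expr0n/= mul0r expR0 mul1r /gauss_cos.
  under eq_Rintegral do rewrite mul0r add0r.
  by rewrite Rintegral_cst//= probability_setT/= mulr1.
by rewrite -E0 (is_derive_0_is_cst 0 t dE) /E mulrA -expRD addNr expR0 mul1r.
Qed.

Lemma Rintegral_normal_prob_cos m s t b : 0 < s ->
  \int[normal_prob m s]_x cos (t * x + b) =
  expR (- (t ^+ 2 * s ^+ 2 / 2)) * cos (b + t * m).
Proof.
move=> s0; rewrite Rintegral_gauss_affine//; last 2 first.
- by apply: (@measurable_cosD _ _ _ id); exact: measurable_id.
- by move=> x; exact: cos_max.
have -> : expR (- (t ^+ 2 * s ^+ 2 / 2)) * cos (b + t * m) = gauss_cos (b + t * m) (t * s).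
  by rewrite gauss_cosE exprMn.
by apply: eq_Rintegral => x _; congr cos; ring.
Qed.

Lemma integral_normal_prob_cosh2 m s : 0 < s ->
  (\int[normal_prob m s]_x (cosh2 x)%:E = (cosh2 m * expR (s ^+ 2 / 2))%:E)%E.
Proof.
move=> s0; rewrite (@ge0_integral_normal_prob_gauss m s (fun x => (cosh2 x)%:E))//; last 2 first.
- by apply/measurable_EFinP; exact: measurable_cosh2.
- by move=> x; rewrite lee_fin cosh2_ge0.
have -> : (\int[gauss]_x (cosh2 (s * x + m))%:E =
    \int[gauss]_x ((expR m)%:E * (expR (s * x))%:E +
      (expR (- m))%:E * (expR (- s * x))%:E))%E.
  apply: eq_integral => x _; rewrite -!EFinM -EFinD -!expRD; congr EFin.
  by rewrite /cosh2; congr (expR _ + expR _); ring.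
have intZ c h : gauss.-integrable [set: R] (fun x => c%:E * (EFin \o (fun x => expR (h * x))) x)%E.
  by apply: integrableZl => //; exact: integrable_gauss_expR.
rewrite (integralD measurableT (intZ (expR m) s) (intZ (expR (- m)) (- s))).
rewrite !integralZl//; [|exact: integrable_gauss_expR..].
by rewrite !integral_gauss_expR -!EFinM -EFinD sqrrN /cosh2 mulrDl.
Qed.

End standard_normal.

(** * Likelihood ratios of independent rows *)

Section likelihood_coordinate.
Context d (T : measurableType d) (R : realType) (N Q : probability T R).
Variable y : T -> R.
Hypothesis my : measurable_fun [set: T] y.
Hypothesis y_ge : forall x, - 2^-1 <= y x.
Hypothesis QE : forall A, measurable A -> (Q A = \int[N]_(x in A) (1 + y x)%:E)%E.
Implicit Types (c t b : R).

Let onem_gt0 x : 0 < 1 + y x.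
Proof. by have := y_ge x => ?; lra. Qed.

Lemma measurable_1Dy : measurable_fun [set: T] (fun x => 1 + y x).
Proof. exact: measurable_funD. Qed.

Lemma integral_1Dy : (\int[N]_x (1 + y x)%:E = 1)%E.
Proof. by rewrite -QE// probability_setT. Qed.

Lemma integrable_1Dy : N.-integrable [set: T] (EFin \o (fun x => 1 + y x)).
Proof.
apply: ge0_integrable_lty; first exact: measurable_1Dy.
  by move=> x; rewrite ltW.
by rewrite integral_1Dy ltry.
Qed.

Lemma ge0_integral_Q (f : T -> \bar R) : measurable_fun [set: T] f ->
  (forall x, 0 <= f x)%E -> (\int[Q]_x f x = \int[N]_x (f x * (1 + y x)%:E))%E.
Proof.
move=> mf f0; apply: ge0_integral_density => //.
- exact: integrable_1Dy.
- by move=> x; rewrite ltW.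
Qed.

Let int1 : N.-integrable [set: T] (EFin \o cst (1 : R)).
Proof. exact: finite_measure_integrable_cst. Qed.

Lemma integrable_y : N.-integrable [set: T] (EFin \o y).
Proof.
have := integrableB measurableT integrable_1Dy int1.
by apply: eq_integrable => // x _ /=; rewrite -EFinD addrAC subrr add0r.
Qed.

Lemma Rintegral_y : \int[N]_x y x = 0.
Proof.
have : (\int[N]_x (1 + y x) = 1)%R by rewrite /Rintegral integral_1Dy.
rewrite RintegralD//; last exact: integrable_y.
by rewrite Rintegral_cst//= probability_setT mulr1 => /(canRL (addKr _)) ->; rewrite addNr.
Qed.

Lemma integrable_1Dy_bounded (u : T -> R) : measurable_fun [set: T] u ->
  (forall x, `|u x| <= 1) ->
  N.-integrable [set: T] (EFin \o (fun x => (1 + y x) * u x)).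
Proof.
move=> mu_ u1; apply: (le_integrable measurableT _ _ integrable_1Dy) => /=.
  by apply: measurableT_comp => //; apply: measurable_funM => //; exact: measurable_1Dy.
by move=> x _; rewrite lee_fin normrM ler_piMr.
Qed.

Lemma Rintegral_Q (u : T -> R) : measurable_fun [set: T] u ->
  (forall x, `|u x| <= 1) -> \int[Q]_x u x = \int[N]_x ((1 + y x) * u x).
Proof.
move=> mu_ u1.
have intQu : Q.-integrable [set: T] (EFin \o u).
  exact: (@probability_integrable_bounded _ _ _ _ _ 1).
have intQ1 : Q.-integrable [set: T] (EFin \o cst (1 : R)).
  exact: finite_measure_integrable_cst.
have intN := integrable_1Dy_bounded mu_ u1.
suff e : (\int[Q]_x (1 + u x)%:E = \int[N]_x ((1 + y x) + (1 + y x) * u x)%:E)%E.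
  have : \int[Q]_x (1 + u x) = \int[N]_x ((1 + y x) + (1 + y x) * u x).
    by rewrite /Rintegral e.
  have -> : \int[Q]_x (1 + u x) = \int[Q]_x (cst 1 x) + \int[Q]_x u x.
    exact: (RintegralD measurableT intQ1 intQu).
  have -> : \int[N]_x ((1 + y x) + (1 + y x) * u x) =
      \int[N]_x (1 + y x) + \int[N]_x ((1 + y x) * u x).
    exact: (RintegralD measurableT integrable_1Dy intN).
  have -> : (\int[N]_x (1 + y x) = 1)%R by rewrite /Rintegral integral_1Dy.
  by rewrite Rintegral_cst//= probability_setT mulr1 => /addrI.
rewrite ge0_integral_Q//.
- by apply: eq_integral => x _; rewrite -EFinM; congr EFin; ring.
- by apply: measurableT_comp => //; exact: measurable_funD.
- move=> x; rewrite lee_fin; have := u1 x; rewrite ler_norml => /andP[h _].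
  by rewrite -lerBlDl sub0r.
Qed.

Let sqrt_1Dy x := expR (ln (1 + y x) / 2).

Let sqr_sqrt_1Dy x : sqrt_1Dy x ^+ 2 = 1 + y x.
Proof. by rewrite expr2 -expRD -splitr lnK// posrE. Qed.

(** Squared Hellinger distance of [Q] and [N], without the factor 1/2. The square root of the
    density is written as the exponential of half its logarithm, so that products over coordinates
    become [expR] of half the row sum. *)
Definition hellinger_y := \int[N]_x ((expR (ln (1 + y x) / 2) - 1) ^+ 2).

(** Expanding the square shows that the affinity is [1 - hellinger_y / 2]. *)
Lemma affinity_le_hellinger :
  (\int[N]_x (expR (ln (1 + y x) / 2))%:E <= (expR (- (hellinger_y / 2)))%:E)%E.
Proof.
have ms : measurable_fun [set: T] sqrt_1Dy.
  apply: measurableT_comp => //; apply: measurable_funM => //.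
  by apply: measurableT_comp; [exact: measurable_ln|exact: measurable_1Dy].
have ints : N.-integrable [set: T] (EFin \o sqrt_1Dy).
  apply: (le_integrable measurableT _ _ (integrableD measurableT int1 integrable_1Dy)) => /=.
    exact/measurable_EFinP.
  move=> x _; have := onem_gt0 x => y1.
  rewrite lee_fin -(sqr_sqrt_1Dy x) !ger0_norm ?addr_ge0 ?sqr_ge0 ?expR_ge0//.
  have := sqr_ge0 (sqrt_1Dy x - 1); have : 0 <= sqrt_1Dy x := expR_ge0 _.
  by move=> ? ?; nra.
have int2s := integrable_scale (- 2) ints.
have int12 : N.-integrable [set: T] (EFin \o (fun x => 1 + y x + cst (1 : R) x)).
  exact: (integrableD measurableT integrable_1Dy int1).
have Rs : \int[N]_x sqrt_1Dy x = 1 - hellinger_y / 2.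
  rewrite /hellinger_y (_ : (fun x => (_ - 1) ^+ 2) =
      (fun x => (1 + y x + cst 1 x) + - 2 * sqrt_1Dy x)); last first.
    apply/funext => x /=; have := sqr_sqrt_1Dy x; rewrite /sqrt_1Dy.
    by set s := expR _ => <-; ring.
  rewrite RintegralD// RintegralZl// RintegralD//; last exact: integrable_1Dy.
  have -> : (\int[N]_x (1 + y x) = 1)%R by rewrite /Rintegral integral_1Dy.
  by rewrite Rintegral_cst//= probability_setT/=; field.
have -> : (\int[N]_x (expR (ln (1 + y x) / 2))%:E = (\int[N]_x sqrt_1Dy x)%:E)%E.
  by rewrite /Rintegral fineK//; exact: (integrable_fin_num measurableT ints).
by rewrite Rs lee_fin; exact: expR_ge1Dx.
Qed.

Section second_moment.
Hypothesis yy : (\int[N]_x (y x ^+ 2)%:E < +oo)%E.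

Lemma measurable_sqr_y : measurable_fun [set: T] (fun x => y x ^+ 2).
Proof. exact: measurable_funX. Qed.

Lemma integrable_sqr_y : N.-integrable [set: T] (EFin \o (fun x => y x ^+ 2)).
Proof.
by apply: ge0_integrable_lty => // [|x]; [exact: measurable_sqr_y|exact: sqr_ge0].
Qed.

(** The variance, since [y] has mean 0 under [N]; it is also the chi-square divergence of [Q] from
    [N]. *)
Definition var_y := \int[N]_x (y x ^+ 2).
Definition trunc_y := \int[N]_x trunc_sqr (y x).

Lemma integral_sqr_y : (\int[N]_x (y x ^+ 2)%:E = var_y%:E)%E.
Proof.
by rewrite /var_y /Rintegral fineK//; apply: (integrable_fin_num measurableT integrable_sqr_y).
Qed.

Lemma measurable_trunc_y : measurable_fun [set: T] (fun x => trunc_sqr (y x)).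
Proof.
apply: measurable_funM; first exact: measurable_sqr_y.
by apply: measurable_minr => //; exact: measurableT_comp.
Qed.

Lemma trunc_sqr_le (z : R) : trunc_sqr z <= z ^+ 2.
Proof. by rewrite /trunc_sqr ler_piMr ?sqr_ge0// ge_min lexx orbT. Qed.

Lemma integrable_trunc_y : N.-integrable [set: T] (EFin \o (fun x => trunc_sqr (y x))).
Proof.
apply: (le_integrable measurableT _ _ integrable_sqr_y) => /=.
  by apply: measurableT_comp => //; exact: measurable_trunc_y.
move=> x _; rewrite lee_fin !ger0_norm ?sqr_ge0 ?trunc_sqr_ge0//.
exact: trunc_sqr_le.
Qed.

Lemma var_y_ge0 : 0 <= var_y.
Proof. by apply: Rintegral_ge0 => x _; exact: sqr_ge0. Qed.

Lemma trunc_y_ge0 : 0 <= trunc_y.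
Proof. by apply: Rintegral_ge0 => x _; exact: trunc_sqr_ge0. Qed.

(** Where [|y| <= e] the square is at most [e ^+ 2]; elsewhere [min (|y|, 1) >= e], so it is at most
    [e^-1 * trunc_sqr y]. Small truncated moments thus make each variance of a row small. *)
Lemma var_y_le (e : R) : 0 < e <= 1 -> var_y <= e ^+ 2 + e^-1 * trunc_y.
Proof.
move=> /andP[e0 e1].
have intt := integrable_trunc_y.
have intet : N.-integrable [set: T] (EFin \o (fun x => e^-1 * trunc_sqr (y x))).
  exact: integrable_scale.
have inte : N.-integrable [set: T] (EFin \o cst (e ^+ 2)).
  exact: finite_measure_integrable_cst.
rewrite /trunc_y -RintegralZl//.
rewrite (_ : e ^+ 2 = \int[N]_x (cst (e ^+ 2) x)); last first.
  by rewrite Rintegral_cst//= probability_setT mulr1.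
rewrite -RintegralD//; apply: le_Rintegral => //.
- exact: integrable_sqr_y.
- exact: (integrableD measurableT inte intet).
move=> x _ /=; have [ye|ye] := leP `|y x| e.
  rewrite -[leLHS]addr0; apply: lerD; last by rewrite mulr_ge0 ?invr_ge0 ?trunc_sqr_ge0// ltW.
  by rewrite -[leLHS]real_normK ?num_real// lerXn2r ?nnegrE// ltW.
rewrite -[leLHS]add0r; apply: lerD; first exact: sqr_ge0.
rewrite -ler_pdivrMl ?invr_gt0// invrK mulrC /trunc_sqr.
by apply: ler_wpM2l; [exact: sqr_ge0|rewrite le_min e1 ltW].
Qed.

Lemma measurable_ln1Dy : measurable_fun [set: T] (fun x => ln (1 + y x)).
Proof. by apply: measurableT_comp; [exact: measurable_ln|exact: measurable_1Dy]. Qed.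

Lemma measurable_invr_1Dy : measurable_fun [set: T] (fun x => (1 + y x)^-1).
Proof.
rewrite (_ : (fun x => _) = (fun x => expR (- ln (1 + y x)))).
  by do 2 apply: measurableT_comp => //; exact: measurable_ln1Dy.
by apply/funext => x; rewrite expRN lnK// posrE.
Qed.

(** Adding the density, of mean 1, cancels the linear term and keeps the integrands nonnegative:
    [(1 + y)^-1 + (1 + y) <= 2 + 2 * y^2] for [y >= - 1/2]. *)
Lemma integral_invr_1Dy_le : (\int[N]_x ((1 + y x)^-1)%:E <= (1 + 2 * var_y)%:E)%E.
Proof.
have mi : measurable_fun [set: T] (fun x => (1 + y x)^-1).
  exact: measurable_invr_1Dy.
suff : (\int[N]_x ((1 + y x)^-1)%:E + \int[N]_x (1 + y x)%:E <= (2 + 2 * var_y)%:E)%E.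
  rewrite integral_1Dy -leeBrDr// -EFinB => /le_trans; apply.
  by rewrite lee_fin; lra.
rewrite -ge0_integralD//; last 4 first.
- by move=> x _; rewrite lee_fin invr_ge0 ltW.
- exact: measurableT_comp.
- by move=> x _; rewrite lee_fin ltW.
- by apply: measurableT_comp => //; exact: measurable_1Dy.
have -> : ((2 + 2 * var_y)%:E = \int[N]_x (2 + 2 * y x ^+ 2)%:E)%E.
  under eq_integral do rewrite EFinD EFinM.
  rewrite ge0_integralD//=; last 2 first.
  - by move=> x _; rewrite -EFinM lee_fin mulr_ge0// sqr_ge0.
  - by apply: emeasurable_funM => //; apply: measurableT_comp => //; exact: measurable_sqr_y.
  rewrite integral_cst//= probability_setT mule1 ge0_integralZl//.
  - by rewrite integral_sqr_y.
  - by apply: measurableT_comp => //; exact: measurable_sqr_y.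
  - by move=> x _; rewrite lee_fin sqr_ge0.
apply: ge0_le_integral => //.
- by move=> x _; rewrite -EFinD lee_fin addr_ge0 ?invr_ge0// ltW.
- apply: emeasurable_funD; apply: measurableT_comp => //; exact: measurable_1Dy.
- apply: measurableT_comp => //; apply: measurable_funD => //.
  by apply: measurable_funM => //; exact: measurable_sqr_y.
move=> x _; rewrite -EFinD lee_fin.
have y1 := onem_gt0 x.
rewrite -subr_ge0 (_ : _ - _ = (1 + y x)^-1 * (y x ^+ 2 * (2 * (1 + y x) - 1))); last first.
  by field; rewrite gt_eqF.
apply: mulr_ge0; first by rewrite invr_ge0 ltW.
by apply: mulr_ge0; [exact: sqr_ge0|have := y_ge x => ?; lra].
Qed.

Lemma integral_sqr_1Dy : (\int[N]_x ((1 + y x) ^+ 2)%:E = (1 + var_y)%:E)%E.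
Proof.
have inty := integrable_y; have intyy := integrable_sqr_y.
have int2y := integrable_scale 2 inty.
have int12y : N.-integrable [set: T] (EFin \o (fun x => 1 + 2 * y x)).
  exact: (integrableD measurableT int1 int2y).
have -> : (\int[N]_x ((1 + y x) ^+ 2)%:E =
    \int[N]_x ((EFin \o (fun x => 1 + 2 * y x)%R) x + (EFin \o (fun x => y x ^+ 2)%R) x))%E.
  by apply: eq_integral => x _; rewrite /= -EFinD; congr EFin; ring.
rewrite integralD// EFinD integral_sqr_y; congr (_ + _)%E.
have e1 : \int[N]_x (1 + 2 * y x) = 1.
  rewrite RintegralD// RintegralZl// Rintegral_y mulr0 addr0.
  by rewrite Rintegral_cst//= probability_setT mulr1.
by rewrite -[LHS]fineK ?(integrable_fin_num measurableT int12y)//; congr EFin; exact: e1.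
Qed.

Lemma integrable_loglik_cos c t b :
  N.-integrable [set: T] (EFin \o (fun x => loglik_cos c t b (y x))).
Proof.
have mc : measurable_fun [set: T] (fun x => cos (t * ln (1 + y x) + b)).
  by apply: measurable_cosD; exact: measurable_ln1Dy.
have intc : N.-integrable [set: T] (EFin \o (fun x => cos (t * ln (1 + y x) + b))).
  by apply: (@probability_integrable_bounded _ _ _ _ _ 1) => // x; exact: cos_max.
have intyc : N.-integrable [set: T] (EFin \o (fun x => (c * y x) * cos (t * ln (1 + y x) + b))).
  have intcy := integrable_scale c integrable_y.
  apply: (le_integrable measurableT _ _ intcy) => /=.
    by apply: measurableT_comp => //; apply: measurable_funM => //; exact: measurable_funM.
  by move=> x _; rewrite lee_fin normrM ler_piMr// cos_max.
apply: eq_integrable (integrableD measurableT intc intyc) => // x _ /=.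
by rewrite -EFinD /loglik_cos mulrDl mul1r.
Qed.

Lemma loglik_cos_integral_approx c t b C : loglik_expansion c t C ->
  `|\int[N]_x loglik_cos c t b (y x)
    - expR (- (t ^+ 2 * var_y / 2)) * cos (b + loglik_drift c t * var_y)|
  <= C * (trunc_y + var_y ^+ 2).
Proof.
move=> [/(_ b) + /(_ b)].
set k1 := c * cos b - t * sin b; set k2 := _ * sin b - t ^+ 2 * cos b => H1 H2.
have intb : N.-integrable [set: T] (EFin \o cst (cos b)).
  exact: finite_measure_integrable_cst.
pose g x := cst (cos b) x + (k1 * y x + k2 / 2 * y x ^+ 2).
have int1y := integrable_scale k1 integrable_y.
have int2y := integrable_scale (k2 / 2) integrable_sqr_y.
have int12 := integrable_add int1y int2y.
have intg : N.-integrable [set: T] (EFin \o g) := integrable_add intb int12.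
have Eg : \int[N]_x g x = cos b + var_y / 2 * k2.
  rewrite RintegralD// RintegralD// RintegralZl// ?RintegralZl//; last 2 first.
  - exact: integrable_sqr_y.
  - exact: integrable_y.
  by rewrite Rintegral_y Rintegral_cst//= probability_setT/= -/var_y; field.
have intt := integrable_scale C integrable_trunc_y.
have h1 : `|\int[N]_x loglik_cos c t b (y x) - \int[N]_x g x| <= C * trunc_y.
  rewrite -RintegralZl//; last exact: integrable_trunc_y.
  apply: normr_RintegralB_le_integral => //; first exact: integrable_loglik_cos.
  move=> x; apply: le_trans (H1 (y x) (y_ge x)); rewrite le_eqVlt; apply/orP; left.
  by apply/eqP; congr `| _ |; rewrite /g /=; field.
have h2 := H2 var_y var_y_ge0.
rewrite mulrDr.
rewrite (_ : _ - _ = (\int[N]_x loglik_cos c t b (y x) - \int[N]_x g x) -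
  (expR (- (t ^+ 2 * var_y / 2)) * cos (b + loglik_drift c t * var_y) - cos b
   - var_y / 2 * k2)); last by rewrite Eg; ring.
by apply: (le_trans (ler_normB _ _)); exact: lerD.
Qed.

End second_moment.
End likelihood_coordinate.

Lemma prode_le_expR_sum (R : realType) n (u : 'I_n -> \bar R) (w : 'I_n -> R) :
  (forall i, 0 <= u i)%E -> (forall i, u i <= (expR (w i))%:E)%E ->
  (\prod_(i < n) u i <= (expR (\sum_(i < n) w i))%:E)%E.
Proof.
move=> u0 uw; suff : (0 <= \prod_(i < n) u i <= (expR (\sum_(i < n) w i))%:E)%E.
  by case/andP.
elim/big_rec2: _ => [|i s p _ /andP[p0 ps]]; first by rewrite expR0 lexx lee01.
by rewrite mule_ge0//= expRD EFinM lee_pmul.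
Qed.

Section likelihood_row.
Context d (T : measurableType d) (R : realType) (N : probability T R) (n : nat).
Variables (y : 'I_n -> T -> R) (Q : 'I_n -> probability T R).
Hypothesis my : forall i, measurable_fun [set: T] (y i).
Hypothesis y_ge : forall i x, - 2^-1 <= y i x.
Hypothesis QE : forall i A, measurable A -> (Q i A = \int[N]_(x in A) (1 + y i x)%:E)%E.
Implicit Types (t b : R) (q : bool).

Local Notation NN := (prod_prob (fun _ : 'I_n => N)).
Local Notation QQ := (prod_prob Q).

(** A boolean treats the null and the alternative together; [q%:R] is the coefficient [c] of the
    expansions. *)
Definition row_law q (i : 'I_n) := if q then Q i else N.

Definition row_loglr (x : n.-tuple T) : R := \sum_(i < n) ln (1 + y i (tnth x i)).

Let onem_gt0 i x : 0 < 1 + y i x.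
Proof. by have := y_ge i x => ?; lra. Qed.

Lemma measurable_row_loglr : measurable_fun [set: n.-tuple T] row_loglr.
Proof. exact: (measurable_sum_tnth (fun i => measurable_ln1Dy (my i))). Qed.

Definition row_loglr_mfun : {mfun n.-tuple T >-> measurableTypeR R} :=
  HB.pack row_loglr
    (@isMeasurableFun.Build _ _ _ (measurableTypeR R) row_loglr measurable_row_loglr).

Lemma expR_row_loglr x : expR (row_loglr x) = \prod_(i < n) (1 + y i (tnth x i)).
Proof.
rewrite /row_loglr expR_sum; apply: eq_bigr => i _.
by rewrite lnK// posrE.
Qed.

Lemma measurable_expR_row_loglr :
  measurable_fun [set: n.-tuple T] (fun x => expR (row_loglr x)).
Proof. by apply: measurableT_comp => //; exact: measurable_row_loglr. Qed.

Lemma measurable_expRN_row_loglr :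
  measurable_fun [set: n.-tuple T] (fun x => (expR (- row_loglr x))%:E).
Proof.
apply/measurable_EFinP; apply: (measurableT_comp (f := expR)) => //.
by apply: measurable_funN; exact: measurable_row_loglr.
Qed.

Lemma ge0_integral_row_density (F : n.-tuple T -> \bar R) :
  measurable_fun [set: n.-tuple T] F -> (forall x, 0 <= F x)%E ->
  (\int[QQ]_x F x = \int[NN]_x (F x * (expR (row_loglr x))%:E))%E.
Proof.
move=> mF F0.
rewrite (@integral_prod_prob_density _ _ _ n (fun=> N) Q (fun i x => 1 + y i x))//.
- by apply: eq_integral => x _; rewrite expR_row_loglr.
- by move=> i; exact: (measurable_1Dy (my i)).
- by move=> i x; rewrite ltW.
- by move=> i f mf f0; exact: (ge0_integral_Q (my i) (y_ge i) (QE i)).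
Qed.

Lemma integral_expR_row_loglr : (\int[NN]_x (expR (row_loglr x))%:E = 1)%E.
Proof.
under eq_integral do rewrite expR_row_loglr.
rewrite (@integral_prod_prob_prodr _ _ _ n (fun=> N) (fun i x => 1 + y i x)).
- by rewrite big1// => i _; exact: (integral_1Dy (QE i)).
- by move=> i; exact: (measurable_1Dy (my i)).
- by move=> i x; rewrite ltW.
Qed.

Lemma expRN_row_loglr x : expR (- row_loglr x) = \prod_(i < n) (1 + y i (tnth x i))^-1.
Proof. by rewrite expRN expR_row_loglr prodfV. Qed.

Lemma prode_le_expR (u : 'I_n -> \bar R) (w : 'I_n -> R) :
  (forall i, 0 <= u i)%E -> (forall i, u i <= (1 + w i)%:E)%E ->
  (\prod_(i < n) u i <= (expR (\sum_(i < n) w i))%:E)%E.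
Proof.
move=> u0 uw; apply: prode_le_expR_sum => // i.
by apply: le_trans (uw i) _; rewrite lee_fin expR_ge1Dx.
Qed.

Lemma integral_expRN_row_loglr_le (w : 'I_n -> R) :
  (forall i, \int[N]_x ((1 + y i x)^-1)%:E <= (1 + w i)%:E)%E ->
  (\int[NN]_x (expR (- row_loglr x))%:E <= (expR (\sum_(i < n) w i))%:E)%E.
Proof.
move=> yw; under eq_integral do rewrite expRN_row_loglr.
rewrite (@integral_prod_prob_prodr _ _ _ n (fun=> N) (fun i x => (1 + y i x)^-1)).
- apply: prode_le_expR => // i; apply: integral_ge0 => x _.
  by rewrite lee_fin invr_ge0 ltW.
- by move=> i; exact: (measurable_invr_1Dy (my i) (y_ge i)).
- by move=> i x; rewrite invr_ge0 ltW.
Qed.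

Lemma integral_expRN_row_loglr_Q :
  (\int[QQ]_x (expR (- row_loglr x))%:E = 1)%E.
Proof.
rewrite ge0_integral_row_density.
- under eq_integral do rewrite -EFinM -expRD addNr expR0.
  by rewrite integral_cst// mul1e; exact: (@probability_setT _ _ _ NN).
- exact: measurable_expRN_row_loglr.
- by move=> x; rewrite lee_fin expR_ge0.
Qed.

Lemma integral_cosh2_row_loglr_le (w : 'I_n -> R) :
  (forall i, \int[N]_x ((1 + y i x)^-1)%:E <= (1 + w i)%:E)%E ->
  (\int[NN]_x (cosh2 (row_loglr x))%:E <= (1 + expR (\sum_(i < n) w i))%:E)%E.
Proof.
move=> yw.
have -> : (\int[NN]_x (cosh2 (row_loglr x))%:E =
    \int[NN]_x (expR (row_loglr x))%:E + \int[NN]_x (expR (- row_loglr x))%:E)%E.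
  rewrite -ge0_integralD//.
  - by apply/measurable_EFinP; exact: measurable_expR_row_loglr.
  - exact: measurable_expRN_row_loglr.
by rewrite EFinD integral_expR_row_loglr leeD2l// integral_expRN_row_loglr_le.
Qed.

Section square_integrable_row.
Hypothesis yy : forall i, (\int[N]_x (y i x ^+ 2)%:E < +oo)%E.

Local Notation v i := (var_y N (y i)).

Lemma integral_expR2_row_loglr_le :
  (\int[NN]_x (expR (row_loglr x) ^+ 2)%:E <= (expR (\sum_(i < n) v i))%:E)%E.
Proof.
under eq_integral do rewrite expR_row_loglr -prodrXl.
rewrite (@integral_prod_prob_prodr _ _ _ n (fun=> N) (fun i x => (1 + y i x) ^+ 2)).
- apply: prode_le_expR => i.
  + by apply: integral_ge0 => x _; rewrite lee_fin sqr_ge0.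
  + by rewrite (integral_sqr_1Dy (my i) (y_ge i) (QE i) (yy i)).
- by move=> i; apply: measurable_funX; exact: (measurable_1Dy (my i)).
- by move=> i x; rewrite sqr_ge0.
Qed.

(** Under the alternative the inverse of the likelihood ratio has mean 1, and the likelihood ratio
    has for mean its second moment under the null, a product of factors [1 + v i]. *)
Lemma integral_cosh2_row_loglr_Q_le :
  (\int[QQ]_x (cosh2 (row_loglr x))%:E <= (1 + expR (\sum_(i < n) v i))%:E)%E.
Proof.
have -> : (\int[QQ]_x (cosh2 (row_loglr x))%:E =
    \int[QQ]_x (expR (row_loglr x))%:E + \int[QQ]_x (expR (- row_loglr x))%:E)%E.
  rewrite -ge0_integralD//.
  - by apply/measurable_EFinP; exact: measurable_expR_row_loglr.
  - exact: measurable_expRN_row_loglr.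
rewrite EFinD integral_expRN_row_loglr_Q addeC leeD2l//.
rewrite ge0_integral_row_density//; last first.
  by apply/measurable_EFinP; exact: measurable_expR_row_loglr.
by under eq_integral do rewrite -EFinM -expr2; exact: integral_expR2_row_loglr_le.
Qed.

Lemma row_law_cos_approx q t b C : loglik_expansion q%:R t C ->
  `|\int[prod_prob (row_law q)]_x cos (t * row_loglr x + b)
    - expR (- (t ^+ 2 * (\sum_(i < n) v i) / 2))
      * cos (b + loglik_drift q%:R t * \sum_(i < n) v i)|
  <= \sum_(i < n) C * (trunc_y N (y i) + v i ^+ 2).
Proof.
move=> H.
apply: (@prod_prob_cos_approx _ _ _ n (row_law q) (fun i x => ln (1 + y i x))
  (fun i => v i)) => [i|i|i b'].
- exact: (measurable_ln1Dy (my i)).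
- exact: var_y_ge0.
have mc : measurable_fun [set: T] (fun x => cos (t * ln (1 + y i x) + b')).
  by apply: measurable_cosD; exact: (measurable_ln1Dy (my i)).
rewrite [X in `|X - _|](_ : _ = \int[N]_x loglik_cos q%:R t b' (y i x)).
  exact: (loglik_cos_integral_approx (my i) (y_ge i) (QE i) (yy i)).
rewrite /row_law /loglik_cos; case: (q).
  rewrite (Rintegral_Q (my i) (y_ge i) (QE i) mc) => [|x]; last exact: cos_max.
  by apply: eq_Rintegral => x _; rewrite mul1r.
by apply: eq_Rintegral => x _; rewrite mul0r addr0 mul1r.
Qed.

End square_integrable_row.

Lemma ge0_integral_testing_error (psi : n.-tuple T -> R) :
  measurable_fun [set: n.-tuple T] psi -> (forall x, 0 <= psi x <= 1) ->
  (\int[NN]_x (psi x)%:E + \int[QQ]_x (1 - psi x)%:E =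
   \int[NN]_x (psi x + (1 - psi x) * expR (row_loglr x))%:E)%E.
Proof.
move=> mpsi psi01.
have m1 : measurable_fun [set: n.-tuple T] (fun x => 1 - psi x) by exact: measurable_funB.
have p0 x : 0 <= psi x by case/andP: (psi01 x).
have p1 x : 0 <= 1 - psi x by case/andP: (psi01 x) => _; rewrite subr_ge0.
have mE : measurable_fun [set: n.-tuple T] (fun x => (1 - psi x)%:E).
  exact/measurable_EFinP.
rewrite (ge0_integral_row_density mE) => [|x]; last by rewrite lee_fin.
rewrite -ge0_integralD//=.
- by move=> x _; rewrite lee_fin.
- exact/measurable_EFinP.
- by move=> x _; rewrite mule_ge0 ?lee_fin ?expR_ge0.
- apply: emeasurable_funM; apply/measurable_EFinP => //.
  exact: measurable_expR_row_loglr.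
Qed.

Lemma integrable_expR_row_loglr : NN.-integrable [set: n.-tuple T]
  (EFin \o (fun x => expR (row_loglr x))).
Proof.
apply: ge0_integrable_lty; first exact: measurable_expR_row_loglr.
  by move=> x; exact: expR_ge0.
by rewrite integral_expR_row_loglr ltry.
Qed.

(** With [L] the likelihood ratio, the sum of the errors minus 1 is the integral of
    [(1 - psi) * (L - 1)]. Its absolute value is at most the integral of [e + e^-1 * (L - 1)^2], and
    the chi-square distance [\int L^2 - 1] is at most [expR V - 1]. *)
Lemma Rintegral_testing_errorB1_le (psi : n.-tuple T -> R) (e : R) :
  (forall i, (\int[N]_x (y i x ^+ 2)%:E < +oo)%E) ->
  measurable_fun [set: n.-tuple T] psi -> (forall x, 0 <= psi x <= 1) -> 0 < e ->
  exists2 r, (\int[NN]_x (psi x)%:E + \int[QQ]_x (1 - psi x)%:E = r%:E)%E &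
    `|r - 1| <= e + e^-1 * (expR (\sum_(i < n) var_y N (y i)) - 1).
Proof.
move=> yy mpsi psi01 e0.
have mL := measurable_expR_row_loglr.
have intL := integrable_expR_row_loglr.
set L := fun x => expR (row_loglr x) in mL intL.
set V := \sum_(i < n) _.
have intc c : NN.-integrable [set: n.-tuple T] (EFin \o cst (c : R)).
  exact: finite_measure_integrable_cst.
have intL2 : NN.-integrable [set: n.-tuple T] (EFin \o (fun x => L x ^+ 2)).
  apply: ge0_integrable_lty; [exact: measurable_funX|by move=> x; exact: sqr_ge0|].
  exact: le_lt_trans (integral_expR2_row_loglr_le yy) (ltry _).
have RL : \int[NN]_x L x = 1 by rewrite /Rintegral integral_expR_row_loglr.
have RL2 : \int[NN]_x (L x ^+ 2) <= expR V.
  rewrite -lee_fin /Rintegral fineK; first exact: integral_expR2_row_loglr_le.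
  exact: (integrable_fin_num measurableT intL2).
have NT : fine (NN [set: n.-tuple T]) = 1 by rewrite (@probability_setT _ _ _ NN).
pose f x := psi x + (1 - psi x) * L x.
have intf : NN.-integrable [set: n.-tuple T] (EFin \o f).
  apply: (le_integrable measurableT _ _ (integrable_add (intc 1) intL)) => /=.
    apply/measurable_EFinP; apply: measurable_funD => //; apply: measurable_funM => //.
    exact: measurable_funB.
  move=> x _; have /andP[p0 p1] := psi01 x; have L0 : 0 <= L x := expR_ge0 _.
  rewrite lee_fin /f !ger0_norm ?addr_ge0 ?mulr_ge0 ?subr_ge0//.
  by apply: lerD => //; apply: ler_piMl => //; rewrite lerBlDr lerDl.
exists (\int[NN]_x f x).
  rewrite ge0_integral_testing_error// /Rintegral fineK//.
  exact: (integrable_fin_num measurableT intf).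
(* This is [e + e^-1 * (L - 1)^2], expanded so as to use the first two moments of [L]. *)
pose h x := cst (e + e^-1) x + ((- 2 * e^-1) * L x + e^-1 * L x ^+ 2).
have inth : NN.-integrable [set: n.-tuple T] (EFin \o h).
  exact: (integrable_add (intc _) (integrable_add (integrable_scale _ intL)
    (integrable_scale _ intL2))).
rewrite [X in `|_ - X|](_ : 1 = \int[NN]_x (cst 1 x)); last first.
  by rewrite Rintegral_cst// NT mulr1.
apply: (@le_trans _ _ (\int[NN]_x h x)).
  apply: normr_RintegralB_le_integral => // x.
  have -> : f x - cst 1 x = (1 - psi x) * (L x - 1) by rewrite /f /=; ring.
  have -> : h x = e + e^-1 * (L x - 1) ^+ 2 by rewrite /h /=; ring.
  have /andP[p0 p1] := psi01 x.
  apply: normrM_le1; first by rewrite ger0_norm ?subr_ge0// lerBlDr lerDl.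
  have z0 : 0 <= `|L x - 1| := normr_ge0 _.
  have [ze|ze] := leP `|L x - 1| e.
    by apply: (le_trans ze); rewrite lerDl mulr_ge0 ?sqr_ge0// invr_ge0 ltW.
  rewrite -[leLHS]add0r; apply: lerD; first exact: ltW.
  rewrite -[X in _ <= _ * X]real_normK ?num_real// ler_pdivlMl//.
  by rewrite expr2; apply: ler_wpM2r => //; exact: ltW.
have int1L := integrable_scale (- 2 * e^-1) intL.
have int2L := integrable_scale e^-1 intL2.
have int12L := integrable_add int1L int2L.
rewrite /h (RintegralD measurableT (intc (e + e^-1)) int12L).
rewrite (RintegralD measurableT int1L int2L).
rewrite (RintegralZl _ measurableT intL) (RintegralZl _ measurableT intL2).
rewrite Rintegral_cst// NT RL !mulr1.
have -> : e + e^-1 * (expR V - 1) = e + e^-1 + (- 2 * e^-1 + e^-1 * expR V) by ring.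
by rewrite lerD2l lerD2l; apply: ler_wpM2l => //; rewrite invr_ge0 ltW.
Qed.

(* With [c = 0] the likelihood ratio test minimizes the sum of the two errors,
   and [min 1 u <= sqrt u] bounds it by the Hellinger affinity. *)
Lemma testing_error_le_affinity :
  (\int[NN]_x (\1_[set x | 0 < row_loglr x] x)%:E +
   \int[QQ]_x (1 - \1_[set x | 0 < row_loglr x] x)%:E <=
   \prod_(i < n) \int[N]_x (expR (ln (1 + y i x) / 2))%:E)%E.
Proof.
have mset : measurable [set x | 0 < row_loglr x].
  rewrite -[X in measurable X]setTI (_ : [set x | _] = row_loglr @^-1` `]0, +oo[%classic).
    exact: measurable_row_loglr.
  by apply/seteqP; split => x /=; rewrite in_itv/= andbT.
rewrite ge0_integral_testing_error; last 2 first.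
- exact: measurable_indic.
- by move=> x; rewrite indicE; case: (_ \in _); rewrite ?lexx ?ler01.
have mi i : measurable_fun [set: T] (fun x => expR (ln (1 + y i x) / 2)).
  apply: measurableT_comp => //; apply: measurable_funM => //.
  exact: (measurable_ln1Dy (my i)).
rewrite -(@integral_prod_prob_prodr _ _ _ n (fun=> N) (fun i x => expR (ln (1 + y i x) / 2)))//.
apply: ge0_le_integral => //.
- apply/measurable_EFinP; apply: measurable_funD; first exact: measurable_indic.
  apply: measurable_funM; last exact: measurable_expR_row_loglr.
  by apply: measurable_funB => //; exact: measurable_indic.
- by apply/measurable_EFinP; exact: (measurable_prodr_tnth mi).
move=> x _; rewrite lee_fin -expR_sum -mulr_suml -/(row_loglr x) indicE.
have [x0|x0] := ltP 0 (row_loglr x).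
  rewrite mem_set// subrr mul0r addr0 -[leLHS]expR0 ler_expR.
  by rewrite divr_ge0// ltW.
rewrite memNset/=; last by rewrite ltNge x0.
by rewrite subr0 mul1r add0r ler_expR; lra.
Qed.

End likelihood_row.

Lemma measurable_continuous_ereal (R : realType) (f : \bar R -> R) : continuous f ->
  measurable_fun [set: \bar R] f.
Proof.
move=> cf.
rewrite (_ : f = fun x : \bar R => if x == +oo%E then f +oo%E else
    if x == -oo%E then f -oo%E else f (fine x)%:E); last first.
  by apply/funext => -[].
apply: measurable_fun_ifT => //=; first exact: measurable_fun_eqe.
apply: measurable_fun_ifT => //=; first exact: measurable_fun_eqe.
apply: (measurableT_comp (measurable_ereal_EFin cf)); exact: fine_measurable.
Qed.

(** * The Radon-Nikodym log-likelihood ratio and its explicit version *)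

Section loglr_almost_everywhere.
Context d (T : measurableType d) (R : realType) (N : probability T R) (n : nat).
Variables (y : 'I_n -> T -> R) (Q : 'I_n -> probability T R).
Hypothesis my : forall i, measurable_fun [set: T] (y i).
Hypothesis y_ge : forall i x, - 2^-1 <= y i x.
Hypothesis QE : forall i A, measurable A -> (Q i A = \int[N]_(x in A) (1 + y i x)%:E)%E.

Local Notation PP q := (prod_prob (row_law N Q q)).

Let good i : set T := [set u | dens (Q i) N u = (1 + y i u)%:E].

Let mgood i : measurable (good i).
Proof.
rewrite (_ : good i = (fun u => dens (Q i) N u == (1 + y i u)%:E) @^-1` [set true]).
  rewrite -[X in measurable X]setTI.
  apply: (measurable_fun_eqe (measurable_dens (Q i) N)) => //.
  by apply/measurable_EFinP; exact: (measurable_1Dy (my i)).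
by apply/seteqP; split => u /= => [->|/eqP]; rewrite ?eqxx.
Qed.

(** [dens] is a Radon-Nikodym derivative, determined only up to [N]-null sets; since [Q i] has a
    density with respect to [N], such sets are null under the alternative as well. *)
Let row_law_good q i : row_law N Q q i (good i) = 1%E.
Proof.
have ae : ae_eq N [set: T] (dens (Q i) N) (EFin \o (fun x => 1 + y i x)).
  apply: ae_eq_Radon_Nikodym_density; last exact: QE.
  exact: (integrable_1Dy (my i) (y_ge i) (QE i)).
have N0 : N (~` good i) = 0%E.
  apply/measure_negligible; first exact: measurableC.
  move: ae; rewrite /ae_eq; apply: negligibleS => u /= Hu H.
  by apply: Hu; exact: H.
have : row_law N Q q i (~` good i) = 0%E.
  rewrite /row_law; case: q => //; rewrite QE; last exact: measurableC.
  apply: null_set_integral => //; first exact: measurableC.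
  apply/measurable_funTS/measurable_EFinP; exact: (measurable_1Dy (my i)).
move=> c0; rewrite -(setCK (good i)) probability_setC ?c0 ?sube0//.
exact: measurableC.
Qed.

Lemma ae_loglr q : ae_eq (PP q) [set: n.-tuple T] (loglr Q (fun=> N))
  (EFin \o row_loglr y).
Proof.
pose B := [set x : n.-tuple T | forall i, good i (tnth x i)].
have mB : measurable B by exact: measurable_box.
exists (~` B); split; first exact: measurableC.
  have B1 : PP q B = 1%E by apply: prod_prob_box1 => // i; exact: row_law_good.
  by have := probability_setC (PP q) mB; rewrite B1 subee.
move=> x /= Hx Bx; apply: Hx => _.
rewrite /loglr /row_loglr /= -sumEFin; apply: eq_bigr => i _.
rewrite (Bx i) lne_EFin//; have := y_ge i (tnth x i) => ?; lra.
Qed.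

Lemma ge0_integral_loglr q (F : \bar R -> \bar R) :
  measurable_fun [set: \bar R] F -> (forall x, 0 <= F x)%E ->
  (\int[PP q]_x F (loglr Q (fun=> N) x) = \int[PP q]_x F (row_loglr y x)%:E)%E.
Proof.
move=> mF F0; apply: ge0_ae_eq_integral => //.
- by apply: measurableT_comp => //; exact: measurable_loglr.
- apply: measurableT_comp => //; apply/measurable_EFinP; exact: measurable_row_loglr.
by have := ae_loglr q; apply: filterS => x H _; rewrite H.
Qed.

Lemma integral_loglr_continuous q (f : \bar R -> R) : continuous f ->
  (\int[PP q]_x (f (loglr Q (fun=> N) x))%:E = \int[PP q]_x (f (row_loglr y x)%:E)%:E)%E.
Proof.
move=> cf; apply: ae_eq_integral => //.
- apply/measurable_EFinP; apply: (measurableT_comp (measurable_continuous_ereal cf)).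
  exact: measurable_loglr.
- apply/measurable_EFinP; apply: (measurableT_comp (measurable_continuous_ereal cf)).
  apply/measurable_EFinP; exact: measurable_row_loglr.
by have := ae_loglr q; apply: filterS => x H _; rewrite H.
Qed.

End loglr_almost_everywhere.

(** * Central limit theorem for rows under Lindeberg's condition *)

Section sequences_of_rows.
Context d (T : measurableType d) (R : realType) (N : probability T R) (k : nat -> nat).
Variables (y : forall n, 'I_(k n) -> T -> R) (Q : forall n, 'I_(k n) -> probability T R).
Hypothesis my : forall n i, measurable_fun [set: T] (@y n i).
Hypothesis y_ge : forall n i x, - 2^-1 <= @y n i x.
Hypothesis QE : forall n i A, measurable A ->
  (@Q n i A = \int[N]_(x in A) (1 + @y n i x)%:E)%E.
Hypothesis yy : forall n i, (\int[N]_x (@y n i x ^+ 2)%:E < +oo)%E.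

Local Notation V n := (\sum_(i < k n) var_y N (@y n i)).
Local Notation tau n := (\sum_(i < k n) trunc_y N (@y n i)).

Variable v : R.
Hypothesis v0 : 0 < v.
Hypothesis V_cvg : V n @[n --> \oo] --> v.
Hypothesis tau_cvg : tau n @[n --> \oo] --> 0.

(** The sum of the squared variances is at most the largest variance times [V], and [var_y_le]
    bounds every variance of the row by [a^2 + a^-1 * tau]. *)
Lemma sum_sqr_var_cvg0 :
  \sum_(i < k n) (trunc_y N (@y n i) + var_y N (@y n i) ^+ 2) @[n --> \oo] --> 0.
Proof.
have tau0 n : 0 <= tau n by apply: sumr_ge0 => i _; exact: trunc_y_ge0.
have V0 n : 0 <= V n by apply: sumr_ge0 => i _; exact: var_y_ge0.
apply/cvgrPdist_le => e e0.
(* Chosen for [a^2 * (v + 1) <= e / 4]; [D] is then the total coefficient of [tau n]. *)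
pose a := Num.min 1 (e / (4 * (v + 1))).
have v1 : 0 < v + 1 by rewrite addr_gt0.
have a0 : 0 < a by rewrite lt_min ltr01 divr_gt0// mulr_gt0.
have a1 : a <= 1 by rewrite ge_min lexx.
pose D := 1 + a^-1 * (v + 1).
have D0 : 0 < D by rewrite addr_gt0// mulr_gt0// invr_gt0.
have e2D : 0 < e / (2 * D) by rewrite divr_gt0// mulr_gt0.
have /cvgrPdist_le/(_ 1 ltr01) Vev := V_cvg.
have /cvgrPdist_le/(_ _ e2D) tauev := tau_cvg.
near=> n.
have Vn : V n <= v + 1.
  have : `|v - V n| <= 1 by near: n.
  by rewrite ler_norml => /andP[? ?]; lra.
have taun : tau n <= e / (2 * D).
  have : `|0 - tau n| <= e / (2 * D) by near: n.
  by rewrite sub0r normrN ger0_norm.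
have s0 : 0 <= \sum_(i < k n) (trunc_y N (@y n i) + var_y N (@y n i) ^+ 2).
  by apply: sumr_ge0 => i _; rewrite addr_ge0 ?sqr_ge0// trunc_y_ge0.
rewrite sub0r normrN ger0_norm//.
have step : \sum_(i < k n) (trunc_y N (@y n i) + var_y N (@y n i) ^+ 2) <=
    tau n + (a ^+ 2 + a^-1 * tau n) * V n.
  rewrite big_split/= lerD2l mulr_sumr; apply: ler_sum => i _.
  rewrite expr2; apply: ler_wpM2r; first exact: var_y_ge0.
  have a01 : 0 < a <= 1 by rewrite a0 a1.
  apply: (le_trans (var_y_le (my i) (yy i) a01)); rewrite lerD2l.
  apply: ler_wpM2l; first by rewrite invr_ge0 ltW.
  rewrite (bigD1 i)//= lerDl; apply: sumr_ge0 => j _; exact: trunc_y_ge0.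
apply: (le_trans step).
apply: (@le_trans _ _ (tau n + (a ^+ 2 + a^-1 * tau n) * (v + 1))).
  rewrite lerD2l; apply: ler_wpM2l => //; apply: addr_ge0; first exact: sqr_ge0.
  by rewrite mulr_ge0// invr_ge0 ltW.
rewrite (_ : _ + _ = tau n * D + a ^+ 2 * (v + 1)); last by rewrite /D; ring.
rewrite (splitr e); apply: lerD.
  apply: (@le_trans _ _ (e / (2 * D) * D)); first by apply: ler_wpM2r => //; exact: ltW.
  by rewrite le_eqVlt; apply/orP; left; apply/eqP; field; rewrite gt_eqF.
apply: (@le_trans _ _ (a * (v + 1))).
  by apply: ler_wpM2r; [exact: ltW|rewrite expr2 ler_piMl// ltW].
apply: (@le_trans _ _ (e / (4 * (v + 1)) * (v + 1))).
  by apply: ler_wpM2r; [exact: ltW|rewrite ge_min lexx orbT].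
rewrite (_ : _ * _ = e / 4); last by field; rewrite gt_eqF.
lra.
Unshelve. all: by end_near. Qed.

Variable q : bool.

Local Notation PP n := (prod_prob (row_law N (@Q n) q)).

Let nu n : probability (measurableTypeR R) R :=
  distribution (PP n) (row_loglr_mfun (@my n)).

Let integral_nu n (f : R -> \bar R) : measurable_fun [set: R] f -> (forall x, 0 <= f x)%E ->
  (\int[nu n]_x f x = \int[PP n]_x f (row_loglr (@y n) x))%E.
Proof. by move=> mf f0; rewrite /nu ge0_integral_distribution. Qed.

Let Rintegral_nu n (f : R -> R) : measurable_fun [set: R] f ->
  (forall x, `|f x| <= 1) ->
  \int[nu n]_x f x = \int[PP n]_x f (row_loglr (@y n) x).
Proof.
move=> mf f1; rewrite /Rintegral /nu integral_distribution//.
  exact/measurable_EFinP.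
apply: (@probability_integrable_bounded _ _ _ _ (fun x => f (row_loglr (@y n) x)) 1) => //.
by apply: measurableT_comp => //; exact: measurable_row_loglr.
Qed.

Let m : R := (2 * q%:R - 1) * v / 2.

(** [loglr] is first replaced by the finite sum [row_loglr], whose laws live on the real line, where
    exponential moments give tightness and characteristic functions identify the limit. *)
Lemma weak_cvg_loglr :
  weak_cvg (fun n => distribution (PP n) (loglr (@Q n) (fun=> N))) (normal_law m v).
Proof.
move=> f cf [A0 [A0r fA0]].
have bf : bounded_fun f by exists A0.
have fA (x : \bar R) : `|f x| <= A0 + 1 by apply: fA0 => //; rewrite ltrDl.
have mf := measurable_continuous_ereal cf.
have s0 : 0 < Num.sqrt v by rewrite sqrtr_gt0.
pose Z : probability (measurableTypeR R) R := normal_prob m (Num.sqrt v).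
have -> : (\int[normal_law m v]_x (f x)%:E = \int[Z]_x (f x%:E)%:E)%E.
  rewrite /normal_law integral_distribution//; first exact/measurable_EFinP.
  apply: (@probability_integrable_bounded _ (measurableTypeR R) R _ (fun x => f x%:E) (A0 + 1)) => //.
  exact: measurable_ereal_EFin.
have fE n : (\int[distribution (PP n) (loglr (@Q n) (fun=> N))]_x (f x)%:E =
    \int[nu n]_x (f x%:E)%:E)%E.
  rewrite integral_distribution//; last 2 first.
  - exact/measurable_EFinP.
  - apply: (@probability_integrable_bounded _ _ _ _ (f \o loglr (@Q n) (fun=> N)) (A0 + 1)) => //.
      by apply: measurableT_comp => //; exact: measurable_loglr.
    by move=> x; exact: fA.
  apply: (etrans (integral_loglr_continuous (@my n) (@y_ge n) (@QE n) q cf)).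
  rewrite /nu integral_distribution//.
  - by apply/measurable_EFinP; exact: measurable_ereal_EFin.
  - apply: (@probability_integrable_bounded _ _ _ _ (fun x => f (row_loglr (@y n) x)%:E) (A0 + 1)) => //.
    apply: (measurableT_comp (measurable_ereal_EFin cf)).
    exact: measurable_row_loglr.
under eq_cvg do rewrite fE.
(* One bound for the rows and for the limit: the null costs [2 * V n], the alternative [V n], with
   [V n <= v + 1] eventually; the last term is the moment of the Gaussian. *)
pose B := 1 + expR (2 * (v + 1)) + cosh2 m * expR (Num.sqrt v ^+ 2 / 2).
apply: (@cvg_integral_of_cos R nu Z B) => //.
- have /cvgrPdist_le/(_ 1 ltr01) Vev := V_cvg.
  near=> n.
  have Vn : V n <= v + 1.
    have : `|v - V n| <= 1 by near: n.
    by rewrite ler_norml => /andP[? ?]; lra.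
  have V0 : 0 <= V n by apply: sumr_ge0 => i _; exact: var_y_ge0.
  rewrite integral_nu; last 2 first.
  - by apply/measurable_EFinP; exact: measurable_cosh2.
  - by move=> x; rewrite lee_fin cosh2_ge0.
  apply: (@le_trans _ _ (1 + expR (2 * (v + 1)))%:E); last first.
    by rewrite lee_fin /B lerDl mulr_ge0 ?expR_ge0 ?cosh2_ge0.
  rewrite /row_law; case: (q).
    apply: (le_trans (integral_cosh2_row_loglr_Q_le (@my n) (@y_ge n) (@QE n) (@yy n))).
    by rewrite lee_fin lerD2l ler_expR; lra.
  apply: (le_trans (@integral_cosh2_row_loglr_le _ _ _ _ _ _ _ (@my n) (@y_ge n) (@QE n)
    (fun i => 2 * var_y N (@y n i)) _)).
  + by move=> i; exact: (integral_invr_1Dy_le (my i) (y_ge i) (QE i) (yy i)).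
  + by rewrite lee_fin lerD2l ler_expR -mulr_sumr ler_wpM2l.
- rewrite integral_normal_prob_cosh2// lee_fin /B lerDr.
  by rewrite addr_ge0// expR_ge0.
- move=> t b.
  have q01 : 0 <= (q%:R : R) <= 1 by case: (q); rewrite ?lexx ?ler01.
  have [C C0 expansion] := loglik_expansion_exists t q01.
  have mcos : measurable_fun [set: R] (fun x => cos (t * x + b)).
    by apply: (@measurable_cosD _ _ _ id); exact: measurable_id.
  have RnuE n : \int[nu n]_x cos (t * x + b) =
      \int[PP n]_x cos (t * row_loglr (@y n) x + b).
    by rewrite (Rintegral_nu _ mcos)// => x; exact: cos_max.
  under eq_cvg do rewrite RnuE.
  rewrite Rintegral_normal_prob_cos// sqr_sqrtr ?(ltW v0)//.
  have -> : t * m = loglik_drift q%:R t * v by rewrite /m /loglik_drift; field.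
  pose G w := expR (- (t ^+ 2 * w / 2)) * cos (b + loglik_drift q%:R t * w).
  have cG : G (V n) @[n --> \oo] --> G v.
    have Gc : {for v, continuous G}; last exact: (continuous_cvg _ Gc V_cvg).
    apply: cvgM.
      apply: continuous_comp; last exact: continuous_expR.
      apply: cvgN; apply: cvgM; last exact: cvg_cst.
      by apply: cvgM; [exact: cvg_cst|exact: cvg_id].
    apply: continuous_comp; last exact: continuous_cos.
    apply: cvgD; first exact: cvg_cst.
    by apply: cvgM; [exact: cvg_cst|exact: cvg_id].
  rewrite -/(G v).
  apply/cvgrPdist_le => e e0.
  have e20 : 0 < e / 2 by rewrite divr_gt0.
  have eC0 : 0 < e / (2 * (C + 1)) by rewrite divr_gt0// mulr_gt0// ltr_wpDl.
  have /cvgrPdist_le/(_ _ e20) Gev := cG.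
  have /cvgrPdist_le/(_ _ eC0) sev := sum_sqr_var_cvg0.
  near=> n.
  have h1 : `|G v - G (V n)| <= e / 2 by near: n.
  have h2 : `|0 - \sum_(i < k n) (trunc_y N (@y n i) + var_y N (@y n i) ^+ 2)|
      <= e / (2 * (C + 1)) by near: n.
  have h3 := row_law_cos_approx (@my n) (@y_ge n) (@QE n) (@yy n) b expansion.
  set E := \int[_]_x _ in h3 *.
  rewrite (_ : G v - E = (G v - G (V n)) - (E - G (V n))); last by ring.
  apply: (le_trans (ler_normB _ _)); rewrite (splitr e); apply: lerD => //.
  apply: (le_trans h3); rewrite -mulr_sumr.
  move: h2; rewrite sub0r normrN => /(le_trans (ler_norm _)) h2.
  apply: (@le_trans _ _ (C * (e / (2 * (C + 1))))); first exact: ler_wpM2l.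
  rewrite (_ : _ * _ = (C / (C + 1)) * (e / 2)); last by field; rewrite gt_eqF// ltr_wpDl.
  apply: ler_piMl; first exact: ltW.
  by rewrite ler_pdivrMr ?ltr_wpDl// mul1r lerDl.
Unshelve. all: by end_near. Qed.

End sequences_of_rows.

(** * Square-integrable functions and rescaled shapes *)

Section square_integrable.
Context d (T : measurableType d) (R : realType) (N : probability T R).
Implicit Types (f g A B : T -> R) (c e : R).

Definition sqint f := measurable_fun [set: T] f /\ (\int[N]_x (f x ^+ 2)%:E < +oo)%E.

Definition nrm2 f : R := \int[N]_x (f x ^+ 2).

Lemma sqint_integrable f : sqint f -> N.-integrable [set: T] (EFin \o (fun x => f x ^+ 2)).
Proof. by move=> [mf ff]; exact: integrable_sqr_y. Qed.

Lemma nrm2_ge0 f : 0 <= nrm2 f.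
Proof. by apply: Rintegral_ge0 => x _; exact: sqr_ge0. Qed.

Lemma sqintM f g : sqint f -> sqint g -> N.-integrable [set: T] (EFin \o (fun x => f x * g x)).
Proof.
move=> sf sg; have [mf _] := sf; have [mg _] := sg.
have intfg := integrableD measurableT (sqint_integrable sf) (sqint_integrable sg).
apply: (le_integrable measurableT _ _ intfg) => /=.
  by apply/measurable_EFinP; exact: measurable_funM.
move=> x _; rewrite lee_fin [leRHS]ger0_norm ?addr_ge0 ?sqr_ge0//.
have := sqr_ge0 (f x - g x); have := sqr_ge0 (f x + g x) => h1 h2.
by rewrite ler_norml; apply/andP; split; nra.
Qed.

Lemma sqintP f : measurable_fun [set: T] f ->
  N.-integrable [set: T] (EFin \o (fun x => f x ^+ 2)) -> sqint f.
Proof.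
move=> mf /integrableP[_ ff]; split=> //; apply: le_lt_trans ff.
apply: ge0_le_integral => //=.
- by move=> x _; rewrite lee_fin sqr_ge0.
- by apply/measurable_EFinP; exact: measurable_funX.
- by do 2 apply: measurableT_comp => //; exact: measurable_funX.
- by move=> x _; rewrite ger0_norm// sqr_ge0.
Qed.

Lemma sqintD f g : sqint f -> sqint g -> sqint (fun x => f x + g x).
Proof.
move=> sf sg; have [mf _] := sf; have [mg _] := sg.
apply: sqintP; first exact: measurable_funD.
have i1 := integrable_add (sqint_integrable sf) (sqint_integrable sg).
have i2 := integrable_scale 2 (sqintM sf sg).
apply: eq_integrable (integrable_add i1 i2) => // x _ /=.
by congr EFin; ring.
Qed.

Lemma nrm2D_le f g : sqint f -> sqint g ->
  nrm2 (fun x => f x + g x) <= 2 * nrm2 f + 2 * nrm2 g.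
Proof.
move=> sf sg; have i1 := integrable_scale 2 (sqint_integrable sf).
have i2 := integrable_scale 2 (sqint_integrable sg).
rewrite /nrm2 -(RintegralZl _ measurableT (sqint_integrable sf)).
rewrite -(RintegralZl _ measurableT (sqint_integrable sg)).
rewrite -(RintegralD measurableT i1 i2); apply: le_Rintegral => //.
- exact: (sqint_integrable (sqintD sf sg)).
- exact: integrable_add.
- by move=> x _; have := sqr_ge0 (f x - g x) => ?; nra.
Qed.

Lemma normrM_le_sqr e (a b : R) : 0 < e -> `|a * b| <= e / 2 * a ^+ 2 + e^-1 / 2 * b ^+ 2.
Proof.
move=> e0; have ei : 0 < e^-1 by rewrite invr_gt0.
have ee : e * e^-1 = 1 by rewrite divff// gt_eqF.
have h1 : 0 <= e / 2 * (a - e^-1 * b) ^+ 2.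
  by apply: mulr_ge0; [rewrite divr_ge0// ltW|exact: sqr_ge0].
have h2 : 0 <= e / 2 * (a + e^-1 * b) ^+ 2.
  by apply: mulr_ge0; [rewrite divr_ge0// ltW|exact: sqr_ge0].
have e1 : e / 2 * (a - e^-1 * b) ^+ 2 = e / 2 * a ^+ 2 + e^-1 / 2 * b ^+ 2 - a * b.
  by field; rewrite gt_eqF.
have e2 : e / 2 * (a + e^-1 * b) ^+ 2 = e / 2 * a ^+ 2 + e^-1 / 2 * b ^+ 2 + a * b.
  by field; rewrite gt_eqF.
by rewrite ler_norml; apply/andP; split; lra.
Qed.

(** The cross terms [A1 * B2] and [A2 * B1] are split by Young's inequality with weight [e], the
    product [B1 * B2] with weight 1; hence the coefficient [e^-1 + 1] that [cvg0_of_trade_off]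
    expects. *)
Lemma RintegralM_perturb e A1 B1 A2 B2 : 0 < e ->
  sqint A1 -> sqint B1 -> sqint A2 -> sqint B2 ->
  `|\int[N]_x ((A1 x + B1 x) * (A2 x + B2 x)) - \int[N]_x (A1 x * A2 x)| <=
  e / 2 * (nrm2 A1 + nrm2 A2) + (e^-1 + 1) / 2 * (nrm2 B1 + nrm2 B2).
Proof.
move=> e0 sA1 sB1 sA2 sB2.
have iA := integrable_add (sqint_integrable sA1) (sqint_integrable sA2).
have iB := integrable_add (sqint_integrable sB1) (sqint_integrable sB2).
rewrite -(RintegralD measurableT (sqint_integrable sA1) (sqint_integrable sA2)).
rewrite -(RintegralD measurableT (sqint_integrable sB1) (sqint_integrable sB2)).
rewrite -(RintegralZl _ measurableT iA) -(RintegralZl _ measurableT iB).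
rewrite -RintegralD//; [|exact: integrable_scale..].
apply: normr_RintegralB_le_integral.
- exact: sqintM (sqintD sA1 sB1) (sqintD sA2 sB2).
- exact: sqintM.
- by apply: integrable_add; exact: integrable_scale.
move=> x; rewrite (_ : _ - _ = A1 x * B2 x + A2 x * B1 x + B1 x * B2 x); last by ring.
have h1 := normrM_le_sqr (A1 x) (B2 x) e0.
have h2 := normrM_le_sqr (A2 x) (B1 x) e0.
have h3 := normrM_le_sqr (B1 x) (B2 x) (@ltr01 R).
apply: (le_trans (ler_normD _ _)).
apply: (le_trans (lerD (ler_normD _ _) h3)).
apply: (le_trans (lerD (lerD h1 h2) (lexx _))).
by rewrite le_eqVlt; apply/orP; left; apply/eqP; field; rewrite gt_eqF.
Qed.

(** [|a + b|] is at most twice the larger of [|a|] and [|b|]. If that is [|a|], the square gives a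
    factor 4 and the truncation a factor 2; otherwise the truncation is dropped. *)
Lemma trunc_sqrD_le (a b : R) : trunc_sqr (a + b) <= 8 * trunc_sqr a + 4 * b ^+ 2.
Proof.
have a0 := normr_ge0 a.
have [ba|ab] := leP `|b| `|a|.
  have ab2 : `|a + b| <= 2 * `|a|.
    by apply: (le_trans (ler_normD _ _)); rewrite mulr_natl mulr2n lerD.
  rewrite -[leLHS]addr0; apply: lerD; last by rewrite mulr_ge0// sqr_ge0.
  have -> : 8 * trunc_sqr a = (4 * a ^+ 2) * (2 * Num.min `|a| 1).
    by rewrite /trunc_sqr; ring.
  rewrite /trunc_sqr; apply: ler_pM; first exact: sqr_ge0.
  - by rewrite le_min normr_ge0 ler01.
  - rewrite -[leLHS]real_normK ?num_real// -[X in _ <= _ * X]real_normK ?num_real//.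
    have -> : 4 * `|a| ^+ 2 = (2 * `|a|) ^+ 2 by ring.
    by rewrite lerXn2r ?nnegrE ?mulr_ge0.
  - rewrite (_ : 2 * Num.min _ _ = Num.min (2 * `|a|) 2); last by rewrite minr_pMr// mulr1.
    by rewrite le_min !ge_min ab2 /= (_ : 1 <= 2) ?orbT// ler1n.
apply: (le_trans (trunc_sqr_le _)).
rewrite -[leLHS]add0r; apply: lerD; first by rewrite mulr_ge0// trunc_sqr_ge0.
have ab2 : `|a + b| <= 2 * `|b|.
  by apply: (le_trans (ler_normD _ _)); rewrite mulr_natl mulr2n lerD// ltW.
rewrite -[leLHS]real_normK ?num_real// -[X in _ <= _ * X]real_normK ?num_real//.
have -> : 4 * `|b| ^+ 2 = (2 * `|b|) ^+ 2 by ring.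
by rewrite lerXn2r ?nnegrE ?mulr_ge0.
Qed.

Lemma trunc_yD_le A B : sqint A -> sqint B ->
  trunc_y N (fun x => A x + B x) <= 8 * trunc_y N A + 4 * nrm2 B.
Proof.
move=> sA sB; have [mA AA] := sA; have [mB BB] := sB.
have iA := integrable_trunc_y mA AA.
have i1 := integrable_scale 8 iA; have i2 := integrable_scale 4 (sqint_integrable sB).
rewrite /trunc_y -(RintegralZl _ measurableT iA).
rewrite -(RintegralZl _ measurableT (sqint_integrable sB)).
rewrite -(RintegralD measurableT i1 i2); apply: le_Rintegral => //.
- have [mAB ABs] := sqintD sA sB; exact: integrable_trunc_y mAB ABs.
- exact: integrable_add.
- by move=> x _; exact: trunc_sqrD_le.
Qed.

End square_integrable.

Section unit_interval.
Context {R : realType}.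
Local Notation mu := (@lebesgue_measure R).
Local Notation I01 := (`]0%R, 1%R[%classic : set R).
Local Open Scope ereal_scope.

Lemma integral_noise (f : R -> \bar R) : measurable_fun [set: R] f ->
  (forall x, 0 <= f x) -> \int[noise R]_x f x = \int[mu]_(x in I01) f x.
Proof.
move=> mf f0; rewrite /noise integral_uniform// subr0 invr1 mul1e.
by rewrite integral_itv_bndoo//; exact: measurable_funTS.
Qed.

Lemma integral_noise_in (A : set R) (f : R -> \bar R) : measurable A ->
  measurable_fun [set: R] f -> (forall x, 0 <= f x) ->
  \int[noise R]_(x in A) f x = \int[mu]_(x in A `&` I01) f x.
Proof.
move=> mA mf f0; rewrite integral_mkcond integral_noise.
- by rewrite -integral_mkcondl setIC.
- by apply/(measurable_restrictT _ mA); exact: measurable_funTS.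
- by move=> x; rewrite patchE; case: ifP.
Qed.

Lemma noise_setI (A : set R) : measurable A -> noise R A = mu (A `&` I01).
Proof.
move=> mA; have := @integral_noise_in A (cst 1) mA (measurable_cst _) (fun=> lee01).
rewrite integral_cst// mul1e => ->; rewrite integral_cst ?mul1e//.
exact: measurableI.
Qed.

Lemma mem_scale (k u : R) : (0 < k <= 1)%R -> I01 (u / k)%R -> I01 u.
Proof.
move=> /andP[k0 k1] /=; rewrite !in_itv/= => /andP[u0 u1]; apply/andP; split.
  by rewrite pmulr_lgt0 ?invr_gt0// in u0.
by move: u1; rewrite ltr_pdivrMr// mul1r => /lt_le_trans; apply.
Qed.

(** Since [F] vanishes off ]0, 1[ and [k <= 1], the rescaled function lives on ]0, k[, inside the
    support of the noise: nothing is lost in the change of variable. *)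
Lemma integral_noise_scale (k : R) (F : R -> \bar R) : (0 < k <= 1)%R ->
  measurable_fun [set: R] F -> (forall x, 0 <= F x) ->
  (forall x, ~ I01 x -> F x = 0) ->
  \int[noise R]_x F (x / k)%R = k%:E * \int[mu]_(x in I01) F x.
Proof.
move=> k01 mF F0 Fout; have /andP[k0 k1] := k01.
have mFk : measurable_fun [set: R] (fun x => F (x / k)%R).
  by apply: (measurableT_comp mF); exact: measurable_funM.
have mkT (G : R -> \bar R) : (forall x, ~ I01 x -> G x = 0) ->
    \int[mu]_(x in I01) G x = \int[mu]_x G x.
  move=> G0; rewrite integral_mkcond; apply: eq_integral => x _.
  by rewrite patchE; case: ifPn => //; rewrite notin_setE => /G0.
rewrite integral_noise// mkT; last by move=> x nx; apply: Fout => /(mem_scale k01).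
rewrite mkT// (ge0_integral_affine 0 k0)//; congr (_ * _).
by apply: eq_integral => x _; rewrite addr0 mulrAC divff ?mul1r// gt_eqF.
Qed.

End unit_interval.

(** * The density of one observation *)

Section coordinate.
Context {R : realType}.
Local Notation mu := (@lebesgue_measure R).
Local Notation I01 := (`]0%R, 1%R[%classic : set R).
Variables (e k : R) (h r : R -> R) (M : probability (measurableTypeR R) R).
Hypothesis e01 : 0 <= e <= 1.
Hypothesis k0 : 0 < k.
Hypothesis mh : measurable_fun [set: R] h.
Hypothesis h0 : forall u, 0 <= h u.
Hypothesis h_out : forall u, u \notin `]0, 1[%R -> h u = 0.
Hypothesis mr : measurable_fun I01 r.
Hypothesis dens0 : forall u, u \in `]0, 1[%R -> 0 <= k^-1 * h (u / k) + r u.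
Hypothesis ME : forall A : set (measurableTypeR R), measurable A ->
  (M A = \int[mu]_(u in A `&` I01) (k^-1 * h (u / k) + r u)%:E)%E.

(** Set to 0 off ]0, 1[, a null set for the noise, so that measurability and the lower bound [- e]
    hold on the whole line. *)
Definition excess : R -> R := (fun u => e * (k^-1 * h (u / k) + r u - 1)) \_ I01.

Let mhk : measurable_fun [set: R] (fun u => h (u / k)).
Proof. by apply: (measurableT_comp mh); exact: measurable_funM. Qed.

Let msig : measurable_fun I01 (fun u => k^-1 * h (u / k) + r u).
Proof.
by apply: measurable_funD => //; apply: measurable_funM => //; exact: measurable_funTS.
Qed.

Lemma measurable_excess : measurable_fun [set: R] excess.
Proof.
have mI : measurable I01 by exact: measurable_itv.
apply/(measurable_restrictT _ mI); apply: measurable_funM => //.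
exact: measurable_funB.
Qed.

Lemma excessE u : I01 u -> excess u = e * (k^-1 * h (u / k) + r u - 1).
Proof. by move=> Iu; rewrite /excess patchE mem_set. Qed.

Lemma excess_ge u : - e <= excess u.
Proof.
have /andP[e0 _] := e01.
rewrite /excess patchE; case: ifPn; last by rewrite oppr_le0.
rewrite inE => Iu; rewrite mulrBr mulr1 addrC -[leLHS]addr0 lerD2l.
by apply: mulr_ge0 => //; exact: dens0.
Qed.

Lemma mixture_excess (A : set (measurableTypeR R)) : measurable A ->
  (mixture (noise R) M e01 A = \int[noise R]_(x in A) (1 + excess x)%:E)%E.
Proof.
move=> mA; have /andP[e0 e1] := e01.
have mAI : measurable (A `&` I01) by apply: measurableI => //; exact: measurable_itv.
have mex := measurable_excess.
rewrite integral_noise_in//; last 2 first.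
- by apply/measurable_EFinP; exact: measurable_funD.
- by move=> x; rewrite lee_fin; have := excess_ge x => ?; lra.
have -> : (\int[mu]_(x in A `&` I01) (1 + excess x)%:E = \int[mu]_(x in A `&` I01)
    ((1 - e)%:E + e%:E * (k^-1 * h (x / k) + r x)%:E))%E.
  apply: eq_integral => x; rewrite inE => -[_ Ix]; rewrite excessE// -EFinM -EFinD.
  by congr EFin; ring.
rewrite ge0_integralD//; last 3 first.
- by move=> x _; rewrite lee_fin subr_ge0.
- by move=> x [_ Ix]; rewrite mule_ge0 ?lee_fin// dens0.
- apply: emeasurable_funM => //; apply/measurable_EFinP.
  by apply: measurable_funS msig => //; exact: measurable_itv.
rewrite integral_cst// ge0_integralZl//; last 2 first.
- apply/measurable_EFinP.
  by apply: measurable_funS msig => //; exact: measurable_itv.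
- by move=> x [_ Ix]; rewrite lee_fin dens0.
by rewrite /mixture noise_setI// ME.
Qed.

End coordinate.

Section rescaled_functions.
Context {R : realType}.
Local Notation mu := (@lebesgue_measure R).
Local Notation I01 := (`]0%R, 1%R[%classic : set R).
Implicit Types (c k : R) (g r : R -> R).

Definition l2 g : R := fine (\int[mu]_(x in I01) (g x ^+ 2)%:E)%E.

Definition supp01 g := measurable_fun [set: R] g /\ forall x, ~ I01 x -> g x = 0.

Lemma measurable_rescaled g c k : measurable_fun [set: R] g ->
  measurable_fun [set: R] (fun u => c * g (u / k)).
Proof.
move=> mg; apply: measurable_funM => //.
by apply: (measurableT_comp mg); exact: measurable_funM.
Qed.

Lemma integral_sqr_rescaled g c k : 0 < k <= 1 -> supp01 g ->
  (\int[noise R]_u ((c * g (u / k)) ^+ 2)%:E =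
   (c ^+ 2 * k)%:E * \int[mu]_(x in I01) (g x ^+ 2)%:E)%E.
Proof.
move=> k01 [mg gout]; have mg2 : measurable_fun [set: R] (fun x => g x ^+ 2).
  exact: measurable_funX.
rewrite (@integral_noise_scale R k (fun x => ((c * g x) ^+ 2)%:E) k01).
- under eq_integral do rewrite exprMn EFinM.
  rewrite ge0_integralZl//.
  + by rewrite muleA -EFinM mulrC.
  + by apply/measurable_EFinP; exact: measurable_funTS.
  + by move=> x _; rewrite lee_fin sqr_ge0.
  + by rewrite lee_fin sqr_ge0.
- apply/measurable_EFinP; apply: measurable_funX; exact: measurable_funM.
- by move=> x; rewrite lee_fin sqr_ge0.
- by move=> x nx; rewrite gout// mulr0 expr0n.
Qed.

Lemma l2_ge0 g : 0 <= l2 g.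
Proof. by apply: fine_ge0; apply: integral_ge0 => x _; rewrite lee_fin sqr_ge0. Qed.

Lemma sqint_rescaled g c k : 0 < k <= 1 -> supp01 g ->
  (\int[mu]_(x in I01) (g x ^+ 2)%:E < +oo)%E ->
  sqint (noise R) (fun u => c * g (u / k)).
Proof.
move=> k01 sg gg; split; first by apply: measurable_rescaled; exact: sg.1.
rewrite integral_sqr_rescaled//; apply: lte_mul_pinfty => //.
  by rewrite lee_fin mulr_ge0 ?sqr_ge0//; case/andP: k01 => /ltW.
Qed.

Lemma nrm2_rescaled g c k : 0 < k <= 1 -> supp01 g ->
  nrm2 (noise R) (fun u => c * g (u / k)) = c ^+ 2 * k * l2 g.
Proof.
move=> k01 sg; rewrite /nrm2 /Rintegral integral_sqr_rescaled// /l2.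
have : (0 <= \int[mu]_(x in I01) (g x ^+ 2)%:E)%E.
  by apply: integral_ge0 => x _; rewrite lee_fin sqr_ge0.
(* An infinite integral is read as 0 by [fine] on both sides, whether or not the factor [c ^+ 2 * k]
   vanishes. *)
case: (\int[mu]_(x in I01) (g x ^+ 2)%:E)%E => [a||]//= _.
have : 0 <= c ^+ 2 * k.
  by rewrite mulr_ge0 ?sqr_ge0//; case/andP: k01 => /ltW.
rewrite le_eqVlt => /orP[/eqP <-|ck]; first by rewrite mul0e mul0r.
by rewrite gt0_muley//= mulr0.
Qed.

(* Controls the Lindeberg condition: [trunc_sqr] of a rescaled function. *)
Definition l2_trunc g c : R :=
  fine (\int[mu]_(x in I01) (g x ^+ 2 * Num.min (c * `|g x|) 1)%:E)%E.

Lemma measurable_l2_trunc g c : measurable_fun [set: R] g ->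
  measurable_fun [set: R] (fun x => g x ^+ 2 * Num.min (c * `|g x|) 1).
Proof.
move=> mg; apply: measurable_funM; first exact: measurable_funX.
by apply: measurable_minr => //; apply: measurable_funM => //; exact: measurableT_comp.
Qed.

Lemma l2_trunc_ge0 (x c : R) : 0 <= c -> 0 <= x ^+ 2 * Num.min (c * `|x|) 1.
Proof. by move=> c0; rewrite mulr_ge0 ?sqr_ge0// le_min ler01 mulr_ge0. Qed.

Lemma l2_trunc_le (x c : R) : x ^+ 2 * Num.min (c * `|x|) 1 <= x ^+ 2.
Proof. by rewrite ler_piMr ?sqr_ge0// ge_min lexx orbT. Qed.

Lemma trunc_y_rescaled_le g c k b : 0 < k <= 1 -> supp01 g ->
  (\int[mu]_(x in I01) (g x ^+ 2)%:E < +oo)%E -> 0 <= c <= b ->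
  trunc_y (noise R) (fun u => c * g (u / k)) <= c ^+ 2 * k * l2_trunc g b.
Proof.
move=> k01 sg gg /andP[c0 cb]; have [mg gout] := sg; have b0 := le_trans c0 cb.
have /andP[k0 k1] := k01.
have mb := measurable_l2_trunc b mg.
have intb : (\int[mu]_(x in I01) (g x ^+ 2 * Num.min (b * `|g x|) 1)%:E < +oo)%E.
  apply: le_lt_trans gg; apply: ge0_le_integral => //=.
  - by move=> x _; rewrite lee_fin l2_trunc_ge0.
  - by apply/measurable_EFinP; exact: measurable_funTS.
  - by apply/measurable_EFinP; apply: measurable_funTS; exact: measurable_funX.
  - by move=> x _; rewrite lee_fin l2_trunc_le.
have intb0 : (0 <= \int[mu]_(x in I01) (g x ^+ 2 * Num.min (b * `|g x|) 1)%:E)%E.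
  by apply: integral_ge0 => x _; rewrite lee_fin l2_trunc_ge0.
have le1 : (\int[noise R]_u (trunc_sqr (c * g (u / k)))%:E <=
    (c ^+ 2 * k * l2_trunc g b)%:E)%E.
  rewrite (@integral_noise_scale R k (fun x => (trunc_sqr (c * g x))%:E) k01).
  - rewrite (mulrC (c ^+ 2)) -mulrA [leRHS]EFinM lee_wpmul2l ?lee_fin ?(ltW k0)//.
    rewrite EFinM /l2_trunc fineK ?ge0_fin_numE//.
    rewrite -ge0_integralZl//; last 3 first.
    + by apply/measurable_EFinP; exact: measurable_funTS.
    + by move=> x _; rewrite lee_fin l2_trunc_ge0.
    + by rewrite lee_fin sqr_ge0.
    apply: ge0_le_integral => //=.
    + by move=> x _; rewrite lee_fin trunc_sqr_ge0.
    + apply/measurable_EFinP; apply: measurable_funTS.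
      apply: measurable_trunc_y; exact: measurable_funM.
    + apply/measurable_EFinP; apply: measurable_funTS; exact: measurable_funM.
    move=> x _; rewrite -EFinM lee_fin /trunc_sqr exprMn -mulrA.
    apply: ler_wpM2l; first exact: sqr_ge0.
    apply: ler_wpM2l; first exact: sqr_ge0.
    rewrite normrM (ger0_norm c0) le_min !ge_min lexx orbT andbT.
    by rewrite ler_wpM2r.
  - apply/measurable_EFinP; apply: measurable_trunc_y; exact: measurable_funM.
  - by move=> x; rewrite lee_fin trunc_sqr_ge0.
  - by move=> x nx; rewrite gout// mulr0 /trunc_sqr expr0n mul0r.
rewrite -lee_fin /trunc_y /Rintegral fineK//.
rewrite ge0_fin_numE ?(le_lt_trans le1) ?ltry//.
by apply: integral_ge0 => x _; rewrite lee_fin trunc_sqr_ge0.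
Qed.

(** Dominated convergence with bound [g ^+ 2]: the truncation factor tends to 0 at every point. *)
Lemma l2_trunc_cvg0 g (b : nat -> R) : measurable_fun [set: R] g ->
  (\int[mu]_(x in I01) (g x ^+ 2)%:E < +oo)%E ->
  (forall n, 0 <= b n) -> b n @[n --> \oo] --> 0 ->
  l2_trunc g (b n) @[n --> \oo] --> 0.
Proof.
move=> mg gg b0 bcvg.
have mI : measurable I01 by exact: measurable_itv.
have mg2 : measurable_fun I01 (fun x => (g x ^+ 2)%:E).
  by apply/measurable_EFinP; apply: measurable_funTS; exact: measurable_funX.
have := @dominated_convergence _ _ R mu I01 mI
  (fun n x => (g x ^+ 2 * Num.min (b n * `|g x|) 1)%:E) (cst 0%E) (fun x => (g x ^+ 2)%:E).
case.
- by move=> n; apply/measurable_EFinP; apply: measurable_funTS; exact: measurable_l2_trunc.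
- exact: measurable_cst.
- apply: aeW => x _; apply: cvg_EFin; first exact: nearW.
  apply/cvgrPdist_le => e e0.
  have e1 : 0 < e / (g x ^+ 2 * `|g x| + 1).
    by rewrite divr_gt0// ltr_wpDl// mulr_ge0// sqr_ge0.
  move/cvgrPdist_le : bcvg => /(_ _ e1) bev.
  near=> n; have : `|0 - b n| <= e / (g x ^+ 2 * `|g x| + 1) by near: n.
  rewrite sub0r normrN ger0_norm// => bn.
  rewrite sub0r normrN ger0_norm ?l2_trunc_ge0//=.
  apply: (@le_trans _ _ (b n * (g x ^+ 2 * `|g x|))).
    by rewrite mulrCA; apply: ler_wpM2l; [exact: sqr_ge0|rewrite ge_min lexx].
  have gx0 : 0 <= g x ^+ 2 * `|g x| by rewrite mulr_ge0// sqr_ge0.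
  apply: (@le_trans _ _ (e / (g x ^+ 2 * `|g x| + 1) * (g x ^+ 2 * `|g x| + 1))).
    by apply: ler_pM => //; rewrite lerDl.
  by rewrite divfK// gt_eqF// ltr_wpDl.
- apply/integrableP; split => //; apply: le_lt_trans gg; apply: ge0_le_integral => //=.
  + by do 2 apply: measurableT_comp => //; apply: measurable_funTS; exact: measurable_funX.
  + by move=> x _; rewrite ger0_norm// sqr_ge0.
- by apply: aeW => x n _; rewrite lee_fin ger0_norm ?l2_trunc_ge0// l2_trunc_le.
move=> _ _; rewrite integral0 => cvg0.
by apply: fine_cvg; exact: cvg0.
Unshelve. all: by end_near. Qed.

End rescaled_functions.

Section excess_decomposition.
Context {R : realType}.
Local Notation mu := (@lebesgue_measure R).
Local Notation I01 := (`]0%R, 1%R[%classic : set R).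
Variables (e k : R) (h r : R -> R).
Hypothesis k01 : 0 < k <= 1.
Hypothesis sh : supp01 h.
Hypothesis mr : measurable_fun I01 r.
Hypothesis rr : ((e ^+ 2)%:E * \int[mu]_(u in I01) (r u ^+ 2)%:E < +oo)%E.

Local Notation excess := (excess e k h r).

Definition perturbation : R -> R := (fun u => e * r u) \_ I01.

(** All of the excess but the rescaled shape: the perturbation and the centering constant [- e]. *)
Definition drift : R -> R := (fun u => e * (r u - 1)) \_ I01.

(** The product is formed in the extended reals before [fine]: for [e = 0] it is 0 even if the
    integral of [r ^+ 2] is infinite. *)
Definition pert_sqr : R := fine ((e ^+ 2)%:E * \int[mu]_(u in I01) (r u ^+ 2)%:E)%E.

Let mI : measurable I01. Proof. exact: measurable_itv. Qed.

Let k0 : 0 < k. Proof. by case/andP: k01. Qed.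

Lemma excess_split u : excess u = e / k * h (u / k) + drift u.
Proof.
rewrite /excess /drift !patchE; case: ifPn => [_|]; first by ring.
rewrite notin_setE => nI; rewrite sh.2 ?mulr0 ?addr0// => /(mem_scale k01).
exact: nI.
Qed.

Lemma measurable_perturbation : measurable_fun [set: R] perturbation.
Proof. by apply/(measurable_restrictT _ mI); exact: measurable_funM. Qed.

Lemma integral_sqr_perturbation :
  (\int[noise R]_u (perturbation u ^+ 2)%:E =
   (e ^+ 2)%:E * \int[mu]_(u in I01) (r u ^+ 2)%:E)%E.
Proof.
rewrite integral_noise.
- rewrite -ge0_integralZl//.
  + apply: eq_integral => u uI; rewrite /perturbation patchE uI exprMn.
    by rewrite EFinM.
  + by apply/measurable_EFinP; exact: measurable_funX.
  + by move=> x _; rewrite lee_fin sqr_ge0.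
  + by rewrite lee_fin sqr_ge0.
- by apply/measurable_EFinP; apply: measurable_funX; exact: measurable_perturbation.
- by move=> x; rewrite lee_fin sqr_ge0.
Qed.

Lemma sqint_perturbation : sqint (noise R) perturbation.
Proof. by split; [exact: measurable_perturbation|rewrite integral_sqr_perturbation]. Qed.

Lemma nrm2_perturbation : nrm2 (noise R) perturbation = pert_sqr.
Proof. by rewrite /nrm2 /Rintegral integral_sqr_perturbation. Qed.

Let unit_e : R -> R := (cst (- e)) \_ I01.

Let munit : measurable_fun [set: R] unit_e.
Proof. by apply/(measurable_restrictT _ mI). Qed.

Let unit_le u : `|unit_e u ^+ 2| <= e ^+ 2.
Proof.
rewrite ger0_norm ?sqr_ge0// /unit_e patchE; case: ifP => _; first by rewrite sqrrN.
by rewrite expr0n sqr_ge0.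
Qed.

Let int_unit : (noise R).-integrable [set: R] (EFin \o (fun u => unit_e u ^+ 2)).
Proof.
apply: (@probability_integrable_bounded _ (measurableTypeR R) R _ _ (e ^+ 2)) => //.
exact: measurable_funX.
Qed.

Let driftE : drift = (fun u => perturbation u + unit_e u).
Proof.
apply/funext => u; rewrite /drift /perturbation /unit_e !patchE; case: ifP => _.
  by rewrite mulrBr mulr1.
by rewrite addr0.
Qed.

Let sqint_unit : sqint (noise R) unit_e. Proof. exact: sqintP. Qed.

Lemma sqint_drift : sqint (noise R) drift.
Proof. by rewrite driftE; apply: sqintD sqint_unit; exact: sqint_perturbation. Qed.

Lemma nrm2_drift_le : nrm2 (noise R) drift <= 2 * pert_sqr + 2 * e ^+ 2.
Proof.
rewrite driftE; apply: (le_trans (nrm2D_le sqint_perturbation sqint_unit)).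
rewrite nrm2_perturbation lerD2l; apply: ler_wpM2l => //.
apply: (@le_trans _ _ (\int[noise R]_x (cst (e ^+ 2) x))).
  apply: le_Rintegral => //; first exact: finite_measure_integrable_cst.
  by move=> u _; exact: le_trans (ler_norm _) (unit_le u).
by rewrite Rintegral_cst//= probability_setT mulr1.
Qed.

Section shape.
Hypothesis hh : (\int[mu]_(x in I01) (h x ^+ 2)%:E < +oo)%E.

Lemma sqint_excess : sqint (noise R) excess.
Proof.
rewrite (_ : excess = fun u => e / k * h (u / k) + drift u); last first.
  by apply/funext => u; exact: excess_split.
by apply: sqintD sqint_drift; exact: sqint_rescaled.
Qed.

Variable g : R -> R.
Hypothesis sg : supp01 g.
Hypothesis gg : (\int[mu]_(x in I01) (g x ^+ 2)%:E < +oo)%E.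
Hypothesis hg : (\int[mu]_(x in I01) ((h x - g x) ^+ 2)%:E < +oo)%E.

(** Remainder after the shape has been replaced by its limit [g], as suits the variances. The
    covariances between two models keep the shapes, in terms of which [Gamma] is given, and use
    [drift]. *)
Definition residual u := drift u + e / k * (h (u / k) - g (u / k)).

Let shg : supp01 (fun x => h x - g x).
Proof.
split; first by apply: measurable_funB; [exact: sh.1|exact: sg.1].
by move=> x nx; rewrite sh.2// sg.2// subr0.
Qed.

Lemma excess_split_residual u : excess u = e / k * g (u / k) + residual u.
Proof. by rewrite excess_split /residual; ring. Qed.

Lemma sqint_residual : sqint (noise R) residual.
Proof.
rewrite /residual; apply: (sqintD sqint_drift).
exact: (@sqint_rescaled R (fun x => h x - g x) (e / k) k k01 shg hg).
Qed.

Lemma nrm2_residual_le : nrm2 (noise R) residual <=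
  4 * pert_sqr + 4 * e ^+ 2 + 2 * (e ^+ 2 / k * l2 (fun x => h x - g x)).
Proof.
have s1 := @sqint_rescaled R (fun x => h x - g x) (e / k) k k01 shg hg.
apply: (le_trans (nrm2D_le sqint_drift s1)).
rewrite (@nrm2_rescaled R (fun x => h x - g x) (e / k) k k01 shg).
apply: lerD.
  apply: (@le_trans _ _ (2 * (2 * pert_sqr + 2 * e ^+ 2))).
    by apply: ler_wpM2l => //; exact: nrm2_drift_le.
  by rewrite le_eqVlt; apply/orP; left; apply/eqP; ring.
apply: ler_wpM2l => //; rewrite le_eqVlt; apply/orP; left; apply/eqP.
by congr (_ * _); field; rewrite gt_eqF.
Qed.

End shape.
End excess_decomposition.

(** * Hellinger lower bound *)

Section hellinger_lower_bound.
Context {R : realType}.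
Local Notation mu := (@lebesgue_measure R).
Local Notation I01 := (`]0%R, 1%R[%classic : set R).

(* Where the shape [z] exceeds 1/2 the density is at least [1 + a / 4] up to the
   perturbation [w]; [min a^2 a] is the order of [(sqrt (1 + a) - 1)^2]. *)
Lemma sqr_sqrtB1_ge (a k z w s : R) : 0 <= a -> 0 < k -> k <= 4^-1 -> 2^-1 <= z ->
  0 <= s -> s ^+ 2 = 1 + a * (z - k) + w ->
  Num.min (a ^+ 2) a / 72 <= 2 * (s - 1) ^+ 2 + 2 * w ^+ 2.
Proof.
move=> a0 k0 k4 z2 s0 sE; pose y := a * (z - k).
have ya : a / 4 <= y by rewrite /y; nra.
have y0 : 0 <= y by lra.
pose t := Num.sqrt (1 + y).
have tE : t ^+ 2 = 1 + y by rewrite sqr_sqrtr//; lra.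
have t0 : 0 <= t by exact: sqrtr_ge0.
have t1 : 1 <= t by rewrite -(@ler_pXn2r _ 2)// ?nnegrE// tE expr1n; lra.
(* Since [s + t >= 1], removing [w] from the radicand moves the square root by at most [|w|]. *)
have st : (s - t) ^+ 2 <= w ^+ 2.
  have -> : w = (s - t) * (s + t) by rewrite -subr_sqr sE tE /y; ring.
  rewrite exprMn ler_peMr ?sqr_ge0// -[leLHS](expr1n _ 2) lerXn2r ?nnegrE//; lra.
have ts : (t - 1) ^+ 2 <= 2 * (s - 1) ^+ 2 + 2 * w ^+ 2.
  have := sqr_ge0 ((s - 1) + (s - t)); have := st; nra.
apply: le_trans ts.
have t12 : (t + 1) ^+ 2 <= 4 + 2 * y.
  have -> : 4 + 2 * y = 2 + 2 * t ^+ 2 by rewrite tE; ring.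
  have := sqr_ge0 (t - 1); nra.
have tp : 0 < (t + 1) ^+ 2 by apply: exprn_gt0; lra.
have ty : (t - 1) ^+ 2 * (t + 1) ^+ 2 = y ^+ 2.
  by rewrite -exprMn (_ : (t - 1) * (t + 1) = y)// -subr_sqr tE expr1n; ring.
(* [t - 1] equals [y / (t + 1)], and [(t + 1)^2] is at most [4 + 2 * y]. *)
have low : y ^+ 2 / (4 + 2 * y) <= (t - 1) ^+ 2.
  rewrite ler_pdivrMr; last lra.
  by rewrite -ty; apply: ler_wpM2l => //; exact: sqr_ge0.
apply: le_trans low.
rewrite ler_pdivlMr; last lra.
(* By [y >= a / 4] the quotient is at least [a^2 / (64 + 8 * a)], and [64 + 8 * a] is at most 72
   times the larger of 1 and [a]. *)
have [a1|a1] := leP a 1.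
  have -> : Num.min (a ^+ 2) a = a ^+ 2 by rewrite min_l// expr2 ler_piMl.
  have h1 : 0 <= (4 * y - a) * (4 * y + a) by rewrite mulr_ge0//; lra.
  have h2 : 0 <= a * ((1 - a) * y) by rewrite !mulr_ge0//; lra.
  have h3 : 0 <= (4 * y - a) * y by rewrite mulr_ge0//; lra.
  by lra.
have -> : Num.min (a ^+ 2) a = a by rewrite min_r// expr2 ler_peMl// ltW.
have h1 : 0 <= (4 * y - a) * (4 * y + a) by rewrite mulr_ge0//; lra.
have h2 : 0 <= a * (a - 1) by rewrite mulr_ge0//; lra.
have h3 : 0 <= (4 * y - a) * y by rewrite mulr_ge0//; lra.
by lra.
Qed.

Variables (e k : R) (h r : R -> R) (C : R).
Hypothesis e01 : 0 <= e <= 2^-1.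
Hypothesis k0 : 0 < k.
Hypothesis k4 : k <= 4^-1.
Hypothesis sh : supp01 h.
Hypothesis h0 : forall u, 0 <= h u.
Hypothesis h_int : (\int[mu]_(u in I01) (h u)%:E = 1)%E.
Hypothesis mr : measurable_fun I01 r.
Hypothesis rr : ((e ^+ 2)%:E * \int[mu]_(u in I01) (r u ^+ 2)%:E < +oo)%E.
Hypothesis dens0 : forall u, u \in `]0, 1[%R -> 0 <= k^-1 * h (u / k) + r u.
Hypothesis hh : (\int[mu]_(x in I01) (h x ^+ 2)%:E < +oo)%E.
Hypothesis C0 : 0 < C.
Hypothesis hC : l2 h <= C.
Hypothesis intex : (noise R).-integrable [set: R]
  (EFin \o (fun u => (expR (ln (1 + excess e k h r u) / 2) - 1) ^+ 2)).

Local Notation y := (excess e k h r).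
Local Notation m := (Num.min ((e / k) ^+ 2) (e / k)).

Let k01 : 0 < k <= 1. Proof. by rewrite k0/=; move: k4; lra. Qed.

Let a0 : 0 <= e / k.
Proof. by case/andP: e01 => ? _; rewrite divr_ge0// ltW. Qed.

Let m0 : 0 <= m. Proof. by rewrite le_min sqr_ge0 a0. Qed.

(** A second-moment argument for the mass where the shape [z] is at least 1/2: its indicator is
    bounded below by [(z - b / 2) / C - z^2 / (4 * C^2)], with [b] the indicator of ]0, k[. This is
    at most 1 by a perfect square and nonpositive where [z < 1/2]; its integral involves only
    [\int z = k], [\int b = k] and [\int z^2 <= k * C]. *)
Lemma hellinger_ge :
  k * m / (576 * C) <= hellinger_y (noise R) y + pert_sqr e r.
Proof.
have intw := sqint_integrable (sqint_perturbation mr rr).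
pose w := perturbation e r.
pose z u := h (u / k).
pose b u : R := \1_I01 (u / k).
have mhk : measurable_fun [set: R] z by apply: (measurableT_comp sh.1); exact: measurable_funM.
have mI : measurable I01 by exact: measurable_itv.
have mb : measurable_fun [set: R] b.
  by apply: (measurableT_comp (measurable_indic mI)); exact: measurable_funM.
have intz2 : (noise R).-integrable [set: R] (EFin \o (fun u => z u ^+ 2)).
  have s1 := @sqint_rescaled R h 1 k k01 sh hh.
  by apply: eq_integrable (sqint_integrable s1) => // u _; rewrite /= mul1r.
have Rz2 : \int[noise R]_u (z u ^+ 2) = k * l2 h.
  have := @nrm2_rescaled R h 1 k k01 sh; rewrite expr1n mul1r => <-.
  by apply: eq_Rintegral => u _; rewrite mul1r.
have Ez : (\int[noise R]_u (z u)%:E = k%:E)%E.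
  rewrite (@integral_noise_scale R k (fun u => (h u)%:E) k01).
  - by rewrite h_int mule1.
  - by apply/measurable_EFinP; exact: sh.1.
  - by move=> x; rewrite lee_fin.
  - by move=> x nx; rewrite sh.2.
have intz : (noise R).-integrable [set: R] (EFin \o z).
  by apply: ge0_integrable_lty => //; [move=> x; exact: h0|rewrite Ez ltry].
have Rz : \int[noise R]_u z u = k by rewrite /Rintegral Ez.
have Eb : (\int[noise R]_u (b u)%:E = k%:E)%E.
  rewrite (@integral_noise_scale R k (fun u => (\1_I01 u)%:E) k01).
  - have -> : (\int[mu]_(x in I01) (\1_I01 x)%:E = mu (I01 `&` I01))%E by exact: integral_indic.
    rewrite setIid (lebesgue_measure_itv `]0%R, 1%R[) /= lte01 oppr0 adde0.
    by rewrite mule1.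
  - by apply/measurable_EFinP; exact: measurable_indic.
  - by move=> x; rewrite lee_fin.
  - by move=> x nx; rewrite indicE memNset.
have intb : (noise R).-integrable [set: R] (EFin \o b).
  apply: (@probability_integrable_bounded _ (measurableTypeR R) R _ _ 1) => //.
  by move=> u; rewrite /b indicE; case: (_ \in _); rewrite ?normr1 ?normr0.
have Rb : \int[noise R]_u b u = k by rewrite /Rintegral Eb.
(* The coefficients of that minorant times [m / 72]. Its integral is at least
   [k * m * (1/72 - 1/144 - 1/288) / C], that is [k * m / (288 * C)]; the factor 2 in front of both
   squares turns 288 into 576. *)
pose Cz := m / (72 * C); pose Cb := m / (144 * C); pose Cq := m / (288 * C ^+ 2).
have i1 := integrable_scale Cz intz.
have i2 := integrable_scale (- Cb) intb.
have i3 := integrable_scale (- Cq) intz2.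
have i12 := integrable_add i1 i2; have i123 := integrable_add i12 i3.
have j1 := integrable_scale 2 intex; have j2 := integrable_scale 2 intw.
have j12 := integrable_add j1 j2.
have le1 : \int[noise R]_u (Cz * z u + - Cb * b u + - Cq * z u ^+ 2) <=
   \int[noise R]_u (2 * (expR (ln (1 + y u) / 2) - 1) ^+ 2 + 2 * w u ^+ 2).
  apply: le_Rintegral => // u _.
  have rhs0 : 0 <= 2 * (expR (ln (1 + y u) / 2) - 1) ^+ 2 + 2 * w u ^+ 2.
    by rewrite addr_ge0// mulr_ge0// sqr_ge0.
  have quad : Cz * z u + - Cb * b u + - Cq * z u ^+ 2 =
      m / 72 * ((z u - 2^-1 * b u) / C - z u ^+ 2 / (4 * C ^+ 2)).
    by rewrite /Cz /Cb /Cq; field; rewrite gt_eqF.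
  rewrite quad.
  have Ci : 0 <= C^-1 by rewrite invr_ge0 ltW.
  have sqC : z u ^+ 2 / (4 * C ^+ 2) = (z u / (2 * C)) ^+ 2 by field; rewrite gt_eqF.
  have m72 : 0 <= m / 72 by rewrite divr_ge0.
  have [uk|uk] := boolP (u / k \in I01); last first.
    apply: le_trans rhs0; have -> : z u = 0.
      by rewrite /z sh.2// => /mem_set; rewrite (negbTE uk).
    have -> : b u = 0 by rewrite /b indicE (negbTE uk).
    rewrite (_ : (0 - 2^-1 * 0) / C - 0 ^+ 2 / (4 * C ^+ 2) = 0) ?mulr0//.
    by rewrite ?mulr0 subrr mul0r expr0n/= mul0r subrr.
  have uI : I01 u by apply: (mem_scale k01); exact: set_mem.
  rewrite /b indicE uk mulr1.
  have [z2|z2] := leP 2^-1 (z u); last first.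
    apply: le_trans rhs0; rewrite -[leRHS](mulr0 (m / 72)); apply: ler_wpM2l => //.
    have h1 : (z u - 2^-1) / C <= 0 by rewrite mulr_le0_ge0//; lra.
    have h2 : 0 <= (z u / (2 * C)) ^+ 2 := sqr_ge0 _.
    by rewrite sqC; lra.
  have y1 : 0 < 1 + y u.
    have e01' : 0 <= e <= 1 by case/andP: e01 => ? ?; apply/andP; split; lra.
    have := excess_ge e01' dens0 u; case/andP: e01 => ? ? ?; lra.
  have sE : expR (ln (1 + y u) / 2) ^+ 2 = 1 + e / k * (z u - k) + w u.
    rewrite expr2 -expRD -splitr lnK ?posrE// excessE// /w /perturbation patchE mem_set//.
    by rewrite /z; field; rewrite gt_eqF.
  apply: le_trans (sqr_sqrtB1_ge a0 k0 k4 z2 (expR_ge0 _) sE).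
  rewrite -[leRHS]mulr1; apply: ler_wpM2l => //.
  have h2 : 0 <= (z u / (2 * C) - 1) ^+ 2 := sqr_ge0 _.
  have h3 : (z u / (2 * C) - 1) ^+ 2 = (z u / (2 * C)) ^+ 2 - z u / C + 1.
    by field; rewrite gt_eqF.
  have h4 : (z u - 2^-1) / C = z u / C - 2^-1 / C by field; rewrite gt_eqF.
  have h5 : 0 <= 2^-1 / C by rewrite divr_ge0// ltW.
  by rewrite sqC; lra.
move: le1.
rewrite (RintegralD measurableT j1 j2) (RintegralZl _ measurableT intex).
rewrite (RintegralZl _ measurableT intw) (RintegralD measurableT i12 i3).
rewrite (RintegralD measurableT i1 i2) (RintegralZl _ measurableT intz).
rewrite (RintegralZl _ measurableT intb) (RintegralZl _ measurableT intz2).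
rewrite Rz Rb Rz2 -/(hellinger_y (noise R) y).
have -> : \int[noise R]_x (w x ^+ 2) = pert_sqr e r by exact: nrm2_perturbation.
move=> le1.
have q1 : Cq * (k * l2 h) <= Cq * (k * C).
  apply: ler_wpM2l; last by apply: ler_wpM2l => //; exact: ltW.
  by rewrite divr_ge0// mulr_ge0// sqr_ge0.
have q2 : Cz * k + - Cb * k - Cq * (k * C) = 2 * (k * m / (576 * C)).
  by rewrite /Cz /Cb /Cq; field; rewrite gt_eqF.
by rewrite mulNr in le1; lra.
Qed.

End hellinger_lower_bound.

(** * Rows of the p-value model *)

Section trade_off.
Context {R : realType}.

(** Stands in for the Cauchy-Schwarz inequality: the weight [e] is fixed so small that [e * a n] is
    negligible, and only then does [b n] tend to 0. *)
Lemma cvg0_of_trade_off (u a b : nat -> R) (A : R) :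
  (forall e, 0 < e -> \forall n \near \oo, `|u n| <= e * a n + (e^-1 + 1) * b n) ->
  a n @[n --> \oo] --> A -> b n @[n --> \oo] --> 0 -> u n @[n --> \oo] --> 0.
Proof.
move=> H aA b0; apply/cvgr0Pnorm_le => e e0.
have A1 : 0 < `|A| + 1 by have := normr_ge0 A; lra.
pose d := e / (2 * (`|A| + 1)).
have d0 : 0 < d by rewrite divr_gt0// mulr_gt0.
have d1 : 0 < d^-1 + 1 by have : 0 < d^-1 by [rewrite invr_gt0]; lra.
have An : \forall n \near \oo, a n < `|A| + 1.
  by apply: (cvgr_lt A) => //; have := ler_norm A; lra.
have bn : \forall n \near \oo, b n < e / (2 * (d^-1 + 1)).
  by apply: (cvgr_lt 0) => //; rewrite divr_gt0// mulr_gt0.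
near=> n; apply: (@le_trans _ _ (d * a n + (d^-1 + 1) * b n)); first by near: n; exact: H.
have h1 : d * a n <= d * (`|A| + 1) by apply: ler_wpM2l; [exact: ltW|apply: ltW; near: n].
have h2 : (d^-1 + 1) * b n <= (d^-1 + 1) * (e / (2 * (d^-1 + 1))).
  by apply: ler_wpM2l; [exact: ltW|apply: ltW; near: n].
have h3 : d * (`|A| + 1) = e / 2 by rewrite /d; field; rewrite gt_eqF.
have h4 : (d^-1 + 1) * (e / (2 * (d^-1 + 1))) = e / 2.
  by move: d1; set z := d^-1 + 1 => z0; field; rewrite gt_eqF.
by rewrite h3 in h1; rewrite h4 in h2; lra.
Unshelve. all: by end_near.
Qed.

End trade_off.

Section model_rows.
Context {R : realType} {k : nat -> nat}.
Variable M : pvalue_model R k.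
Local Notation mu := (@lebesgue_measure R).
Local Notation I01 := (`]0%R, 1%R[%classic : set R).

Definition row_excess n (i : 'I_(k n)) : R -> R :=
  excess (eps M i) (kappa M i) (hshape M i) (pert M i).

(** Holds for all large [n]. [eps <= 1/2] gives [y >= - 1/2], [kappa <= 1/4] serves the rescaling
    and the Hellinger bound, and the finiteness of the two integrals follows from [pert_cvg0] and
    from the convergence of the shapes. *)
Definition good_row n := forall i : 'I_(k n),
  [/\ eps M i <= 2^-1, kappa M i <= 4^-1,
    ((eps M i ^+ 2)%:E * \int[mu]_(u in I01) (pert M i u ^+ 2)%:E < +oo)%E
  & (\int[mu]_(u in I01) (hshape M i u ^+ 2)%:E < +oo)%E].

Lemma eps_ge0 n (i : 'I_(k n)) : 0 <= eps M i.
Proof. by have /andP[] := eps01 M i. Qed.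

Lemma eps_kappa_ge0 n (i : 'I_(k n)) : 0 <= eps M i / kappa M i.
Proof. by rewrite divr_ge0 ?eps_ge0// ltW// kappa_gt0. Qed.

Lemma eps2_kappa_ge0 n (i : 'I_(k n)) : 0 <= eps M i ^+ 2 / kappa M i.
Proof. by rewrite divr_ge0 ?sqr_ge0// ltW// kappa_gt0. Qed.

Lemma supp01_hshape n (i : 'I_(k n)) : supp01 (hshape M i).
Proof.
split; first exact: hshape_measurable.
by move=> x nx; apply: hshape_out; apply/negP => xI; exact: nx.
Qed.

Lemma measurable_pert n (i : 'I_(k n)) : measurable_fun I01 (pert M i).
Proof. by apply/measurable_EFinP; exact: measurable_int (pert_integrable M i). Qed.

Lemma measurable_row_excess n (i : 'I_(k n)) : measurable_fun [set: R] (row_excess i).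
Proof. by apply: measurable_excess; [exact: hshape_measurable|exact: measurable_pert]. Qed.

Lemma row_excess_geN n (i : 'I_(k n)) x : - eps M i <= row_excess i x.
Proof. by apply: excess_ge; [exact: eps01|exact: density_ge0]. Qed.

Lemma obsE n (i : 'I_(k n)) (A : set (measurableTypeR R)) : measurable A ->
  (obs M i A = \int[noise R]_(x in A) (1 + row_excess i x)%:E)%E.
Proof.
move=> mA; apply: mixture_excess => //.
- exact: hshape_measurable.
- exact: measurable_pert.
- exact: density_ge0.
- exact: signalE.
Qed.

Section good_rows.
Variable n : nat.
Hypothesis good : good_row n.
Implicit Type i : 'I_(k n).

Lemma row_excess_ge i x : - 2^-1 <= row_excess i x.
Proof. by have [e2 _ _ _] := good i; have := row_excess_geN i x; lra. Qed.

Lemma kappa01 i : 0 < kappa M i <= 1.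
Proof. by have [_ k4 _ _] := good i; rewrite kappa_gt0/=; lra. Qed.

Lemma sqint_row_excess i : sqint (noise R) (row_excess i).
Proof.
have [_ _ rr hh] := good i.
exact: (sqint_excess (kappa01 i) (supp01_hshape i) (measurable_pert i) rr hh).
Qed.

End good_rows.

Definition pert_row n := \sum_(i < k n) pert_sqr (eps M i) (pert M i).

Let prow n i : (0 <= (eps M i ^+ 2)%:E *
  \int[mu]_(u in I01) (@pert _ _ M n i u ^+ 2)%:E)%E.
Proof.
by apply: mule_ge0; [rewrite lee_fin sqr_ge0|apply: integral_ge0 => x _; rewrite lee_fin sqr_ge0].
Qed.

Lemma near_pert_row : \forall n \near \oo, forall i : 'I_(k n),
  ((eps M i ^+ 2)%:E * \int[mu]_(u in I01) (pert M i u ^+ 2)%:E < +oo)%E.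
Proof.
have /fine_cvgP[H _] := pert_cvg0 M.
near=> n => i.
have : (\sum_(i < k n) (eps M i ^+ 2)%:E *
    \int[mu]_(u in I01) (pert M i u ^+ 2)%:E)%E \is a fin_num by near: n; exact: H.
rewrite ge0_fin_numE; last by apply: sume_ge0 => j _; exact: prow.
apply: le_lt_trans; rewrite (bigD1 i)//= leeDl//.
by apply: sume_ge0 => j _; exact: prow.
Unshelve. all: by end_near.
Qed.

Lemma pert_row_cvg0 : pert_row n @[n --> \oo] --> 0.
Proof.
have /fine_cvgP[_] := pert_cvg0 M; apply: cvg_trans; apply: near_eq_cvg.
near=> n; rewrite /pert_row/= -sum_fine// => i _.
rewrite ge0_fin_numE//; move: i; near: n; exact: near_pert_row.
Unshelve. all: by end_near.
Qed.

Definition max_eps_kappa n : R := \big[Num.max/0]_(i < k n) (eps M i + kappa M i).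

Lemma eps_le_max n (i : 'I_(k n)) : eps M i <= max_eps_kappa n.
Proof.
apply: le_trans (le_bigmax 0 (fun i : 'I_(k n) => eps M i + kappa M i) i).
by rewrite lerDl ltW// kappa_gt0.
Qed.

Lemma kappa_le_max n (i : 'I_(k n)) : kappa M i <= max_eps_kappa n.
Proof.
apply: le_trans (le_bigmax 0 (fun i : 'I_(k n) => eps M i + kappa M i) i).
by rewrite lerDr eps_ge0.
Qed.

Variable h : R -> R.
Hypothesis Lh : L2_01 h.
Hypothesis shc : shape_cvg M h.

(** [L2_01] constrains [h] on ]0, 1[ only; after extension by 0 the limit can be rescaled like the
    shapes themselves. *)
Definition shape_limit : R -> R := h \_ I01.
Local Notation g := shape_limit.

Definition shape_dist n : R := fine
  (\big[maxe/0]_(i < k n) \int[mu]_(x in I01) ((hshape M i x - h x) ^+ 2)%:E)%E.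

Lemma supp01_shape_limit : supp01 g.
Proof.
split; last by move=> x nx; rewrite /g patchE memNset.
have mI : measurable (I01 : set R) by exact: measurable_itv.
exact: ((measurable_restrictT h mI).1 Lh.1).
Qed.

Lemma integral_shape_limit :
  (\int[mu]_(x in I01) (g x ^+ 2)%:E = \int[mu]_(x in I01) (h x ^+ 2)%:E)%E.
Proof. by apply: eq_integral => x xI; rewrite /g patchE xI. Qed.

Lemma shape_limit_lty : (\int[mu]_(x in I01) (g x ^+ 2)%:E < +oo)%E.
Proof. by rewrite integral_shape_limit; exact: Lh.2. Qed.

Lemma integral_shape_dist n (i : 'I_(k n)) :
  (\int[mu]_(x in I01) ((hshape M i x - g x) ^+ 2)%:E =
   \int[mu]_(x in I01) ((hshape M i x - h x) ^+ 2)%:E)%E.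
Proof. by apply: eq_integral => x xI; rewrite /g patchE xI. Qed.

Lemma shape_dist_cvg0 : shape_dist n @[n --> \oo] --> 0.
Proof. by have /fine_cvgP[] := shc. Qed.

Lemma near_shape_dist : \forall n \near \oo, forall i : 'I_(k n),
  (\int[mu]_(x in I01) ((hshape M i x - g x) ^+ 2)%:E <= (shape_dist n)%:E)%E.
Proof.
have /fine_cvgP[H _] := shc.
near=> n => i; rewrite /shape_dist fineK; last by near: n; exact: H.
rewrite integral_shape_dist.
exact: (le_bigmax 0%E (fun i : 'I_(k n) =>
  \int[mu]_(x in I01) ((hshape M i x - h x) ^+ 2)%:E)%E i).
Unshelve. all: by end_near.
Qed.

Lemma l2_add_le (u v : R -> R) : supp01 u -> supp01 v ->
  (\int[mu]_(x in I01) ((u x + v x) ^+ 2)%:E <=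
   2%:E * \int[mu]_(x in I01) (u x ^+ 2)%:E + 2%:E * \int[mu]_(x in I01) (v x ^+ 2)%:E)%E.
Proof.
move=> [mu_ _] [mv _].
have ms (w : R -> R) : measurable_fun [set: R] w ->
    measurable_fun I01 (fun x => (w x ^+ 2)%:E).
  move=> mw; apply/measurable_EFinP; apply: measurable_funX.
  exact: measurable_funS mw.
rewrite -!ge0_integralZl//; try exact: ms; try by move=> x _; rewrite lee_fin sqr_ge0.
rewrite -ge0_integralD//; try by move=> x _; rewrite -EFinM lee_fin mulr_ge0// sqr_ge0.
- apply: ge0_le_integral => //.
  + by move=> x _; rewrite lee_fin sqr_ge0.
  + by apply: (ms (fun x => u x + v x)); exact: measurable_funD.
  + by apply: emeasurable_funD; apply: measurable_funeM; exact: ms.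
  + move=> x _; rewrite -!EFinM -EFinD lee_fin; have := sqr_ge0 (u x - v x); lra.
- by apply: measurable_funeM; exact: ms.
- by apply: measurable_funeM; exact: ms.
Qed.

Lemma supp01B (u v : R -> R) : supp01 u -> supp01 v -> supp01 (fun x => u x - v x).
Proof.
by move=> [mu_ u0] [mv v0]; split; [exact: measurable_funB|move=> x nx; rewrite u0// v0// subr0].
Qed.

(** From [(a + b)^2 <= 2 * a^2 + 2 * b^2], once the distance to the limit shape is below 1. The
    bound does not depend on [i] and becomes the constant [C] of the Hellinger estimate. *)
Lemma near_l2_hshape : \forall n \near \oo, forall i : 'I_(k n),
  (\int[mu]_(u in I01) (hshape M i u ^+ 2)%:E <= (2 * l2 g + 2)%:E)%E.
Proof.
have d1 : \forall n \near \oo, shape_dist n < 1.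
  by apply: (cvgr_lt 0) => //; exact: shape_dist_cvg0.
near=> n => i.
have sh := supp01_hshape i; have sg := supp01_shape_limit.
have := l2_add_le sg (supp01B sh sg).
under eq_integral do rewrite addrC subrK.
have -> : ((2 * l2 g + 2)%:E = 2%:E * (l2 g)%:E + 2%:E * 1%:E)%E by rewrite mule1.
move=> /le_trans; apply; apply: leeD.
  apply: lee_pmul => //; last by rewrite /l2 fineK// ge0_fin_numE ?shape_limit_lty//;
    apply: integral_ge0 => x _; rewrite lee_fin sqr_ge0.
  by apply: integral_ge0 => x _; rewrite lee_fin sqr_ge0.
apply: lee_wpmul2l => //.
apply: (@le_trans _ _ (shape_dist n)%:E); last by rewrite lee_fin ltW//; near: n.
by move: i {sh}; near: n; exact: near_shape_dist.
Unshelve. all: by end_near.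
Qed.

Lemma near_good_row : \forall n \near \oo, good_row n.
Proof.
have H : \forall n \near \oo, max_eps_kappa n < 4^-1.
  by apply: (cvgr_lt 0) => //; exact: eps_kappa_cvg0.
near=> n => i.
have m4 : max_eps_kappa n < 4^-1 by near: n.
split.
- by have := eps_le_max i; lra.
- by have := kappa_le_max i; lra.
- by move: i; near: n; exact: near_pert_row.
- apply: (le_lt_trans _ (ltry (2 * l2 g + 2))).
  by move: i; near: n; exact: near_l2_hshape.
Unshelve. all: by end_near.
Qed.

End model_rows.

(** * Sums over a row: variances, truncated moments and residuals *)

Section row_sums.
Context {R : realType} {k : nat -> nat}.
Variable M : pvalue_model R k.
Local Notation mu := (@lebesgue_measure R).
Local Notation I01 := (`]0%R, 1%R[%classic : set R).
Local Notation N := (noise R).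

Definition signal_row n := \sum_(i < k n) eps M i ^+ 2 / kappa M i.

(** As [eps^2] is [kappa] times [eps^2 / kappa], the centering constants are negligible compared
    with the signal when [kappa] vanishes uniformly. *)
Lemma sum_eps2_le n : \sum_(i < k n) eps M i ^+ 2 <= max_eps_kappa M n * signal_row n.
Proof.
rewrite mulr_sumr; apply: ler_sum => i _.
rewrite -[leLHS](divfK (lt0r_neq0 (kappa_gt0 M i))) mulrC.
by apply: ler_wpM2r; [exact: eps2_kappa_ge0|exact: kappa_le_max].
Qed.

Definition row_drift n (i : 'I_(k n)) := drift (eps M i) (pert M i).

Lemma drift_row_le n : good_row M n ->
  \sum_(i < k n) nrm2 N (row_drift i) <=
    2 * pert_row M n + 2 * (max_eps_kappa M n * signal_row n).
Proof.
move=> good; apply: (@le_trans _ _ (\sum_(i < k n)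
    (2 * pert_sqr (eps M i) (pert M i) + 2 * eps M i ^+ 2))).
  apply: ler_sum => i _; have [_ _ rr _] := good i.
  exact: (nrm2_drift_le (measurable_pert M i) rr).
rewrite big_split/= -!mulr_sumr; apply: lerD => //.
by apply: ler_wpM2l => //; exact: sum_eps2_le.
Qed.

Variable h : R -> R.
Hypothesis Lh : L2_01 h.
Hypothesis shc : shape_cvg M h.
Local Notation g := (shape_limit h).

Definition row_residual n (i : 'I_(k n)) : R -> R :=
  residual (eps M i) (kappa M i) (hshape M i) (pert M i) g.

Definition shape_close n := forall i : 'I_(k n),
  (\int[mu]_(x in I01) ((hshape M i x - g x) ^+ 2)%:E <= (shape_dist M h n)%:E)%E.

Section good_rows.
Variable n : nat.
Hypothesis good : good_row M n.
Hypothesis close : shape_close n.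
Implicit Type i : 'I_(k n).

Let closeB i : (\int[mu]_(x in I01) ((hshape M i x - g x) ^+ 2)%:E < +oo)%E.
Proof. exact: le_lt_trans (close i) (ltry _). Qed.

Let sg := supp01_shape_limit Lh.
Let gg := shape_limit_lty Lh.

Lemma sqint_row_main i : sqint N (fun u => eps M i / kappa M i * g (u / kappa M i)).
Proof. by apply: sqint_rescaled => //; exact: kappa01. Qed.

Lemma nrm2_row_main i :
  nrm2 N (fun u => eps M i / kappa M i * g (u / kappa M i)) =
  eps M i ^+ 2 / kappa M i * l2 g.
Proof.
rewrite nrm2_rescaled//; last exact: kappa01.
by congr (_ * _); field; rewrite gt_eqF// kappa_gt0.
Qed.

Lemma sqint_row_residual i : sqint N (row_residual i).
Proof.
have [_ _ rr _] := good i.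
exact: (sqint_residual (kappa01 good i) (supp01_hshape M i) (measurable_pert M i) rr sg (closeB i)).
Qed.

Lemma row_excessE i :
  row_excess M i = (fun u => eps M i / kappa M i * g (u / kappa M i) + row_residual i u).
Proof.
have [_ _ rr _] := good i.
by apply/funext => u; apply: excess_split_residual; [exact: kappa01|exact: supp01_hshape].
Qed.

Lemma residual_row_le : \sum_(i < k n) nrm2 N (row_residual i) <=
  4 * pert_row M n + 4 * (max_eps_kappa M n * signal_row n) +
  2 * (shape_dist M h n * signal_row n).
Proof.
apply: (@le_trans _ _ (\sum_(i < k n)
    (4 * pert_sqr (eps M i) (pert M i) + 4 * eps M i ^+ 2 +
     2 * (shape_dist M h n * (eps M i ^+ 2 / kappa M i))))).
  apply: ler_sum => i _; have [_ _ rr _] := good i.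
  apply: le_trans (nrm2_residual_le (kappa01 good i) (supp01_hshape M i)
    (measurable_pert M i) rr sg (closeB i)) _.
  apply: lerD => //; apply: ler_wpM2l => //.
  rewrite [leRHS]mulrC; apply: ler_wpM2l; first exact: eps2_kappa_ge0.
  rewrite -lee_fin /l2 fineK//.
  by rewrite ge0_fin_numE//; apply: integral_ge0 => x _; rewrite lee_fin sqr_ge0.
rewrite !big_split/= -!mulr_sumr; apply: lerD => //; apply: lerD => //.
by apply: ler_wpM2l => //; exact: sum_eps2_le.
Qed.

Lemma var_row_close e : 0 < e ->
  `|\sum_(i < k n) var_y N (row_excess M i) - signal_row n * l2 g| <=
  e * (signal_row n * l2 g) +
  (e^-1 + 1) * \sum_(i < k n) nrm2 N (row_residual i).
Proof.
move=> e0; rewrite /signal_row mulr_suml -sumrB 2!mulr_sumr -big_split/=.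
apply: le_trans (ler_norm_sum _ _ _) _; apply: ler_sum => i _.
have s1 := sqint_row_main i; have s2 := sqint_row_residual i.
have H := RintegralM_perturb e0 s1 s2 s1 s2.
have E1 : \int[N]_u ((eps M i / kappa M i * g (u / kappa M i)) *
    (eps M i / kappa M i * g (u / kappa M i))) = eps M i ^+ 2 / kappa M i * l2 g.
  by rewrite -nrm2_row_main; apply: eq_Rintegral => u _; rewrite expr2.
have E2 : var_y N (row_excess M i) =
    \int[N]_u ((eps M i / kappa M i * g (u / kappa M i) + row_residual i u) *
      (eps M i / kappa M i * g (u / kappa M i) + row_residual i u)).
  by rewrite /var_y row_excessE; apply: eq_Rintegral => u _; rewrite expr2.
rewrite E2; rewrite E1 nrm2_row_main in H; apply: (le_trans H).
by set a := _ * l2 g; set b := nrm2 _ _; set c := e^-1; lra.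
Qed.

Lemma trunc_row_le b : (forall i, eps M i / kappa M i <= b) ->
  \sum_(i < k n) trunc_y N (row_excess M i) <=
  8 * (signal_row n * l2_trunc g b) + 4 * \sum_(i < k n) nrm2 N (row_residual i).
Proof.
move=> ab; rewrite mulr_suml !mulr_sumr -big_split/=; apply: ler_sum => i _.
rewrite row_excessE.
apply: le_trans (trunc_yD_le (sqint_row_main i) (sqint_row_residual i)) _.
apply: lerD => //; apply: ler_wpM2l => //.
have -> : eps M i ^+ 2 / kappa M i = (eps M i / kappa M i) ^+ 2 * kappa M i.
  by field; rewrite gt_eqF// kappa_gt0.
by apply: trunc_y_rescaled_le => //; [exact: kappa01|rewrite eps_kappa_ge0/=].
Qed.

End good_rows.

Lemma near_shape_close : \forall n \near \oo, shape_close n.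
Proof. exact: near_shape_dist. Qed.

Section finite_signal.
Variable K : R.
Hypothesis signalK : signal_row n @[n --> \oo] --> K.

Lemma max_eps_kappa_signal_cvg0 :
  max_eps_kappa M n * signal_row n @[n --> \oo] --> 0.
Proof. by rewrite -(mul0r K); apply: cvgM => //; exact: eps_kappa_cvg0. Qed.

Lemma drift_row_cvg0 : \sum_(i < k n) nrm2 N (row_drift i) @[n --> \oo] --> 0.
Proof.
apply: (@squeeze_cvgr _ _ _ _ (cst 0)
  (fun n => 2 * pert_row M n + 2 * (max_eps_kappa M n * signal_row n))).
- near=> n; apply/andP; split; first by apply: sumr_ge0 => i _; exact: nrm2_ge0.
  by apply: drift_row_le; near: n; exact: near_good_row shc.
- exact: cvg_cst.
- rewrite -[X in _ --> X]addr0 -{1}(mulr0 2) -{2}(mulr0 2).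
  apply: cvgD; apply: cvgMl_tmp; first exact: pert_row_cvg0.
  exact: max_eps_kappa_signal_cvg0.
Unshelve. all: by end_near.
Qed.

Lemma residual_row_cvg0 : \sum_(i < k n) nrm2 N (row_residual i) @[n --> \oo] --> 0.
Proof.
apply: (@squeeze_cvgr _ _ _ _ (cst 0)
  (fun n => 4 * pert_row M n + 4 * (max_eps_kappa M n * signal_row n) +
     2 * (shape_dist M h n * signal_row n))).
- near=> n; apply/andP; split; first by apply: sumr_ge0 => i _; exact: nrm2_ge0.
  apply: residual_row_le; near: n; first exact: near_good_row shc.
  exact: near_shape_close.
- exact: cvg_cst.
- rewrite (_ : 0 = 4 * 0 + 4 * 0 + 2 * (0 * K)); last by rewrite mul0r !mulr0 !addr0.
  apply: cvgD; first apply: cvgD.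
  + by apply: cvgMl_tmp; exact: pert_row_cvg0.
  + by apply: cvgMl_tmp; exact: max_eps_kappa_signal_cvg0.
  + by apply: cvgMl_tmp; apply: cvgM => //; exact: shape_dist_cvg0.
Unshelve. all: by end_near.
Qed.

Lemma var_row_cvg :
  \sum_(i < k n) var_y N (row_excess M i) @[n --> \oo] --> K * l2 g.
Proof.
have cS : signal_row n * l2 g @[n --> \oo] --> K * l2 g by apply: cvgMr_tmp.
have : (\sum_(i < k n) var_y N (row_excess M i) - signal_row n * l2 g) @[n --> \oo] --> 0.
  apply: cvg0_of_trade_off cS residual_row_cvg0 => e e0.
  near=> n; apply: var_row_close => //; near: n; first exact: near_good_row shc.
  exact: near_shape_close.
move=> /(cvgD cS); rewrite addr0; apply: cvg_trans; apply: near_eq_cvg.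
by apply: nearW => n /=; rewrite addrC subrK.
Unshelve. all: by end_near.
Qed.

(** The factor [eps / kappa] in front of each rescaled shape is at most [b n], so one quantity
    [l2_trunc g (b n)] controls the whole row. *)
Lemma trunc_row_cvg0 :
  \big[Num.max/0]_(i < k n) (eps M i / kappa M i) @[n --> \oo] --> 0 ->
  \sum_(i < k n) trunc_y N (row_excess M i) @[n --> \oo] --> 0.
Proof.
pose b n : R := \big[Num.max/0]_(i < k n) (eps M i / kappa M i) => b0.
apply: (@squeeze_cvgr _ _ _ _ (cst 0) (fun n => 8 * (signal_row n * l2_trunc g (b n)) +
    4 * \sum_(i < k n) nrm2 N (row_residual i))).
- near=> n; have good : good_row M n by near: n; exact: near_good_row shc.
  apply/andP; split.
    by apply: sumr_ge0 => i _; exact: trunc_y_ge0.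
  apply: trunc_row_le => //; first by near: n; exact: near_shape_close.
  by move=> i; exact: (le_bigmax 0 (fun i : 'I_(k n) => eps M i / kappa M i) i).
- exact: cvg_cst.
- rewrite [X in _ --> X](_ : 0 = 8 * (K * 0) + 4 * 0); last by rewrite !mulr0 addr0.
  apply: cvgD; apply: cvgMl_tmp; last exact: residual_row_cvg0.
  apply: cvgM => //; apply: l2_trunc_cvg0 => //.
  + by have [] := supp01_shape_limit Lh.
  + exact: shape_limit_lty.
  + by move=> n; exact: bigmax_ge_id.
Unshelve. all: by end_near.
Qed.

End finite_signal.

End row_sums.

(** * Mass of a law at both infinities *)

Section tail_at_infinity.
Context {R : realType}.

(** The balls of the extended line are those of the distance [|contract x - contract y|]. *)
Lemma continuous_contract : continuous (@contract R).
Proof.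
move=> x; apply/cvgrPdist_lt => e e0; near=> y.
have : ball x e y by near: y; exact: (@nbhsx_ballx R _ x e e0).
by [].
Unshelve. all: by end_near.
Qed.

(** Since [contract x = x / (1 + |x|)], this is [max (0, 1 - A / (1 + |x|))] at a real [x]: a
    continuous function on [-oo, +oo] that is 1 at both ends and 0 for [|x| <= A - 1]. *)
Definition tail_fun (A : R) (x : \bar R) : R := Num.max 0 (1 - A * (1 - `|contract x|)).

Lemma continuous_tail_fun A : continuous (tail_fun A).
Proof.
move=> x; apply: (@continuous_max R (\bar R) (fun=> 0)); first exact: cvg_cst.
apply: cvgB; first exact: cvg_cst.
apply: cvgM; first exact: cvg_cst.
apply: cvgB; first exact: cvg_cst.
apply: cvg_norm; exact: continuous_contract.
Qed.

Lemma tail_fun_ge0 A x : 0 <= tail_fun A x.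
Proof. by rewrite le_max lexx. Qed.

Lemma tail_fun_le1 A x : 0 <= A -> tail_fun A x <= 1.
Proof.
move=> A0; rewrite ge_max ler01/= lerBlDr lerDl mulr_ge0// subr_ge0.
exact: contract_le1.
Qed.

Lemma tail_fun_infty A : tail_fun A -oo = 1 /\ tail_fun A +oo = 1.
Proof. by rewrite /tail_fun/= normrN1 normr1 subrr mulr0 subr0 max_r. Qed.

(** Where the left side is positive, [1 + |x| > A], and both 1 and [|x|] are at most [cosh2 x]. *)
Lemma tail_fun_EFin_le A (x : R) : 0 < A -> tail_fun A x%:E <= 2 / A * cosh2 x.
Proof.
move=> A0; have c0 := cosh2_ge0 x.
rewrite ge_max mulr_ge0//=; last by rewrite divr_ge0// ltW.
have x1 : 0 < 1 + `|x| by rewrite ltr_wpDr.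
have -> : 1 - `|x / (1 + `|x|)| = (1 + `|x|)^-1.
  rewrite normrM normfV (ger0_norm (ltW x1)).
  by move: x1; set z := `|x| => z1; field; rewrite gt_eqF.
have c1 : 1 <= cosh2 x.
  rewrite /cosh2; have [x0|x0] := leP 0 x.
    by have := expR_ge1Dx x; have := expR_ge0 (- x); lra.
  by have := expR_ge1Dx (- x); have := expR_ge0 x; lra.
have c2 := normr_le_cosh2 x.
rewrite lerBlDr -[X in X <= _](@divff _ A) ?gt_eqF//.
have [xA|xA] := leP (1 + `|x|) A.
  have : 1 <= A / (1 + `|x|) by rewrite ler_pdivlMr// mul1r.
  have : 0 <= 2 / A * cosh2 x by rewrite mulr_ge0// divr_ge0// ltW.
  rewrite divff ?gt_eqF//; lra.
have : 0 <= A / (1 + `|x|) by rewrite divr_ge0// ltW.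
have : 1 <= 2 / A * cosh2 x by rewrite mulrAC ler_pdivlMr//; lra.
rewrite divff ?gt_eqF//; lra.
Qed.

Lemma infty_le_tail_fun (xi : probability (\bar R) R) A : 0 <= A ->
  (xi [set -oo; +oo] <= \int[xi]_x (tail_fun A x)%:E)%E.
Proof.
move=> A0.
have mS : measurable ([set -oo; +oo]%E : set (\bar R)).
  exact: (measurableU _ _ (emeasurable_set1 _) (emeasurable_set1 _)).
rewrite -(setIT [set -oo; +oo]%E) -integral_indic//.
have [fN fP] := tail_fun_infty A.
apply: ge0_le_integral => //.
- by apply/measurable_EFinP; exact: measurable_indic.
- by apply/measurable_EFinP; apply: measurable_continuous_ereal; exact: continuous_tail_fun.
- move=> x _; rewrite lee_fin indicE; have [xS|xS] := boolP (x \in _).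
    by move: xS; rewrite inE => -[->|->]; rewrite ?fN ?fP.
  exact: tail_fun_ge0.
Qed.

End tail_at_infinity.

(** * Undetectability and real-valued limits *)

Section theorem_parts.
Context {R : realType} {k : nat -> nat}.
Variable M : pvalue_model R k.
Local Notation mu := (@lebesgue_measure R).
Local Notation I01 := (`]0%R, 1%R[%classic : set R).
Local Notation N := (noise R).
Variable h : R -> R.
Hypothesis Lh : L2_01 h.
Hypothesis shc : shape_cvg M h.
Local Notation g := (shape_limit h).
Local Notation y i := (row_excess M i).

Lemma signal_row_cvg_fin (K : \bar R) : (0 <= K < +oo)%E ->
  ((signal_row M n)%:E @[n --> \oo] --> K)%E -> signal_row M n @[n --> \oo] --> fine K.
Proof.
move=> /andP[K0 Koo]; rewrite -(@fineK _ K) ?ge0_fin_numE//.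
by move=> /fine_cvgP[_].
Qed.

Lemma undetectable_of_signal0 : signal_row M n @[n --> \oo] --> 0 ->
  undetectable (P_ R k) (Q_ M).
Proof.
move=> s0 psi mpsi psi01; rewrite unlock.
pose u n := (\int[P_ R k n]_x (psi n x)%:E + \int[Q_ M n]_x (1 - psi n x)%:E)%E.
pose V n := \sum_(i < k n) var_y N (y i).
have V0 : V n @[n --> \oo] --> 0.
  by rewrite -[X in _ --> X](mul0r (l2 g)); exact: var_row_cvg.
have u_le e n : good_row M n -> 0 < e -> exists2 r, u n = r%:E &
    `|r - 1| <= e + e^-1 * (expR (V n) - 1).
  move=> good e0; apply: Rintegral_testing_errorB1_le => //.
  - exact: measurable_row_excess.
  - exact: row_excess_ge.
  - exact: obsE.
  - by move=> i; have [] := sqint_row_excess good i.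
  - exact: mpsi.
suff : u n @[n --> \oo] --> 1%E by [].
apply: cvg_EFin.
  near=> n; have good : good_row M n by near: n; exact: near_good_row shc.
  by have [r ->] := u_le 1 n good ltr01.
apply/subr_cvg0.
have bV : expR (V n) - 1 @[n --> \oo] --> 0.
  rewrite -[X in _ --> X](subrr 1); apply: cvgB; last exact: cvg_cst.
  by rewrite -[X in _ --> X]expR0; apply: cvg_comp V0 _; exact: continuous_expR.
have a1 : (fun=> 1 : R) n @[n --> \oo] --> (1 : R) by exact: cvg_cst.
apply: cvg0_of_trade_off a1 bV => e e0; near=> n.
have good : good_row M n by near: n; exact: near_good_row shc.
have [r ur re] := u_le e n good e0; rewrite /comp ur /=; apply: le_trans re _.
have : 0 <= expR (V n) - 1.
  by rewrite subr_ge0 -[leLHS]expR0 ler_expR; apply: sumr_ge0 => i _; exact: var_y_ge0.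
by set w := _ - 1 => w0; rewrite mulr1 mulrDl mul1r; lra.
Unshelve. all: by end_near.
Qed.

(* By independence this bounds the null expectation of [expR (- S)], [S] being the
   log-likelihood ratio; that of [expR S] is 1. *)
Definition tight_row W n := exists2 w : 'I_(k n) -> R,
  forall i, (\int[N]_x ((1 + y i x)^-1)%:E <= (1 + w i)%:E)%E
  & \sum_(i < k n) w i <= W.

Section real_valued_limits.
Variable W : R.
Hypothesis tight : \forall n \near \oo, tight_row W n.

(** By weak convergence the mass at infinity is at most the limit of the means of [tail_fun A],
    which the exponential moments bound by [C / A]; then [A] is taken arbitrarily large. *)
Lemma real_valued_limit (s : nat -> nat) (xi : probability (\bar R) R) :
  {homo s : m n / (m < n)%N} ->
  weak_cvg (fun n => distribution (P_ R k (s n)) (T_ M (s n))) xi ->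
  xi [set -oo%E; +oo%E] = 0%E.
Proof.
move=> smono xi_cvg.
(* What holds for all large [n] also holds eventually along [s], because a strictly increasing [s]
   dominates the identity. *)
have s_ge n : (n <= s n)%N.
  by elim: n => // n IH; apply: leq_ltn_trans IH _; exact: smono.
have s_near (P : nat -> Prop) : (\forall n \near \oo, P n) ->
    \forall n \near \oo, P (s n).
  by move=> [n0 _ Pn]; exists n0 => // n n0n; apply: Pn; exact: leq_trans n0n (s_ge n).
pose C := 2 * (1 + expR W).
have C0 : 0 < C by rewrite mulr_gt0// addr_gt0// expR_gt0.
have good_s := s_near _ (near_good_row Lh shc).
have tight_s := s_near _ tight.
have xi_le A : 0 < A -> (xi [set -oo%E; +oo%E] <= (C / A)%:E)%E.
  move=> A0; apply: le_trans (infty_le_tail_fun xi (ltW A0)) _.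
  have cf := @continuous_tail_fun R A.
  have bf : bounded_fun (tail_fun A).
    exists 1; split; first exact: num_real.
    move=> z z1 x _ /=; rewrite ger0_norm ?tail_fun_ge0//.
    by apply: le_trans (ltW z1); apply: tail_fun_le1; exact: ltW.
  apply: (cvge_to_le (xi_cvg _ cf bf)).
  near=> n.
  have good : good_row M (s n) by near: n; exact: good_s.
  have [w wP wW] : tight_row W (s n) by near: n; exact: tight_s.
  have my : forall i : 'I_(k (s n)), measurable_fun [set: measurableTypeR R] (y i).
    exact: measurable_row_excess.
  have mf := measurable_continuous_ereal cf.
  rewrite ge0_integral_distribution/=; last 2 first.
  - exact/measurable_EFinP.
  - by move=> x; rewrite lee_fin tail_fun_ge0.
  have := integral_loglr_continuous my (row_excess_ge good) (@obsE R k M (s n)) false cf.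
  rewrite /comp => ->.
  have mS := measurable_row_loglr my.
  have mc : measurable_fun [set: (k (s n)).-tuple (measurableTypeR R)]
      (fun x => (cosh2 (row_loglr (fun i : 'I_(k (s n)) => y i) x))%:E).
    by apply/measurable_EFinP; exact: (measurableT_comp measurable_cosh2 mS).
  apply: (@le_trans _ _ (\int[P_ R k (s n)]_x
    ((2 / A)%:E * (cosh2 (row_loglr (fun i : 'I_(k (s n)) => y i) x))%:E))%E).
    apply: ge0_le_integral => //.
    + by move=> x _; rewrite lee_fin tail_fun_ge0.
    + by apply/measurable_EFinP; exact: (measurableT_comp (measurable_ereal_EFin cf) mS).
    + exact: measurable_funeM.
    + by move=> x _; rewrite -EFinM lee_fin tail_fun_EFin_le.
  rewrite ge0_integralZl//; last 2 first.
  - by move=> x _; rewrite lee_fin cosh2_ge0.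
  - by rewrite lee_fin divr_ge0// ltW.
  apply: (@le_trans _ _ ((2 / A)%:E * (1 + expR (\sum_(i < k (s n)) w i))%:E)%E).
    apply: lee_wpmul2l; first by rewrite lee_fin divr_ge0// ltW.
    exact: (integral_cosh2_row_loglr_le my (row_excess_ge good) (@obsE R k M (s n)) wP).
  rewrite -EFinM lee_fin /C mulrAC; apply: ler_wpM2r; first by rewrite invr_ge0 ltW.
  by apply: ler_wpM2l => //; rewrite lerD2l ler_expR.
apply/eqP; rewrite eq_le measure_ge0 andbT; apply/lee_addgt0Pr => e e0.
rewrite add0e; apply: le_trans (xi_le (C / e) _) _; first exact: divr_gt0.
by rewrite lee_fin invf_div mulrCA divff ?mulr1// gt_eqF.
Unshelve. all: by end_near.
Qed.

End real_valued_limits.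

(** From [y >= - eps] and [eps <= 1/2] follows [(1 + y)^-1 <= 1 + 2 * eps] pointwise. No second
    moment enters, so the sum of [eps^2 / kappa] may diverge. *)
Lemma tight_of_sum_eps B : (forall n, \sum_(i < k n) eps M i <= B) ->
  \forall n \near \oo, tight_row (2 * B) n.
Proof.
move=> eB; near=> n; have good : good_row M n by near: n; exact: near_good_row shc.
exists (fun i => 2 * eps M i).
- move=> i; have mi := measurable_invr_1Dy (measurable_row_excess M i) (row_excess_ge good i).
  have y1 x : 0 < 1 + y i x by have := row_excess_ge good i x; lra.
  apply: (@le_trans _ _ (\int[N]_x (1 + 2 * eps M i)%:E)%E).
    apply: ge0_le_integral => //.
    + by move=> x _; rewrite lee_fin invr_ge0 ltW.
    + exact/measurable_EFinP.
    + move=> x _; rewrite lee_fin -[leLHS]mul1r ler_pdivrMr//.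
      have [e2 _ _ _] := good i; have := row_excess_geN M i x; have := eps_ge0 M i.
      by nra.
  rewrite integral_cst// [X in (_ * X)%E](_ : _ = 1%E) ?mule1//.
  exact: (@probability_setT _ _ _ N).
- by rewrite -mulr_sumr; apply: ler_wpM2l.
Unshelve. all: by end_near.
Qed.

Lemma tight_of_signal (K : R) : signal_row M n @[n --> \oo] --> K ->
  \forall n \near \oo, tight_row (2 * (K * l2 g + 1)) n.
Proof.
move=> sK; near=> n; have good : good_row M n by near: n; exact: near_good_row shc.
exists (fun i => 2 * var_y N (y i)).
- move=> i; apply: integral_invr_1Dy_le; first exact: measurable_row_excess.
  + exact: row_excess_ge.
  + exact: obsE.
  + by have [] := sqint_row_excess good i.
- rewrite -mulr_sumr; apply: ler_wpM2l => //; apply: ltW; near: n.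
  by apply: (cvgr_lt (K * l2 g)); [exact: var_row_cvg|rewrite ltrDl].
Unshelve. all: by end_near.
Qed.

End theorem_parts.

Lemma integrable_hellinger d (T : measurableType d) (R : realType)
    (N Q : probability T R) (y : T -> R) :
  measurable_fun [set: T] y -> (forall x, - 2^-1 <= y x) ->
  (forall A, measurable A -> (Q A = \int[N]_(x in A) (1 + y x)%:E)%E) ->
  N.-integrable [set: T] (EFin \o (fun x => (expR (ln (1 + y x) / 2) - 1) ^+ 2)).
Proof.
move=> my y_ge QE.
have int1 := integrable_scale 2 (integrable_1Dy my y_ge QE).
have int2 : N.-integrable [set: T] (EFin \o cst (2 : R)).
  exact: finite_measure_integrable_cst.
apply: (le_integrable measurableT _ _ (integrable_add int1 int2)) => /=.
  apply/measurable_EFinP; apply: measurable_funX; apply: measurable_funB => //.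
  apply: measurableT_comp => //; apply: measurable_funM => //.
  exact: measurable_ln1Dy.
move=> x _; have y1 : 0 < 1 + y x by have := y_ge x; lra.
have sE : expR (ln (1 + y x) / 2) ^+ 2 = 1 + y x.
  by rewrite expr2 -expRD -splitr lnK// posrE.
rewrite lee_fin ger0_norm ?sqr_ge0// ger0_norm; last lra.
move: sE; set s := expR _ => sE; have := sqr_ge0 (s + 1); lra.
Qed.

(** * Complete detection and asymptotic normality *)

Section detection_and_normality.
Context {R : realType} {k : nat -> nat}.
Variable M : pvalue_model R k.
Local Notation mu := (@lebesgue_measure R).
Local Notation I01 := (`]0%R, 1%R[%classic : set R).
Local Notation N := (noise R).
Variable h : R -> R.
Hypothesis Lh : L2_01 h.
Hypothesis shc : shape_cvg M h.
Local Notation g := (shape_limit h).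
Local Notation y i := (row_excess M i).

(* A probability density on ]0, 1[ has L2 norm at least 1. *)
Lemma l2_shape_limit_ge : (forall n, (0 < k n)%N) -> 2^-1 <= l2 g.
Proof.
move=> k_gt0; rewrite leNgt; apply/negP => g2.
(* If [l2 g] were below 1/2, the bound [2 * l2 g + 2 * shape_dist] on [\int h_i^2] would fall below
   1, whereas [2 * h_i <= 1 + h_i^2] and [\int h_i = 1] force this integral to be at least 1. *)
have d1 : \forall n \near \oo, shape_dist M h n < (1 - 2 * l2 g) / 2.
  by apply: (cvgr_lt 0); [exact: shape_dist_cvg0|lra].
near \oo => n; have i : 'I_(k n) by exact: (Ordinal (k_gt0 n)).
have dn : shape_dist M h n < (1 - 2 * l2 g) / 2 by near: n.
have cl : shape_close M h n by near: n; exact: near_shape_close.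
have [mh h0] := supp01_hshape M i.
have mI : measurable I01 by exact: measurable_itv.
have mhI : measurable_fun I01 (hshape M i) by exact: measurable_funS mh.
have sh := supp01_hshape M i; have sg := supp01_shape_limit Lh.
have le2 := l2_add_le sg (supp01B sh sg).
have muI : mu I01 = 1%E.
  by rewrite (lebesgue_measure_itv `]0%R, 1%R[) /= lte01 oppr0 adde0.
have : (2%:E * \int[mu]_(x in I01) (hshape M i x)%:E <=
    1 + \int[mu]_(x in I01) (hshape M i x ^+ 2)%:E)%E.
  have -> : (1%E = \int[mu]_(x in I01) (1 : R)%:E)%E.
    by rewrite integral_cst// [X in (_ * X)%E](_ : _ = 1%E) ?mule1//; exact: muI.
  rewrite -ge0_integralZl//; last 2 first.
  - exact/measurable_EFinP.
  - by move=> x _; rewrite lee_fin hshape_ge0.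
  rewrite -ge0_integralD//; last 2 first.
  - by move=> x _; rewrite lee_fin sqr_ge0.
  - by apply/measurable_EFinP; exact: measurable_funX.
  apply: ge0_le_integral => //.
  - by move=> x _; rewrite -EFinM lee_fin mulr_ge0// hshape_ge0.
  - by apply: measurable_funeM; exact/measurable_EFinP.
  - by apply: emeasurable_funD => //; apply/measurable_EFinP; exact: measurable_funX.
  - move=> x _; rewrite -EFinM -EFinD lee_fin.
    by have := sqr_ge0 (hshape M i x - 1); lra.
rewrite hshape_int mule1 => le1.
have : (2%:E <= 1 + (2%:E * (l2 g)%:E + 2%:E * (shape_dist M h n)%:E))%E.
  apply: le_trans le1 _; apply: leeD => //.
  move: le2; under eq_integral do rewrite addrC subrK.
  move=> /le_trans; apply; apply: leeD.
    rewrite /l2 fineK// ge0_fin_numE ?shape_limit_lty//.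
    by apply: integral_ge0 => x _; rewrite lee_fin sqr_ge0.
  by apply: lee_wpmul2l => //; exact: cl.
rewrite -!EFinM -!EFinD lee_fin; lra.
Unshelve. all: by end_near.
Qed.

Lemma asymptotic_normal_of_signal (K : R) : 0 < K -> 0 < l2 g ->
  signal_row M n @[n --> \oo] --> K ->
  \big[Num.max/0]_(i < k n) (eps M i / kappa M i) @[n --> \oo] --> 0 ->
  asymptotic_normal M (K * l2 g).
Proof.
move=> K0 g0 sK a0.
(* The limit theorem for rows asks that all of them be good; dropping the first [n0] does not change
   the limits. *)
have [n0 _ good0] := near_good_row Lh shc.
have good n : good_row M (n + n0) by apply: good0; exact: leq_addl.
pose v := K * l2 g; have v0 : 0 < v by exact: mulr_gt0.
have V_cvg : \sum_(i < k (n + n0)) var_y N (y i) @[n --> \oo] --> v.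
  by have := var_row_cvg Lh shc sK; rewrite -(cvg_shiftn n0).
have t_cvg : \sum_(i < k (n + n0)) trunc_y N (y i) @[n --> \oo] --> 0.
  by have := trunc_row_cvg0 Lh shc sK a0; rewrite -(cvg_shiftn n0).
have H (q : bool) := @weak_cvg_loglr _ _ R N (fun n => k (n + n0)%N)
  (fun n i => row_excess M i) (fun n i => obs M i)
  (fun n => @measurable_row_excess R k M (n + n0)%N)
  (fun n => row_excess_ge (good n)) (fun n => @obsE R k M (n + n0)%N)
  (fun n i => (sqint_row_excess (good n) i).2) v v0 V_cvg t_cvg q.
split => f cf bf.
- rewrite -(cvg_shiftn n0); have := H false f cf bf.
  by rewrite (_ : (2 * false%:R - 1) * v / 2 = - v / 2)// mulr0 sub0r mulN1r.
- rewrite -(cvg_shiftn n0); have := H true f cf bf.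
  by rewrite (_ : (2 * true%:R - 1) * v / 2 = v / 2)//; congr (_ / 2); rewrite (_ : true%:R = 1 :> R)//; lra.
Qed.

Local Notation a i := (eps M i / kappa M i).
Local Notation weight i := (kappa M i * Num.min (a i ^+ 2) (a i)).

Lemma weight_ge0 n (i : 'I_(k n)) : 0 <= weight i.
Proof.
by rewrite mulr_ge0 ?(ltW (kappa_gt0 _ _))// le_min sqr_ge0 eps_kappa_ge0.
Qed.

(** [weight i] is the smaller of [eps^2 / kappa] and [eps]. As [eps / kappa] is monotone, if its
    value at [r] is at most 1 the first is attained for all [i <= r], otherwise the second for all
    [i >= r]. *)
Lemma sum_weight_ge n (r : 'I_(k n)) :
  (forall i j : 'I_(k n), (i <= j)%N -> a i <= a j) ->
  Num.min (\sum_(i < k n | (r <= i)%N) eps M i)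
    (\sum_(i < k n | (i <= r)%N) eps M i ^+ 2 / kappa M i) <=
  \sum_(i < k n) weight i.
Proof.
move=> a_mono; rewrite ge_min; apply/orP.
have kn0 (i : 'I_(k n)) : kappa M i != 0 by rewrite gt_eqF// kappa_gt0.
have [ar|ar] := leP (a r) 1; [right|left].
- rewrite big_mkcond; apply: ler_sum => i _; case: ifP => [ir|_]; last exact: weight_ge0.
  have a1 : a i <= 1 by apply: le_trans ar; exact: a_mono.
  rewrite min_l; last by rewrite expr2 ler_piMl// eps_kappa_ge0.
  by rewrite le_eqVlt; apply/orP; left; apply/eqP; field.
- rewrite big_mkcond; apply: ler_sum => i _; case: ifP => [ir|_]; last exact: weight_ge0.
  have a1 : 1 <= a i by apply: le_trans (ltW ar) _; exact: a_mono.
  rewrite min_r; last by rewrite expr2 ler_peMl// eps_kappa_ge0.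
  by rewrite le_eqVlt; apply/orP; left; apply/eqP; field.
Qed.

Lemma sum_hellinger_ge n : good_row M n ->
  (forall i : 'I_(k n), (\int[mu]_(u in I01) (hshape M i u ^+ 2)%:E <=
    (2 * l2 g + 2)%:E)%E) ->
  (\sum_(i < k n) weight i) / (576 * (2 * l2 g + 2)) - pert_row M n <=
  \sum_(i < k n) hellinger_y N (y i).
Proof.
move=> good hC; rewrite lerBlDr /pert_row mulr_suml -big_split/=; apply: ler_sum => i _.
have C0 : 0 < 2 * l2 g + 2 by have := l2_ge0 g; lra.
have [e2 k4 rr hh] := good i.
apply: hellinger_ge => //.
- by rewrite eps_ge0.
- exact: kappa_gt0.
- exact: supp01_hshape.
- exact: hshape_ge0.
- exact: hshape_int.
- exact: measurable_pert.
- exact: density_ge0.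
- rewrite -lee_fin /l2 fineK//.
  by rewrite ge0_fin_numE//; apply: integral_ge0 => x _; rewrite lee_fin sqr_ge0.
- apply: integrable_hellinger; [exact: measurable_row_excess|exact: row_excess_ge|].
  exact: obsE.
Qed.

Let pos : set (\bar R) := [set t | 0%:E < t]%E.

Let mpos : measurable pos.
Proof.
rewrite (_ : pos = [set` `]0%:E, +oo[%E]); first exact: emeasurable_itv.
by apply/seteqP; split => t /=; rewrite in_itv/= andbT.
Qed.

Lemma lr_testing_error_le n : good_row M n ->
  (\int[P_ R k n]_x (\1_[set w | 0%:E < T_ M n w]%E x)%:E +
   \int[Q_ M n]_x (1 - \1_[set w | 0%:E < T_ M n w]%E x)%:E <=
   (expR (- (\sum_(i < k n) hellinger_y N (y i)) / 2))%:E)%E.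
Proof.
move=> good.
have my : forall i : 'I_(k n), measurable_fun [set: measurableTypeR R] (y i).
  exact: measurable_row_excess.
have posE x : \1_pos (row_loglr (fun i : 'I_(k n) => y i) x)%:E =
    \1_[set x | 0 < row_loglr (fun i : 'I_(k n) => y i) x] x :> R.
  by rewrite !indicE; congr (_%:R); apply/idP/idP; rewrite !inE /= lte_fin.
have mF1 : measurable_fun [set: \bar R] (fun t : \bar R => (\1_pos t : R)%:E).
  by apply/measurable_EFinP; exact: measurable_indic.
have mF2 : measurable_fun [set: \bar R] (fun t : \bar R => (1 - \1_pos t : R)%:E).
  by apply/measurable_EFinP; apply: measurable_funB => //; exact: measurable_indic.
have F1 t : (0 <= (\1_pos t : R)%:E)%E by rewrite lee_fin.
have F2 t : (0 <= (1 - \1_pos t : R)%:E)%E.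
  by rewrite lee_fin indicE subr_ge0; case: (_ \in _).
have E1 := ge0_integral_loglr my (row_excess_ge good) (@obsE R k M n) false mF1 F1.
have E2 := ge0_integral_loglr my (row_excess_ge good) (@obsE R k M n) true mF2 F2.
have -> : (\int[P_ R k n]_x (\1_[set w | 0%:E < T_ M n w]%E x)%:E =
    \int[P_ R k n]_x (\1_[set x | 0 < row_loglr (fun i : 'I_(k n) => y i) x] x)%:E)%E.
  by apply: etrans E1 _; apply: eq_integral => x _; rewrite posE.
have -> : (\int[Q_ M n]_x (1 - \1_[set w | 0%:E < T_ M n w]%E x)%:E =
    \int[Q_ M n]_x (1 - \1_[set x | 0 < row_loglr (fun i : 'I_(k n) => y i) x] x)%:E)%E.
  by apply: etrans E2 _; apply: eq_integral => x _; rewrite posE.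
have := testing_error_le_affinity my (row_excess_ge good) (@obsE R k M n).
move=> /le_trans; apply; rewrite mulNr mulr_suml -sumrN; apply: prode_le_expR_sum => i.
  by apply: integral_ge0 => x _; rewrite lee_fin expR_ge0.
exact: (affinity_le_hellinger (my i) (row_excess_ge good i) (@obsE R k M n i)).
Qed.

(** Affinities multiply, so the errors sum to at most [expR] of minus half the sum of the Hellinger
    distances; this sum is at least that of the weights divided by [C], minus [pert_row], which is
    eventually below 1. *)
Lemma detectable_of_weights :
  \sum_(i < k n) weight i @[n --> \oo] --> +oo ->
  completely_detectable (P_ R k) (Q_ M) (T_ M).
Proof.
move=> w_oo; exists (fun=> 0); rewrite unlock.
have C0 : 0 < 576 * (2 * l2 g + 2) by have := l2_ge0 g; lra.
set C := 576 * _ in C0.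
apply: (@squeeze_cvge _ _ _ _ (cst 0%E) _
  (fun n => (expR (- ((\sum_(i < k n) weight i) / C - 1) / 2))%:E)).
- near=> n.
  have good : good_row M n by near: n; exact: near_good_row shc.
  have p1 : pert_row M n < 1.
    by near: n; apply: (cvgr_lt 0) => //; exact: pert_row_cvg0.
  apply/andP; split.
    apply: adde_ge0; apply: integral_ge0 => x _; rewrite lee_fin//.
    by rewrite /= indicE subr_ge0; case: (_ \in _).
  apply: le_trans (lr_testing_error_le good) _; rewrite lee_fin ler_expR.
  have : (\sum_(i < k n) weight i) / C - pert_row M n <=
      \sum_(i < k n) hellinger_y N (y i).
    apply: sum_hellinger_ge => //; near: n; exact: near_l2_hshape shc.
  by lra.
- exact: cvg_cst.
- apply: cvg_EFin; first exact: nearW.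
  apply/cvgr0Pnorm_le => e e0 /=.
  (* This crude bound suffices, no rate being claimed. *)
  have bnd (X : R) : 0 < X -> expR (- X) <= X^-1.
    move=> X0; rewrite expRN lef_pV2 ?posrE ?expR_gt0//.
    by have := expR_ge1Dx X; lra.
  near=> n; rewrite /comp/= ger0_norm ?expR_ge0//.
  (* Solves [(W / C - 1) / 2 >= e^-1] for the sum [W] of the weights. *)
  have wn : C * (2 * e^-1 + 1) <= \sum_(i < k n) weight i.
    by near: n; move/cvgryPge : w_oo; exact.
  have ei : 0 < e^-1 by rewrite invr_gt0.
  have X1 : e^-1 <= ((\sum_(i < k n) weight i) / C - 1) / 2.
    rewrite ler_pdivlMr// lerBrDr ler_pdivlMr//; rewrite mulrC in wn; lra.
  rewrite mulNr; apply: le_trans (bnd _ (lt_le_trans ei X1)) _.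
  by rewrite -[leRHS]invrK lef_pV2 ?posrE// (lt_le_trans ei X1).
Unshelve. all: by end_near.
Qed.

End detection_and_normality.

(** * Covariances of the signal densities *)

Section covariance_of_densities.
Context {R : realType}.
Local Notation mu := (@lebesgue_measure R).
Local Notation I01 := (`]0%R, 1%R[%classic : set R).
Local Notation N := (noise R).

Section density.
Variables (e k : R) (h r : R -> R) (S : probability (measurableTypeR R) R).
Hypothesis e0 : e != 0.
Hypothesis mh : measurable_fun [set: R] h.
Hypothesis mr : measurable_fun I01 r.
Hypothesis dens0 : forall u, u \in `]0, 1[%R -> 0 <= k^-1 * h (u / k) + r u.
Hypothesis SE : forall A : set (measurableTypeR R), measurable A ->
  (S A = \int[mu]_(u in A `&` I01) (k^-1 * h (u / k) + r u)%:E)%E.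

Local Notation y := (excess e k h r).

(** The signal density read off the excess, equal to 1 off ]0, 1[; the division is meaningful
    because [e != 0]. *)
Let f u := 1 + y u / e.

Let mf : measurable_fun [set: R] f.
Proof. by apply: measurable_funD => //; apply: measurable_funM => //; exact: measurable_excess. Qed.

Let fE u : I01 u -> f u = k^-1 * h (u / k) + r u.
Proof. by move=> uI; rewrite /f excessE// mulrAC divff// mul1r addrC subrK. Qed.

Let f0 u : 0 <= f u.
Proof.
have [uI|uI] := pselect (I01 u); first by rewrite fE// dens0.
by rewrite /f /excess patchE memNset// mul0r addr0.
Qed.

Let signal_density (A : set (measurableTypeR R)) : measurable A ->
  (S A = \int[N]_(x in A) (f x)%:E)%E.
Proof.
move=> mA; rewrite SE// integral_noise_in//; last exact/measurable_EFinP.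
by apply: eq_integral => u; rewrite inE => -[_ uI]; rewrite fE.
Qed.

Let integral_f : (\int[N]_x (f x)%:E = 1)%E.
Proof. by rewrite -signal_density// probability_setT. Qed.

Let integrable_f : N.-integrable [set: measurableTypeR R] (EFin \o f).
Proof.
by apply: ge0_integrable_lty => //; rewrite integral_f ltry.
Qed.

Definition signal_dens := fine \o dens S N.

Lemma measurable_signal_dens : measurable_fun [set: measurableTypeR R] signal_dens.
Proof. by apply: measurableT_comp; [exact: measurable_realfun.fine_measurable|exact: measurable_dens]. Qed.

Lemma ae_signal_dens :
  ae_eq N [set: measurableTypeR R] signal_dens (fun u => 1 + y u / e).
Proof.
have := ae_eq_Radon_Nikodym_density integrable_f signal_density.
by apply: filterS => x /= H _; rewrite /signal_dens /= /dens H.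
Qed.

Lemma expectation_signal_dens : ('E_N[signal_dens] = 1)%E.
Proof.
rewrite unlock -integral_f; apply: ae_eq_integral => //.
- by apply/measurable_EFinP; exact: measurable_signal_dens.
- exact/measurable_EFinP.
- by apply: filterS ae_signal_dens => x H _; rewrite /= H.
Qed.

End density.

Lemma covariance_ae_eq d (T : measurableType d) (P : probability T R)
    (X Y u v : T -> R) (a b : R) : a != 0 -> b != 0 ->
  measurable_fun [set: T] X -> measurable_fun [set: T] Y ->
  measurable_fun [set: T] u -> measurable_fun [set: T] v ->
  ('E_P[X] = 1)%E -> ('E_P[Y] = 1)%E ->
  ae_eq P [set: T] X (fun x => 1 + u x / a) ->
  ae_eq P [set: T] Y (fun x => 1 + v x / b) ->
  P.-integrable [set: T] (EFin \o (fun x => u x * v x)) ->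
  ((a * b)%:E * covariance P X Y = (\int[P]_x (u x * v x))%:E)%E.
Proof.
move=> a0 b0 mX mY mu_ mv EX EY aeX aeY intuv.
have cE : (covariance P X Y = \int[P]_x ((a * b)^-1 * (u x * v x))%:E)%E.
  rewrite covariance.unlock EX EY /= unlock; apply: ae_eq_integral => //.
  - by apply/measurable_EFinP; apply: measurable_funM; apply: measurable_funB.
  - by apply/measurable_EFinP; apply: measurable_funM => //; exact: measurable_funM.
  - apply: filterS2 aeX aeY => x HX HY _ /=; congr EFin.
    transitivity ((X x - 1) * (Y x - 1)); first by [].
    by rewrite HX// HY//; field; rewrite ?a0 ?b0.
rewrite cE; have int' := integrable_scale (a * b)^-1 intuv.
have -> : (\int[P]_x ((a * b)^-1 * (u x * v x))%:E =
    (\int[P]_x ((a * b)^-1 * (u x * v x))%R)%:E)%E.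
  by rewrite fineK//; apply: integrable_fin_num.
rewrite (RintegralZl _ measurableT intuv) -EFinM mulrA divff ?mul1r//.
by rewrite mulf_neq0.
Qed.

End covariance_of_densities.

Section row_covariances.
Context {R : realType} {k : nat -> nat}.
Variables M1 M2 : pvalue_model R k.
Local Notation mu := (@lebesgue_measure R).
Local Notation I01 := (`]0%R, 1%R[%classic : set R).
Local Notation N := (noise R).

Lemma row_excess_eps0 (M : pvalue_model R k) n (i : 'I_(k n)) x :
  eps M i = 0 -> row_excess M i x = 0.
Proof. by move=> e0; rewrite /row_excess /excess patchE e0 mul0r; case: ifP. Qed.

Lemma row_covarianceE n (i : 'I_(k n)) : good_row M1 n -> good_row M2 n ->
  ((eps M1 i * eps M2 i)%:E * covariance N
     (fine \o dens (signal M1 i) N) (fine \o dens (signal M2 i) N) =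
   (\int[N]_x (row_excess M1 i x * row_excess M2 i x))%:E)%E.
Proof.
move=> good1 good2.
(* For [eps = 0] the excess vanishes and no longer determines the signal density, whose square need
   not be integrable; both sides are 0 by the convention [0 * x = 0]. *)
have [e1|e1] := eqVneq (eps M1 i) 0.
  rewrite e1 mul0r mul0e (_ : \int[N]_x _ = \int[N]_x (cst (0 : R) x)).
    by rewrite Rintegral_cst// mul0r.
  by apply: eq_Rintegral => x _; rewrite row_excess_eps0// mul0r.
have [e2|e2] := eqVneq (eps M2 i) 0.
  rewrite e2 mulr0 mul0e (_ : \int[N]_x _ = \int[N]_x (cst (0 : R) x)).
    by rewrite Rintegral_cst// mul0r.
  by apply: eq_Rintegral => x _; rewrite [row_excess M2 i x]row_excess_eps0// mulr0.
have ED (M : pvalue_model R k) : eps M i != 0 ->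
    ('E_N[fine \o dens (signal M i) N] = 1)%E.
  move=> e0; apply: (expectation_signal_dens e0 (hshape_measurable M i)
    (measurable_pert M i) (@density_ge0 _ _ M n i) (@signalE _ _ M n i)).
have AE (M : pvalue_model R k) (e0 : eps M i != 0) := ae_signal_dens e0
  (hshape_measurable M i) (measurable_pert M i)
  (@density_ge0 _ _ M n i) (@signalE _ _ M n i).
apply: (covariance_ae_eq e1 e2) (AE M1 e1) (AE M2 e2) _.
- exact: measurable_signal_dens.
- exact: measurable_signal_dens.
- exact: measurable_row_excess.
- exact: measurable_row_excess.
- exact: ED.
- exact: ED.
- by apply: sqintM; exact: sqint_row_excess.
Qed.

Variables h1 h2 : R -> R.
Hypotheses (L1 : L2_01 h1) (L2 : L2_01 h2).
Hypotheses (shc1 : shape_cvg M1 h1) (shc2 : shape_cvg M2 h2).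

Local Notation main M i := (fun u => eps M i / kappa M i * hshape M i (u / kappa M i)).

(** Either rescaled shape vanishes beyond its own [kappa], so the integral over ]0, 1[ reduces to
    one up to the smaller [kappa], which is below 1 in a good row. *)
Lemma integral_row_mainM n (i : 'I_(k n)) : good_row M1 n -> good_row M2 n ->
  ((\int[N]_x (main M1 i x * main M2 i x))%:E =
   (eps M1 i * eps M2 i / (kappa M1 i * kappa M2 i))%:E *
     \int[mu]_(x in `]0%R, Num.min (kappa M1 i) (kappa M2 i)[)
       (hshape M1 i (x / kappa M1 i) * hshape M2 i (x / kappa M2 i))%:E)%E.
Proof.
move=> good1 good2.
have sq (M : pvalue_model R k) : good_row M n -> sqint N (main M i).
  move=> good; have [_ _ _ hh] := good i.
  by apply: sqint_rescaled hh; [exact: kappa01|exact: supp01_hshape].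
have intA := sqintM (sq _ good1) (sq _ good2).
rewrite fineK; last exact: integrable_fin_num.
pose F x := hshape M1 i (x / kappa M1 i) * hshape M2 i (x / kappa M2 i).
have mF : measurable_fun [set: R] F.
  by apply: measurable_funM; apply: (measurableT_comp (hshape_measurable _ _));
    exact: measurable_funM.
have F0 x : 0 <= F x by rewrite mulr_ge0// hshape_ge0.
set c := _ / (_ * _).
have c0 : 0 <= c by rewrite divr_ge0// mulr_ge0 ?eps_ge0// ltW// kappa_gt0.
have -> : (\int[N]_x (main M1 i x * main M2 i x)%:E = \int[N]_x (c%:E * (F x)%:E))%E.
  apply: eq_integral => x _; rewrite -EFinM; congr EFin; rewrite /c /F; field.
  by rewrite !gt_eqF ?kappa_gt0.
rewrite ge0_integralZl//; last 2 first.
- exact/measurable_EFinP.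
- by move=> x _; rewrite lee_fin.
congr (_ * _)%E; rewrite integral_noise//; last exact/measurable_EFinP.
rewrite integral_mkcond [RHS]integral_mkcond; apply: eq_integral => x _.
rewrite !patchE; case: ifPn => [xI|xI]; case: ifPn => // xm.
- have [F00|] := eqVneq (F x) 0; first by rewrite F00.
  rewrite /F mulf_eq0 negb_or => /andP[n1 n2]; exfalso; move/negP: xm; apply.
  have pos (M : pvalue_model R k) : hshape M i (x / kappa M i) != 0 ->
      0 < x < kappa M i.
    move=> nz; have : x / kappa M i \in `]0, 1[.
      by apply/negPn/negP => xn; move/eqP: nz; apply; exact: hshape_out.
    have kp := kappa_gt0 M i.
    by rewrite in_itv/= ltr_pdivrMr// mul1r pmulr_lgt0 ?invr_gt0.
  have /andP[x0 x1] := pos _ n1; have /andP[_ x2] := pos _ n2.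
  by rewrite inE/= in_itv/= x0 lt_min x1.
- exfalso; move/negP: xI; apply; move: xm; rewrite !inE/= !in_itv/= lt_min.
  move=> /and3P[x0 x1 _]; rewrite x0/=; apply: lt_le_trans x1 _.
  by have [_ k4 _ _] := good1 i; lra.
Qed.

Lemma row_cross_close n e : good_row M1 n -> good_row M2 n -> 0 < e ->
  (forall i : 'I_(k n), (\int[mu]_(u in I01) (hshape M1 i u ^+ 2)%:E <=
    (2 * l2 (shape_limit h1) + 2)%:E)%E) ->
  (forall i : 'I_(k n), (\int[mu]_(u in I01) (hshape M2 i u ^+ 2)%:E <=
    (2 * l2 (shape_limit h2) + 2)%:E)%E) ->
  `|\sum_(i < k n) \int[N]_x (row_excess M1 i x * row_excess M2 i x) -
    \sum_(i < k n) \int[N]_x (main M1 i x * main M2 i x)| <=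
  e * ((signal_row M1 n * (2 * l2 (shape_limit h1) + 2) +
        signal_row M2 n * (2 * l2 (shape_limit h2) + 2)) / 2) +
  (e^-1 + 1) * ((\sum_(i < k n) nrm2 N (row_drift M1 i) +
                 \sum_(i < k n) nrm2 N (row_drift M2 i)) / 2).
Proof.
move=> good1 good2 e0 hC1 hC2.
rewrite -sumrB /signal_row !mulr_suml -!big_split/= !mulr_suml !mulr_sumr -big_split/=.
apply: le_trans (ler_norm_sum _ _ _) _; apply: ler_sum => i _.
have sq (M : pvalue_model R k) : good_row M n -> sqint N (main M i).
  move=> good; have [_ _ _ hh] := good i.
  by apply: sqint_rescaled hh; [exact: kappa01|exact: supp01_hshape].
have sd (M : pvalue_model R k) : good_row M n -> sqint N (row_drift M i).
  by move=> good; have [_ _ rr _] := good i; exact: (sqint_drift (measurable_pert M i) rr).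
have yE (M : pvalue_model R k) : good_row M n ->
    row_excess M i = (fun u => main M i u + row_drift M i u).
  move=> good; have [_ _ rr _] := good i; apply/funext => u.
  by apply: excess_split; [exact: kappa01|exact: supp01_hshape].
have nrm (M : pvalue_model R k) C : good_row M n ->
    (\int[mu]_(u in I01) (hshape M i u ^+ 2)%:E <= C%:E)%E ->
    nrm2 N (main M i) <= eps M i ^+ 2 / kappa M i * C.
  move=> good hC; rewrite nrm2_rescaled; [|exact: kappa01|exact: supp01_hshape].
  have -> : (eps M i / kappa M i) ^+ 2 * kappa M i = eps M i ^+ 2 / kappa M i.
    by field; rewrite gt_eqF// kappa_gt0.
  apply: ler_wpM2l; first exact: eps2_kappa_ge0.
  rewrite -lee_fin /l2 fineK// ge0_fin_numE ?(le_lt_trans hC) ?ltry//.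
  by apply: integral_ge0 => x _; rewrite lee_fin sqr_ge0.
have := RintegralM_perturb e0 (sq _ good1) (sd _ good1) (sq _ good2) (sd _ good2).
rewrite !yE// => /le_trans; apply.
have n1 := nrm M1 _ good1 (hC1 i); have n2 := nrm M2 _ good2 (hC2 i).
apply: (@le_trans _ _ (e * ((nrm2 N (main M1 i) + nrm2 N (main M2 i)) / 2) +
  (e^-1 + 1) * ((nrm2 N (row_drift M1 i) + nrm2 N (row_drift M2 i)) / 2))).
  set a1 := nrm2 N (main M1 i); set a2 := nrm2 N (main M2 i).
  by set b1 := nrm2 N _; set b2 := nrm2 N (row_drift M2 i); set c := e^-1; lra.
apply: lerD => //; apply: ler_wpM2l; first exact: ltW.
by apply: ler_wpM2r; [rewrite invr_ge0|exact: lerD].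
Qed.

Variables (K1 K2 Gamma : R).
Hypothesis s1 : signal_row M1 n @[n --> \oo] --> K1.
Hypothesis s2 : signal_row M2 n @[n --> \oo] --> K2.
Hypothesis GammaE : (\sum_(i < k n)
    (eps M1 i * eps M2 i / (kappa M1 i * kappa M2 i))%:E *
    \int[mu]_(x in `]0%R, Num.min (kappa M1 i) (kappa M2 i)[)
      (hshape M1 i (x / kappa M1 i) * hshape M2 i (x / kappa M2 i))%:E)%E
  @[n --> \oo] --> Gamma%:E.

Lemma row_cross_cvg :
  \sum_(i < k n) \int[N]_x (row_excess M1 i x * row_excess M2 i x)
    @[n --> \oo] --> Gamma.
Proof.
pose A n := \sum_(i < k n) \int[N]_x (main M1 i x * main M2 i x).
have AG : A n @[n --> \oo] --> Gamma.
  have /fine_cvgP[_] := GammaE; apply: cvg_trans; apply: near_eq_cvg; near=> n.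
  have good1 : good_row M1 n by near: n; exact: near_good_row shc1.
  have good2 : good_row M2 n by near: n; exact: near_good_row shc2.
  rewrite /comp -[A n]/(fine (A n)%:E) /A -sumEFin; congr fine.
  by apply: eq_bigr => i _; rewrite integral_row_mainM.
have d0 : (\sum_(i < k n) nrm2 N (row_drift M1 i) +
    \sum_(i < k n) nrm2 N (row_drift M2 i)) / 2 @[n --> \oo] --> 0.
  rewrite [X in _ --> X](_ : 0 = (0 + 0) / 2); last by rewrite addr0 mul0r.
  apply: cvgMr_tmp; apply: cvgD.
    exact: (drift_row_cvg0 L1 shc1 s1).
  exact: (drift_row_cvg0 L2 shc2 s2).
have c0 : (signal_row M1 n * (2 * l2 (shape_limit h1) + 2) +
    signal_row M2 n * (2 * l2 (shape_limit h2) + 2)) / 2 @[n --> \oo] -->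
    (K1 * (2 * l2 (shape_limit h1) + 2) + K2 * (2 * l2 (shape_limit h2) + 2)) / 2.
  by apply: cvgMr_tmp; apply: cvgD; exact: cvgMr_tmp.
have : \sum_(i < k n) \int[N]_x (row_excess M1 i x * row_excess M2 i x) - A n
    @[n --> \oo] --> 0.
  apply: cvg0_of_trade_off c0 d0 => e e0; near=> n.
  by apply: row_cross_close => //; near: n;
    [exact: near_good_row shc1|exact: near_good_row shc2|
     exact: near_l2_hshape shc1|exact: near_l2_hshape shc2].
move=> /(cvgD AG); rewrite addr0; apply: cvg_trans; apply: near_eq_cvg.
by apply: nearW => n /=; rewrite addrC subrK.
Unshelve. all: by end_near.
Qed.

End row_covariances.

Section main_parts.
Context {R : realType} {k : nat -> nat}.
Variable M : pvalue_model R k.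
Variable h : R -> R.
Hypothesis Lh : L2_01 h.
Hypothesis shc : shape_cvg M h.

Lemma detectable_of_split (r : forall n, 'I_(k n)) :
  (forall n (i j : 'I_(k n)), (i <= j)%N ->
    eps M i / kappa M i <= eps M j / kappa M j) ->
  \sum_(i < k n | (r n <= i)%N) eps M i @[n --> \oo] --> +oo ->
  \sum_(i < k n | (i <= r n)%N) eps M i ^+ 2 / kappa M i @[n --> \oo] --> +oo ->
  completely_detectable (P_ R k) (Q_ M) (T_ M).
Proof.
move=> a_mono /cvgryPge eps_oo /cvgryPge sig_oo.
apply: (detectable_of_weights Lh shc); apply/cvgryPge => A; near=> n.
apply: le_trans (sum_weight_ge (r n) (@a_mono n)); rewrite le_min.
by apply/andP; split; near: n.
Unshelve. all: by end_near.
Qed.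

Lemma limit_varianceE (K : \bar R) : (0 <= K < +oo)%E ->
  fine (K * \int[lebesgue_measure]_(x in `]0%R, 1%R[) (h x ^+ 2)%:E)%E =
  fine K * l2 (shape_limit h).
Proof.
move=> /andP[K0 Koo]; rewrite /l2 integral_shape_limit fineM//.
  by rewrite ge0_fin_numE.
rewrite ge0_fin_numE; first exact: Lh.2.
by apply: integral_ge0 => x _; rewrite lee_fin sqr_ge0.
Qed.

End main_parts.

Theorem theorem4p1 (R : realType) (k : nat -> nat)
    (k_gt0 : forall n, (0 < k n)%N) (k_oo : k @ \oo --> \oo) :
  (forall (M : pvalue_model R k) (h : R -> R) (K : \bar R),
    (0 <= K)%E ->
    (\sum_(i < k n) eps M i ^+ 2 / kappa M i)%:E @[n --> \oo] --> K ->
    L2_01 h ->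
    (forall n (i : 'I_(k n)), L2_01 (hshape M i)) ->
    shape_cvg M h ->
    (forall n (i j : 'I_(k n)), (i <= j)%N ->
      eps M i / kappa M i <= eps M j / kappa M j) ->
    [/\ K = 0%E -> undetectable (P_ R k) (Q_ M),
        forall r : forall n, 'I_(k n),
          K = +oo%E ->
          \sum_(i < k n | (r n <= i)%N) eps M i @[n --> \oo] --> +oo ->
          \sum_(i < k n | (i <= r n)%N) eps M i ^+ 2 / kappa M i
            @[n --> \oo] --> +oo ->
          completely_detectable (P_ R k) (Q_ M) (T_ M),
        ((exists B : R, forall n, \sum_(i < k n) eps M i <= B) \/
            (K < +oo)%E) ->
          forall (s : nat -> nat) (xi : probability (\bar R) R),
            {homo s : m n / (m < n)%N} ->
            weak_cvg (fun n => distribution (P_ R k (s n)) (T_ M (s n))) xi ->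
            xi [set -oo%E; +oo%E] = 0%E
      & (0 < K < +oo)%E ->
          \big[Num.max/0]_(i < k n) (eps M i / kappa M i) @[n --> \oo] --> 0 ->
          asymptotic_normal M (fine
            (K * \int[lebesgue_measure]_(x in `]0%R, 1%R[) (h x ^+ 2)%:E)%E)])
  /\
  (forall (theta : 'I_2 -> pvalue_model R k) (h : 'I_2 -> R -> R)
      (K : 'I_2 -> R) (Gamma : R),
    (forall j, 0 < K j) ->
    (forall j, \sum_(i < k n) eps (theta j) i ^+ 2 / kappa (theta j) i
      @[n --> \oo] --> K j) ->
    (forall j, L2_01 (h j)) ->
    (forall j, shape_cvg (theta j) (h j)) ->
    (forall j, \big[Num.max/0]_(i < k n)
      (eps (theta j) i / kappa (theta j) i) @[n --> \oo] --> 0) ->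
    (let M1 := theta ord0 in let M2 := theta ord_max in
     (\sum_(i < k n)
        (eps M1 i * eps M2 i / (kappa M1 i * kappa M2 i))%:E *
        \int[lebesgue_measure]_(x in
            `]0%R, Num.min (kappa M1 i) (kappa M2 i)[)
          (hshape M1 i (x / kappa M1 i) * hshape M2 i (x / kappa M2 i))%:E)%E
       @[n --> \oo] --> Gamma%:E) ->
    exists (sigma : 'I_2 -> R) (gamma : 'I_2 -> 'I_2 -> R),
      [/\ forall j, 0 < sigma j /\ asymptotic_normal (theta j) (sigma j ^+ 2),
          forall j m,
            (\sum_(i < k n) (eps (theta j) i * eps (theta m) i)%:E *
               covariance (noise R)
                 (fine \o dens (signal (theta j) i) (noise R))
                 (fine \o dens (signal (theta m) i) (noise R)))%E
              @[n --> \oo] --> (gamma j m)%:E,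
          forall j, gamma j j = sigma j ^+ 2
        & gamma ord0 ord_max = Gamma]).
Proof.
split.
- move=> M h K K0 KE Lh _ shc a_mono; split.
  + move=> K00; apply: (undetectable_of_signal0 Lh shc).
    by have := signal_row_cvg_fin _ KE; rewrite K00; apply; rewrite lexx ltry.
  + by move=> r _; exact: (detectable_of_split Lh shc).
  + move=> [[B eB]|Koo] s xi.
      exact: (real_valued_limit Lh shc (tight_of_sum_eps Lh shc eB)).
    have sK : signal_row M n @[n --> \oo] --> fine K.
      by apply: signal_row_cvg_fin KE; rewrite K0.
    exact: (real_valued_limit Lh shc (tight_of_signal Lh shc sK)).
  + move=> /andP[Kp Koo] a0.
    have sK : signal_row M n @[n --> \oo] --> fine K.
      by apply: signal_row_cvg_fin KE; rewrite K0.
    rewrite (limit_varianceE Lh) ?K0//.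
    apply: (asymptotic_normal_of_signal Lh shc) => //.
      by rewrite fine_gt0// Kp.
    by have := l2_shape_limit_ge Lh shc k_gt0; lra.
- move=> theta h K Gamma K0 sK Lh shc a0 GE.
  have g0 j : 0 < l2 (shape_limit (h j)).
    by have := l2_shape_limit_ge (Lh j) (shc j) k_gt0; lra.
  pose v j := K j * l2 (shape_limit (h j)).
  have v0 j : 0 < v j by rewrite mulr_gt0.
  have good j := near_good_row (Lh j) (shc j).
  (* Covariances are exchanged for integrals of products of excesses, which is possible in the rows
     that are good for both models. *)
  have covE j m : (\sum_(i < k n) \int[noise R]_x
        (row_excess (theta j) i x * row_excess (theta m) i x))%:E @[n --> \oo] --> 
      (if j == m then v j else Gamma)%:E ->
    (\sum_(i < k n) (eps (theta j) i * eps (theta m) i)%:E *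
       covariance (noise R)
         (fine \o dens (signal (theta j) i) (noise R))
         (fine \o dens (signal (theta m) i) (noise R)))%E
      @[n --> \oo] --> (if j == m then v j else Gamma)%:E.
    apply: cvg_trans; apply: near_eq_cvg; near=> n.
    rewrite -sumEFin; apply: eq_bigr => i _; rewrite row_covarianceE//; near: n.
      exact: good j.
    exact: good m.
  have cross : \sum_(i < k n) \int[noise R]_x
      (row_excess (theta ord0) i x * row_excess (theta ord_max) i x) @[n --> \oo]
      --> Gamma.
    exact: (row_cross_cvg (Lh _) (Lh _) (shc _) (shc _) (sK _) (sK _) GE).
  (* Both off-diagonal entries are [Gamma], by symmetry of the product of excesses; the diagonal
     ones are the limits of the sums of variances. *)
  exists (fun j => Num.sqrt (v j)), (fun j m => if j == m then v j else Gamma).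
  split => //.
  + move=> j; split; first by rewrite sqrtr_gt0.
    rewrite sqr_sqrtr ?ltW//.
    exact: (asymptotic_normal_of_signal (Lh j) (shc j) (K0 j) (g0 j) (sK j) (a0 j)).
  + move=> j m; apply: covE; apply: cvg_EFin; first exact: nearW.
    rewrite /comp/=.
    have [<-|jm] := eqVneq j m.
      have := var_row_cvg (Lh j) (shc j) (sK j); apply: cvg_trans; apply: near_eq_cvg.
      apply: nearW => n; apply: eq_bigr => i _.
      by apply: eq_Rintegral => x _; rewrite expr2.
    have [[jE mE]|[jE mE]] : (j = ord0 /\ m = ord_max) \/ (j = ord_max /\ m = ord0).
      case: j m jm => [[|[|j]] lej] [[|[|m]] lem] //= _; [left|right];
        by split; apply: val_inj.
      by rewrite jE mE.
    rewrite jE mE; move: cross; apply: cvg_trans; apply: near_eq_cvg.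
    apply: nearW => n; apply: eq_bigr => i _.
    by apply: eq_Rintegral => x _; rewrite mulrC.
  + by move=> j; rewrite eqxx sqr_sqrtr// ltW.
Unshelve. all: by end_near.
Qed.
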